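(* Let $\{(x^i,y_i)\}_{i=1}^n\subset\mathbb{R}^d_+\times[K]$, $p_w,p_v,p_u\in(1,\infty)$, $\rho_w,\rho_v,\rho_u>0$, $\epsilon>0$, $n_1,n_2\in\mathbb{N}$, $\alpha\in\mathbb{R}^{n_1}$, $\beta\in\mathbb{R}^{n_2}$ with $\alpha_i\ge1$, $\beta_j\ge1$ for all $i,j$. Let $\rho_x=\max_{i\in[n]}\|x^i\|_{p_u'}$, $$\theta=\rho_v\Psi^\alpha_{p_v',p_u}(\mathbf{1},\rho_u\rho_x),\quad C_w=\rho_w\Psi^\beta_{p_w',p_v}(\mathbf{1},\theta),\quad C_v=\rho_w\Psi^\beta_{p_w',p_v}(\beta,\theta),\quad C_u=\|\alpha\|_\infty C_v,$$ and define $A\in\mathbb{R}^{(K+2)\times(K+2)}_{++}$ for $m,l\in[K]$ by $A_{m,l}=4(p_w'-1)C_w$, $A_{m,K+1}=2(p_w'-1)(2C_v+\|\beta\|_\infty)$, $A_{m,K+2}=2(p_w'-1)(2C_u+\|\alpha\|_\infty\|\beta\|_\infty)$, $A_{K+1,l}=2(p_v'-1)(2C_w+1)$, $A_{K+1,K+1}=2(p_v'-1)(2C_v+\|\beta\|_\infty-1)$, $A_{K+1,K+2}=2(p_v'-1)(2C_u+\|\alpha\|_\infty\|\beta\|_\infty)$, $A_{K+2,l}=2(p_u'-1)(2C_w+1)$, $A_{K+2,K+1}=2(p_u'-1)(2C_v+\|\beta\|_\infty)$, $A_{K+2,K+2}=2(p_u'-1)(2C_u+\|\alpha\|_\infty\|\beta\|_\infty-1)$.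 If $\rho(A)<1$, then $\max_{(w,v,u)\in S_+}\Phi(w,v,u)$ has a unique global maximizer $(w^*,v^*,u^* )$, which lies in $S_{++}$. Moreover, for every $(w^0,v^0,u^0)\in S_{++}$, the sequence $(w^{k+1},v^{k+1},u^{k+1})=G^\Phi(w^k,v^k,u^k)$ converges to $(w^*,v^*,u^* )$, and there exists $R>0$ with $\|(w^k,v^k,u^k)-(w^*,v^*,u^* )\|_\infty\le R\,\rho(A)^k$ for all $k\in\mathbb{N}$.
   Context: Notation: $\mathbb{R}_+=[0,\infty)$, $\mathbb{R}_{++}=(0,\infty)$, $[m]=\{1,\dots,m\}$; entrywise $\ell_p$ norms for matrices; $p'=p/(p-1)$; $\psi_p(z)=\operatorname{sign}(z)|z|^{p-1}$ componentwise; $\rho(A)$ spectral radius; $\mathbf{1}$ all-ones vector of appropriate size. Two-hidden-layer network with parameters $w\in\mathbb{R}^{K\times n_2}_+$ (rows $w_1,\dots,w_K$), $v\in\mathbb{R}^{n_2\times n_1}_+$, $u\in\mathbb{R}^{n_1\times d}_+$: $$f_r(w,v,u)(x)=\sum_{l=1}^{n_2}w_{r,l}\Big(\sum_{m=1}^{n_1}v_{lm}\Big(\sum_{s=1}^d u_{ms}x_s\Big)^{\alpha_m}\Big)^{\beta_l}.$$ Loss $L(y,f(x))=-f_y(x)+\log\sum_{j=1}^K e^{f_j(x)}$. Objective $$\Phi(w,v,u)=\frac1n\sum_{i=1}^n\Big[-L(y_i,f(x^i))+\sum_{r=1}^K f_r(x^i)\Big]+\epsilon\Big(\sum_{r,l}w_{r,l}+\sum_{l,m}v_{lm}+\sum_{m,s}u_{ms}\Big).$$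 $S_+=\{(w,v,u)\in\mathbb{R}^{K\times n_2}_+\times\mathbb{R}^{n_2\times n_1}_+\times\mathbb{R}^{n_1\times d}_+ : \|w_i\|_{p_w}=\rho_w\ \forall i\in[K],\ \|v\|_{p_v}=\rho_v,\ \|u\|_{p_u}=\rho_u\}$; $S_{++}$ the subset with all entries strictly positive. $G^\Phi=(G^\Phi_{w_1},\dots,G^\Phi_{w_K},G^\Phi_v,G^\Phi_u)$ with $G^\Phi_{w_i}=\rho_w\psi_{p_w'}(\nabla_{w_i}\Phi)/\|\psi_{p_w'}(\nabla_{w_i}\Phi)\|_{p_w}$, $G^\Phi_v=\rho_v\psi_{p_v'}(\nabla_v\Phi)/\|\psi_{p_v'}(\nabla_v\Phi)\|_{p_v}$, $G^\Phi_u=\rho_u\psi_{p_u'}(\nabla_u\Phi)/\|\psi_{p_u'}(\nabla_u\Phi)\|_{p_u}$. For $p,q\ge1$ and $\gamma\in\mathbb{R}^r_{++}$, $\Psi^\gamma_{p,q}(\delta,t)=\big([\sum_{l\in J}(\delta_lt^{\gamma_l})^{pq/(q-\bar\gamma p)}]^{1-\bar\gamma p/q}+\max_{j\in J^c}(\delta_jt^{\gamma_j})^p\big)^{1/p}$ for $\delta\in\mathbb{R}^r_{++}$, $t>0$, where $J=\{l:\gamma_lp<q\}$, $J^c=\{l:\gamma_lp\ge q\}$, $\bar\gamma=\min_{l\in J}\gamma_l$, empty sums/maxima $=0$. *)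

(* Defs.v *)
From Stdlib Require Import Reals Lra Lia Arith List.
Open Scope R_scope.

(* Indices are 0-based: [m] = {0,...,m-1}. Vectors/matrices are functions
   nat -> R / nat -> nat -> R; only entries within the bounds matter. *)

Fixpoint fsum (n : nat) (f : nat -> R) : R :=
  match n with O => 0 | S m => fsum m f + f m end.

(* finite maximum over 0..n-1 of quantities (used only for nonnegative ones);
   the empty maximum is 0, as in the paper *)
Fixpoint fmax (n : nat) (f : nat -> R) : R :=
  match n with O => 0 | S m => Rmax (fmax m f) (f m) end.

Definition linf (n : nat) (f : nat -> R) : R := fmax n (fun i => Rabs (f i)).

(* real power x^a for x >= 0, with the convention 0^a = 0 (a > 0 throughout) *)
Definition rpow (x a : R) : R := if Rlt_dec 0 x then Rpower x a else 0.

Definition conj (p : R) : R := p / (p - 1).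

Definition psi (p z : R) : R :=
  if Rlt_dec 0 z then rpow z (p - 1)
  else if Rlt_dec z 0 then - rpow (- z) (p - 1) else 0.

Definition lpnorm (p : R) (n : nat) (f : nat -> R) : R :=
  rpow (fsum n (fun i => rpow (Rabs (f i)) p)) (1 / p).
Definition lpnorm2 (p : R) (m n : nat) (F : nat -> nat -> R) : R :=
  rpow (fsum m (fun i => fsum n (fun j => rpow (Rabs (F i j)) p))) (1 / p).

Fixpoint fmin_on (P : nat -> bool) (g : nat -> R) (n : nat) : option R :=
  match n with
  | O => None
  | S m =>
      let prev := fmin_on P g m in
      if P m then match prev with None => Some (g m) | Some a => Some (Rmin a (g m)) end
      else prev
  end.

Definition inJ (gamma : nat -> R) (p q : R) (l : nat) : bool :=
  if Rlt_dec (gamma l * p) q then true else false.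

Definition Psi (p q : R) (r : nat) (gamma delta : nat -> R) (t : R) : R :=
  let J := inJ gamma p q in
  let term1 :=
    match fmin_on J gamma r with
    | None => 0
    | Some gbar =>
        rpow (fsum r (fun l => if J l
                               then rpow (delta l * rpow t (gamma l)) (p * q / (q - gbar * p))
                               else 0))
             (1 - gbar * p / q)
    end in
  let term2 := fmax r (fun j => if J j then 0 else rpow (delta j * rpow t (gamma j)) p) in
  rpow (term1 + term2) (1 / p).

(* parameters (w, v, u): w is K x n2, v is n2 x n1, u is n1 x d *)
Record Par := mkPar { PW : nat -> nat -> R; PV : nat -> nat -> R; PU : nat -> nat -> R }.

Definition fnet (n1 n2 d : nat) (alpha beta : nat -> R) (z : Par) (x : nat -> R) (r : nat) : R :=
  fsum n2 (fun l => PW z r l *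
    rpow (fsum n1 (fun m => PV z l m * rpow (fsum d (fun s => PU z m s * x s)) (alpha m)))
         (beta l)).

Definition loss (K : nat) (yy : nat) (f : nat -> R) : R :=
  - f yy + ln (fsum K (fun j => exp (f j))).

Definition Phi (K n n1 n2 d : nat) (alpha beta : nat -> R) (eps : R)
  (x : nat -> nat -> R) (y : nat -> nat) (z : Par) : R :=
  (1 / INR n) * fsum n (fun i =>
      let f := fnet n1 n2 d alpha beta z (x i) in
      - loss K (y i) f + fsum K f)
  + eps * (fsum K (fun r => fsum n2 (PW z r))
           + fsum n2 (fun l => fsum n1 (PV z l))
           + fsum n1 (fun m => fsum d (PU z m))).

Definition InSplus (K n1 n2 d : nat) (pw pv pu rw rv ru : R) (z : Par) : Prop :=
  (forall r l, (r < K)%nat -> (l < n2)%nat -> 0 <= PW z r l) /\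
  (forall l m, (l < n2)%nat -> (m < n1)%nat -> 0 <= PV z l m) /\
  (forall m s, (m < n1)%nat -> (s < d)%nat -> 0 <= PU z m s) /\
  (forall r, (r < K)%nat -> lpnorm pw n2 (PW z r) = rw) /\
  lpnorm2 pv n2 n1 (PV z) = rv /\
  lpnorm2 pu n1 d (PU z) = ru.

Definition InSpp (K n1 n2 d : nat) (pw pv pu rw rv ru : R) (z : Par) : Prop :=
  InSplus K n1 n2 d pw pv pu rw rv ru z /\
  (forall r l, (r < K)%nat -> (l < n2)%nat -> 0 < PW z r l) /\
  (forall l m, (l < n2)%nat -> (m < n1)%nat -> 0 < PV z l m) /\
  (forall m s, (m < n1)%nat -> (s < d)%nat -> 0 < PU z m s).

Definition distinf (K n1 n2 d : nat) (z z' : Par) : R :=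
  Rmax (Rmax (fmax K (fun r => fmax n2 (fun l => Rabs (PW z r l - PW z' r l))))
             (fmax n2 (fun l => fmax n1 (fun m => Rabs (PV z l m - PV z' l m)))))
       (fmax n1 (fun m => fmax d (fun s => Rabs (PU z m s - PU z' m s)))).

Definition upd2 (F : nat -> nat -> R) (a b : nat) (t : R) : nat -> nat -> R :=
  fun i j => if andb (Nat.eqb i a) (Nat.eqb j b) then t else F i j.

Definition is_grad (K n1 n2 d : nat) (Ph : Par -> R) (z : Par)
  (gW gV gU : nat -> nat -> R) : Prop :=
  (forall r l, (r < K)%nat -> (l < n2)%nat ->
     derivable_pt_lim (fun t => Ph (mkPar (upd2 (PW z) r l t) (PV z) (PU z))) (PW z r l) (gW r l)) /\
  (forall l m, (l < n2)%nat -> (m < n1)%nat ->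
     derivable_pt_lim (fun t => Ph (mkPar (PW z) (upd2 (PV z) l m t) (PU z))) (PV z l m) (gV l m)) /\
  (forall m s, (m < n1)%nat -> (s < d)%nat ->
     derivable_pt_lim (fun t => Ph (mkPar (PW z) (PV z) (upd2 (PU z) m s t))) (PU z m s) (gU m s)).

Definition Gstep (K n1 n2 d : nat) (pw pv pu rw rv ru : R) (Ph : Par -> R) (z z' : Par) : Prop :=
  exists gW gV gU, is_grad K n1 n2 d Ph z gW gV gU /\
  (forall r l, (r < K)%nat -> (l < n2)%nat ->
     PW z' r l = rw * psi (conj pw) (gW r l)
                 / lpnorm pw n2 (fun l' => psi (conj pw) (gW r l'))) /\
  (forall l m, (l < n2)%nat -> (m < n1)%nat ->
     PV z' l m = rv * psi (conj pv) (gV l m)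
                 / lpnorm2 pv n2 n1 (fun l' m' => psi (conj pv) (gV l' m'))) /\
  (forall m s, (m < n1)%nat -> (s < d)%nat ->
     PU z' m s = ru * psi (conj pu) (gU m s)
                 / lpnorm2 pu n1 d (fun m' s' => psi (conj pu) (gU m' s'))).

(* the (K+2) x (K+2) matrix A; indices 0..K-1 are [K], K is "K+1", K+1 is "K+2" *)
Definition Amat (K : nat) (pw pv pu Cw Cv Cu ainf binf : R) : nat -> nat -> R :=
  fun i j =>
    if Nat.ltb i K then
      (if Nat.ltb j K then 4 * (conj pw - 1) * Cw
       else if Nat.eqb j K then 2 * (conj pw - 1) * (2 * Cv + binf)
       else 2 * (conj pw - 1) * (2 * Cu + ainf * binf))
    else if Nat.eqb i K then
      (if Nat.ltb j K then 2 * (conj pv - 1) * (2 * Cw + 1)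
       else if Nat.eqb j K then 2 * (conj pv - 1) * (2 * Cv + binf - 1)
       else 2 * (conj pv - 1) * (2 * Cu + ainf * binf))
    else
      (if Nat.ltb j K then 2 * (conj pu - 1) * (2 * Cw + 1)
       else if Nat.eqb j K then 2 * (conj pu - 1) * (2 * Cv + binf)
       else 2 * (conj pu - 1) * (2 * Cu + ainf * binf - 1)).

(* a + i b is a (complex) eigenvalue of the real N x N matrix A:
   A (x + i y) = (a + i b)(x + i y) with x + i y <> 0 *)
Definition is_eigenvalue (N : nat) (A : nat -> nat -> R) (a b : R) : Prop :=
  exists xr xi : nat -> R,
    (exists k, (k < N)%nat /\ (xr k <> 0 \/ xi k <> 0)) /\
    forall i, (i < N)%nat ->
      fsum N (fun j => A i j * xr j) = a * xr i - b * xi i /\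
      fsum N (fun j => A i j * xi j) = b * xr i + a * xi i.

Definition is_spectral_radius (N : nat) (A : nat -> nat -> R) (rho : R) : Prop :=
  (exists a b, is_eigenvalue N A a b /\ rho = sqrt (a ^ 2 + b ^ 2)) /\
  (forall a b, is_eigenvalue N A a b -> sqrt (a ^ 2 + b ^ 2) <= rho).

(* Main.v *)
Require Import Defs.
From Stdlib Require Import Reals Ranalysis5 Lra Lia Arith List Classical IndefiniteDescription.
Open Scope R_scope.

(* The iteration is studied in the metric |ln u - ln v| on positive entries.  When each block of
   parameters moves by a bounded factor, every term of the gradient of Phi changes by a controlled
   factor: monomials in the layers contribute the exponents 1, beta, alpha beta, and the softmax
   weights contribute twice the variation of the outputs, which is bounded through Hoelder's
   inequality by Cw, Cv and Cu.  The duality map psi_{p'} and the normalization multiply these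
   exponents by 2(p' - 1), so the log-distances of the blocks are multiplied by A.  Measured with
   the right Perron vector of A as weights, the map contracts by the Perron eigenvalue.
   A maximizer exists by compactness.  It has no zero entry, since by the epsilon term raising a
   zero entry to t gains order t while the norm constraint costs only order t^p, p > 1; it is
   therefore a fixed point of the map by the Lagrange conditions, and contraction gives both its
   uniqueness and the rate. *)

(** * Finite sums and maxima *)

(** Adding the sum of all outputs to -L makes the coefficient of every output derivative
    nonnegative. Each partial derivative of the objective is therefore a sum of nonnegative terms
    without cancellation, and multiplicative comparison passes through it. Differentiating in one
    layer lowers the degree in that layer by one; this is the -1 in the diagonal entries of A for v
    and u, and it turns 2 Cw + 1 into 2 Cw in the w-block. The outputs have to be bounded along
    whole geodesics, which leave the spheres but not the balls, so all norm constraints are relaxed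
    to inequalities there. The Perron vector is explicit: up to a diagonal factor A is a rank-one
    matrix minus a block matrix of ones, so that one scalar equation yields a positive eigenvector,
    and the definition of the spectral radius bounds its eigenvalue. The derivative formula is
    established only at positive entries, so the positivity of a maximizer rests on finite
    comparisons instead: scaling an entry by exp(-s) costs at most C s, and raising an entry from 0
    never lowers the network part of the objective. *)

Lemma fsum_ext n f g : (forall i, (i < n)%nat -> f i = g i) -> fsum n f = fsum n g.
Proof.
  induction n as [|n IH]; simpl; intros H; [reflexivity|].
  rewrite IH, (H n); [reflexivity|lia|intros; apply H; lia].
Qed.

Lemma fsum_le n f g : (forall i, (i < n)%nat -> f i <= g i) -> fsum n f <= fsum n g.
Proof.
  induction n as [|n IH]; simpl; intros H; [lra|].
  assert (f n <= g n) by (apply H; lia).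
  assert (fsum n f <= fsum n g) by (apply IH; intros; apply H; lia). lra.
Qed.

Lemma fsum_0 n : fsum n (fun _ => 0) = 0.
Proof. induction n as [|n IH]; simpl; lra. Qed.

Lemma fsum_nonneg n f : (forall i, (i < n)%nat -> 0 <= f i) -> 0 <= fsum n f.
Proof. intros H. rewrite <- (fsum_0 n). now apply fsum_le. Qed.

Lemma fsum_plus n f g : fsum n (fun i => f i + g i) = fsum n f + fsum n g.
Proof. induction n as [|n IH]; simpl; [lra|rewrite IH; lra]. Qed.

Lemma fsum_scal n c f : fsum n (fun i => c * f i) = c * fsum n f.
Proof. induction n as [|n IH]; simpl; [lra|rewrite IH; lra]. Qed.

Lemma fsum_term_le n f k : (forall i, (i < n)%nat -> 0 <= f i) -> (k < n)%nat -> f k <= fsum n f.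
Proof.
  induction n as [|n IH]; simpl; intros H Hk; [lia|].
  destruct (Nat.eq_dec k n) as [->|Hne].
  - assert (0 <= fsum n f) by (apply fsum_nonneg; intros; apply H; lia). lra.
  - assert (f k <= fsum n f) by (apply IH; [intros; apply H; lia|lia]).
    assert (0 <= f n) by (apply H; lia). lra.
Qed.

Lemma fsum_pos n f k :
  (forall i, (i < n)%nat -> 0 <= f i) -> (k < n)%nat -> 0 < f k -> 0 < fsum n f.
Proof. intros H Hk Hp. pose proof (fsum_term_le n f k H Hk). lra. Qed.

Lemma fsum_eq0_term n f k :
  (forall i, (i < n)%nat -> 0 <= f i) -> fsum n f = 0 -> (k < n)%nat -> f k = 0.
Proof.
  intros H H0 Hk. pose proof (fsum_term_le n f k H Hk). specialize (H k Hk). lra.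
Qed.

Lemma fsum_neq0_term n f : fsum n f <> 0 -> exists k, (k < n)%nat /\ f k <> 0.
Proof.
  induction n as [|n IH]; simpl; intros H; [lra|].
  destruct (Req_dec (f n) 0) as [E|E]; [|exists n; split; [lia|exact E]].
  destruct IH as [k [Hk Hf]]; [lra|]. exists k; split; [lia|exact Hf].
Qed.

Lemma fsum_abs n f : Rabs (fsum n f) <= fsum n (fun i => Rabs (f i)).
Proof.
  induction n as [|n IH]; simpl; [rewrite Rabs_R0; lra|].
  eapply Rle_trans; [apply Rabs_triang|lra].
Qed.

Lemma fsum_const n c : fsum n (fun _ => c) = INR n * c.
Proof.
  induction n as [|n IH]; [simpl; lra|]. rewrite S_INR. simpl fsum. rewrite IH. lra.
Qed.

Lemma fsum_split n k f : fsum (n + k) f = fsum n f + fsum k (fun i => f (n + i)%nat).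
Proof.
  induction k as [|k IH]; simpl; [rewrite Nat.add_0_r; lra|].
  rewrite Nat.add_succ_r. simpl. rewrite IH. lra.
Qed.

Lemma fsum_derivable n (f : nat -> R -> R) (df : nat -> R) t :
  (forall i, (i < n)%nat -> derivable_pt_lim (f i) t (df i)) ->
  derivable_pt_lim (fun s => fsum n (fun i => f i s)) t (fsum n df).
Proof.
  induction n as [|n IH]; simpl; intros H.
  - apply derivable_pt_lim_const.
  - apply (derivable_pt_lim_plus (fun s => fsum n (fun i => f i s)) (f n)).
    + apply IH; intros; apply H; lia.
    + apply H; lia.
Qed.

Lemma Un_cv_const c : Un_cv (fun _ => c) c.
Proof.
  intros e He; exists 0%nat; intros. unfold Rdist. rewrite Rminus_diag, Rabs_R0; lra.
Qed.

Lemma fsum_Un_cv n (u : nat -> nat -> R) (l : nat -> R) :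
  (forall i, (i < n)%nat -> Un_cv (fun k => u k i) (l i)) ->
  Un_cv (fun k => fsum n (u k)) (fsum n l).
Proof.
  induction n as [|n IH]; simpl; intros H.
  - apply Un_cv_const.
  - apply (CV_plus (fun k => fsum n (u k)) (fun k => u k n)).
    + apply IH; intros; apply H; lia.
    + apply H; lia.
Qed.

Lemma fmax_nonneg n f : 0 <= fmax n f.
Proof.
  induction n as [|n IH]; simpl; [lra|]. eapply Rle_trans; [exact IH|apply Rmax_l].
Qed.

Lemma fmax_ge n f k : (k < n)%nat -> f k <= fmax n f.
Proof.
  induction n as [|n IH]; simpl; intros Hk; [lia|].
  destruct (Nat.eq_dec k n) as [->|Hne]; [apply Rmax_r|].
  eapply Rle_trans; [apply IH; lia|apply Rmax_l].
Qed.

Lemma fmax_le n f c : 0 <= c -> (forall i, (i < n)%nat -> f i <= c) -> fmax n f <= c.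
Proof.
  induction n as [|n IH]; simpl; intros Hc H; [lra|].
  apply Rmax_lub; [apply IH; [lra|intros; apply H; lia]|apply H; lia].
Qed.

Lemma linf_ge n f k : (k < n)%nat -> f k <= linf n f.
Proof.
  intros Hk. eapply Rle_trans; [apply Rle_abs|]. apply (fmax_ge n (fun i => Rabs (f i))), Hk.
Qed.

(** * Real powers with the convention [rpow 0 a = 0] *)

Lemma rpow_pos_eq x a : 0 < x -> rpow x a = Rpower x a.
Proof. intros; unfold rpow; destruct (Rlt_dec 0 x); [reflexivity|lra]. Qed.

Lemma rpow_npos x a : x <= 0 -> rpow x a = 0.
Proof. intros; unfold rpow; destruct (Rlt_dec 0 x); [lra|reflexivity]. Qed.

Lemma rpow_0 a : rpow 0 a = 0.
Proof. apply rpow_npos; lra. Qed.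

Lemma rpow_gt0 x a : 0 < x -> 0 < rpow x a.
Proof. intros; rewrite rpow_pos_eq by assumption. apply exp_pos. Qed.

Lemma rpow_nonneg x a : 0 <= rpow x a.
Proof. unfold rpow; destruct (Rlt_dec 0 x); [left; apply exp_pos|lra]. Qed.

(** No sign condition appears because both sides are 0 for x <= 0 by the convention. *)
Lemma rpow_rpow x a b : rpow (rpow x a) b = rpow x (a * b).
Proof.
  destruct (Rlt_dec 0 x) as [H|H].
  - rewrite (rpow_pos_eq (rpow x a)) by now apply rpow_gt0.
    rewrite !rpow_pos_eq by assumption. apply Rpower_mult.
  - rewrite !(rpow_npos x) by lra. apply rpow_0.
Qed.

Lemma rpow_mul x y a : 0 <= x -> 0 <= y -> rpow (x * y) a = rpow x a * rpow y a.
Proof.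
  intros [Hx| <-] [Hy| <-]; rewrite ?Rmult_0_l, ?Rmult_0_r, ?rpow_0; try lra.
  rewrite !rpow_pos_eq; try assumption; [|now apply Rmult_lt_0_compat].
  symmetry; now apply Rpower_mult_distr.
Qed.

Lemma rpow_add x a b : rpow x (a + b) = rpow x a * rpow x b.
Proof.
  destruct (Rlt_dec 0 x) as [H|H].
  - rewrite !rpow_pos_eq by assumption. apply Rpower_plus.
  - rewrite !rpow_npos by lra. lra.
Qed.

Lemma rpow_1 x : 0 <= x -> rpow x 1 = x.
Proof.
  intros [Hx| <-]; [|apply rpow_0]. rewrite rpow_pos_eq by assumption. now apply Rpower_1.
Qed.

Lemma rpow_one a : rpow 1 a = 1.
Proof. rewrite rpow_pos_eq by lra. unfold Rpower. rewrite ln_1, Rmult_0_r. apply exp_0. Qed.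

Lemma rpow_cancel x a b : 0 <= x -> a * b = 1 -> rpow (rpow x a) b = x.
Proof. intros Hx Hab. rewrite rpow_rpow, Hab. now apply rpow_1. Qed.

Lemma rpow_inv x a : 0 < x -> rpow (/ x) a = / rpow x a.
Proof.
  intros Hx. pose proof (Rinv_0_lt_compat x Hx). pose proof (rpow_gt0 x a Hx).
  apply Rmult_eq_reg_r with (rpow x a); [|lra].
  rewrite <- rpow_mul by lra. rewrite !Rinv_l by lra. apply rpow_one.
Qed.

Lemma rpow_le x y a : 0 <= x <= y -> 0 <= a -> rpow x a <= rpow y a.
Proof.
  intros [[Hx| <-] Hxy] Ha; [|rewrite rpow_0; apply rpow_nonneg].
  rewrite !rpow_pos_eq by lra. apply Rle_Rpower_l; lra.
Qed.

Lemma rpow_le_exponent x a b : 0 <= x <= 1 -> a <= b -> rpow x b <= rpow x a.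
Proof.
  intros [[Hx| <-] Hx1] Hab; [|rewrite !rpow_0; lra].
  rewrite !rpow_pos_eq by lra. unfold Rpower.
  assert (ln x <= 0).
  { rewrite <- ln_1. destruct Hx1 as [?| ->]; [left; now apply ln_increasing|lra]. }
  assert (b * ln x <= a * ln x) by nra.
  destruct (Rle_lt_or_eq_dec _ _ H0) as [H1|H1]; [left; now apply exp_increasing|rewrite H1; lra].
Qed.

Lemma rpow_exp s a : rpow (exp s) a = exp (s * a).
Proof. rewrite rpow_pos_eq by apply exp_pos. unfold Rpower. rewrite ln_exp. f_equal; ring. Qed.

Lemma exp_le x y : x <= y -> exp x <= exp y.
Proof. intros [H| ->]; [left; now apply exp_increasing|lra]. Qed.

Lemma rpow_derivable (f : R -> R) t df a : 0 < f t -> derivable_pt_lim f t df ->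
  derivable_pt_lim (fun s => rpow (f s) a) t (a * rpow (f t) (a - 1) * df).
Proof.
  intros Hp Hf.
  apply (derivable_pt_lim_comp f (fun x => rpow x a)); [exact Hf|].
  apply derivable_pt_lim_locally_ext with (f := fun x => Rpower x a) (a := 0) (b := f t + 1).
  - lra.
  - intros z Hz. now rewrite rpow_pos_eq by lra.
  - rewrite rpow_pos_eq by assumption. now apply derivable_pt_lim_power.
Qed.

Lemma rpow_small a e : 0 < a -> 0 < e -> exists d, 0 < d /\ forall x, x < d -> rpow x a < e.
Proof.
  intros Ha He. exists (rpow e (1 / a)). split; [now apply rpow_gt0|].
  intros x Hx. destruct (Rlt_dec 0 x) as [H|H]; [|rewrite rpow_npos; lra].
  replace e with (rpow (rpow e (1 / a)) a).
  2:{ apply rpow_cancel; [lra|field; lra]. }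
  rewrite !(rpow_pos_eq _ a); try assumption; [|now apply rpow_gt0].
  apply Rlt_Rpower_l; lra.
Qed.

(** For a > 0 the default value 0 on x <= 0 is the continuous extension, so limits may be taken at
    parameters with zero entries. *)
Lemma rpow_continuous a x : 0 < a -> continuity_pt (fun y => rpow y a) x.
Proof.
  intros Ha. destruct (Rtotal_order x 0) as [H|[H|H]].
  - apply continuity_pt_locally_ext with (f := fct_cte 0) (a := - x).
    + lra.
    + intros y Hy. unfold Rdist in Hy. unfold fct_cte.
      rewrite rpow_npos; [reflexivity|]. apply Rabs_def2 in Hy. lra.
    + apply continuity_pt_const. intros u v; reflexivity.
  - subst x. intros e He. destruct (rpow_small a e Ha He) as [d [Hd Hs]].
    exists d; split; [exact Hd|]. intros y [_ Hy]. simpl in *. unfold Rdist in *.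
    rewrite rpow_0, Rminus_0_r in *. rewrite Rabs_pos_eq by apply rpow_nonneg.
    apply Hs. apply Rabs_def2 in Hy. lra.
  - apply derivable_continuous_pt. eexists.
    apply (rpow_derivable (fun y => y) x 1 a H). apply derivable_pt_lim_id.
Qed.

Lemma rpow_Un_cv a u l : 0 < a -> Un_cv u l -> Un_cv (fun k => rpow (u k) a) (rpow l a).
Proof. intros Ha Hu. apply (continuity_seq (fun y => rpow y a)); [now apply rpow_continuous|exact Hu]. Qed.

(** * Young, Hoelder and entrywise norms *)

Lemma weighted_amgm x y th : 0 < th < 1 -> 0 <= x -> 0 <= y ->
  rpow x th * rpow y (1 - th) <= th * x + (1 - th) * y.
Proof.
  intros Hth [Hx| <-] [Hy| <-]; rewrite ?rpow_0; try nra.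
  set (m := th * x + (1 - th) * y). assert (Hm : 0 < m) by (unfold m; nra).
  (* The concave logarithm lies below its tangent at the weighted mean m; averaging the two tangent
     estimates with weights th and 1 - th leaves exactly ln m. *)
  assert (L : forall z, 0 < z -> ln z <= ln m + z / m - 1).
  { intros z Hz. assert (Hzm : 0 < z / m) by now apply Rdiv_lt_0_compat.
    pose proof (exp_ineq1_le (ln (z / m))) as E. rewrite exp_ln in E by assumption.
    unfold Rdiv in E at 1. rewrite ln_mult, ln_Rinv in E by (try apply Rinv_0_lt_compat; assumption).
    lra. }
  rewrite !rpow_pos_eq by assumption. unfold Rpower. rewrite <- exp_plus.
  rewrite <- (exp_ln m) by assumption. apply exp_le.
  pose proof (L x Hx). pose proof (L y Hy).
  assert (th * (x / m) + (1 - th) * (y / m) = 1) by (unfold m; field; fold m; lra).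
  nra.
Qed.

(** Termwise arithmetic-geometric mean after dividing X and Y by their sums; a vanishing sum forces
    all its terms to vanish. The form with exponents th and 1 - th serves both the dual norms and
    the exponents inside [Psi]. *)
Lemma fsum_holder n X Y th : 0 < th < 1 ->
  (forall i, (i < n)%nat -> 0 <= X i) -> (forall i, (i < n)%nat -> 0 <= Y i) ->
  fsum n (fun i => rpow (X i) th * rpow (Y i) (1 - th))
  <= rpow (fsum n X) th * rpow (fsum n Y) (1 - th).
Proof.
  intros Hth HX HY.
  assert (P0 : 0 <= rpow (fsum n X) th * rpow (fsum n Y) (1 - th))
    by (apply Rmult_le_pos; apply rpow_nonneg).
  destruct (fsum_nonneg n X HX) as [SX|SX]; cycle 1.
  { rewrite (fsum_ext n _ (fun _ => 0)); [rewrite fsum_0; exact P0|].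
    intros i Hi. rewrite (fsum_eq0_term n X i HX (eq_sym SX) Hi), rpow_0. ring. }
  destruct (fsum_nonneg n Y HY) as [SY|SY]; cycle 1.
  { rewrite (fsum_ext n _ (fun _ => 0)); [rewrite fsum_0; exact P0|].
    intros i Hi. rewrite (fsum_eq0_term n Y i HY (eq_sym SY) Hi), rpow_0. ring. }
  set (c := rpow (fsum n X) th * rpow (fsum n Y) (1 - th)).
  apply Rle_trans with (fsum n (fun i => c * (th * (/ fsum n X * X i) + (1 - th) * (/ fsum n Y * Y i)))).
  - apply fsum_le. intros i Hi.
    pose proof (Rinv_0_lt_compat _ SX) as IX. pose proof (Rinv_0_lt_compat _ SY) as IY.
    specialize (HX i Hi). specialize (HY i Hi).
    assert (W := weighted_amgm (/ fsum n X * X i) (/ fsum n Y * Y i) th Hth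
               ltac:(apply Rmult_le_pos; lra) ltac:(apply Rmult_le_pos; lra)).
    apply Rmult_le_compat_l with (r := c) in W; [|exact P0].
    eapply Rle_trans; [|exact W]. right.
    rewrite !rpow_mul by lra. rewrite !rpow_inv by lra. unfold c. field.
    split; apply Rgt_not_eq, rpow_gt0; lra.
  - rewrite fsum_scal, fsum_plus, !fsum_scal. right. field. lra.
Qed.

Lemma conj_gt1 p : 1 < p -> 1 < conj p.
Proof.
  intros Hp. unfold conj. apply Rmult_lt_reg_r with (p - 1); [lra|].
  unfold Rdiv. rewrite Rmult_assoc, Rinv_l; lra.
Qed.

Lemma conj_m1 p : 1 < p -> (p - 1) * (conj p - 1) = 1.
Proof. intros Hp. unfold conj. field. lra. Qed.

Lemma holder_conj n a b p : 1 < p ->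
  (forall i, (i < n)%nat -> 0 <= a i) -> (forall i, (i < n)%nat -> 0 <= b i) ->
  fsum n (fun i => a i * b i)
  <= rpow (fsum n (fun i => rpow (a i) p)) (1 / p)
     * rpow (fsum n (fun i => rpow (b i) (conj p))) (1 / conj p).
Proof.
  intros Hp Ha Hb.
  assert (Hc := conj_gt1 p Hp).
  assert (Ht : 0 < 1 / p < 1).
  { split; [apply Rdiv_lt_0_compat; lra|]. apply Rmult_lt_reg_r with p; [lra|].
    unfold Rdiv. rewrite Rmult_assoc, Rinv_l; lra. }
  assert (E : 1 / conj p = 1 - 1 / p) by (unfold conj; field; lra).
  rewrite E. eapply Rle_trans; [|apply fsum_holder; [exact Ht| |]; intros; apply rpow_nonneg].
  right. apply fsum_ext. intros i Hi.
  rewrite (rpow_cancel (a i)); [|now apply Ha|field; lra].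
  rewrite <- E, (rpow_cancel (b i)); [reflexivity|now apply Hb|field; lra].
Qed.

(** A row of w is treated as a matrix with one row, so that all blocks share the lemmas on
    [lpnorm2]. *)
Lemma lpnorm_row p n f : lpnorm p n f = lpnorm2 p 1 n (fun _ => f).
Proof. unfold lpnorm, lpnorm2. simpl. now rewrite Rplus_0_l. Qed.

Lemma lpnorm2_ext p m n F G :
  (forall i j, (i < m)%nat -> (j < n)%nat -> F i j = G i j) -> lpnorm2 p m n F = lpnorm2 p m n G.
Proof.
  intros H. unfold lpnorm2. f_equal. apply fsum_ext. intros i Hi. apply fsum_ext. intros j Hj.
  now rewrite H.
Qed.

Lemma fsum2_nonneg m n F : (forall i j, (i < m)%nat -> (j < n)%nat -> 0 <= F i j) ->
  0 <= fsum m (fun i => fsum n (F i)).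
Proof. intros H. apply fsum_nonneg; intros; apply fsum_nonneg; auto. Qed.

Lemma fsum2_term_le m n F a b : (forall i j, (i < m)%nat -> (j < n)%nat -> 0 <= F i j) ->
  (a < m)%nat -> (b < n)%nat -> F a b <= fsum m (fun i => fsum n (F i)).
Proof.
  intros H Ha Hb. apply Rle_trans with (fsum n (F a)).
  - apply fsum_term_le; auto.
  - apply (fsum_term_le m (fun i => fsum n (F i))); [intros; apply fsum_nonneg; auto|assumption].
Qed.

Lemma lpnorm2_sum p m n F c : 0 < p -> 0 < c ->
  lpnorm2 p m n F = c <-> fsum m (fun i => fsum n (fun j => rpow (Rabs (F i j)) p)) = rpow c p.
Proof.
  intros Hp Hc. unfold lpnorm2. split; intros H.
  - rewrite <- H. symmetry. apply rpow_cancel; [|field; lra].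
    apply fsum2_nonneg. intros; apply rpow_nonneg.
  - rewrite H. apply rpow_cancel; [lra|field; lra].
Qed.

Lemma lpnorm2_gt0 p m n F a b : (a < m)%nat -> (b < n)%nat -> F a b <> 0 -> 0 < lpnorm2 p m n F.
Proof.
  intros Ha Hb H. apply rpow_gt0.
  eapply Rlt_le_trans; [|apply (fsum2_term_le m n (fun i j => rpow (Rabs (F i j)) p) a b); auto;
    intros; apply rpow_nonneg].
  apply rpow_gt0. now apply Rabs_pos_lt.
Qed.

Lemma lpnorm2_scal p m n c F : 0 < p -> 0 <= c ->
  lpnorm2 p m n (fun i j => c * F i j) = c * lpnorm2 p m n F.
Proof.
  intros Hp Hc. unfold lpnorm2.
  replace (c * _) with (rpow (rpow c p) (1 / p) *
    rpow (fsum m (fun i => fsum n (fun j => rpow (Rabs (F i j)) p))) (1 / p))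
    by (f_equal; apply rpow_cancel; [lra|field; lra]).
  rewrite <- rpow_mul; [|apply rpow_nonneg|apply fsum2_nonneg; intros; apply rpow_nonneg].
  f_equal. rewrite <- fsum_scal. apply fsum_ext. intros i Hi.
  rewrite <- fsum_scal. apply fsum_ext. intros j Hj.
  rewrite Rabs_mult, rpow_mul, (Rabs_pos_eq c) by (assumption || apply Rabs_pos). reflexivity.
Qed.

Lemma lpnorm2_normalize p m n c F : 0 < p -> 0 < c -> 0 < lpnorm2 p m n F ->
  lpnorm2 p m n (fun i j => c * F i j / lpnorm2 p m n F) = c.
Proof.
  intros Hp Hc HF.
  rewrite (lpnorm2_ext p m n _ (fun i j => (c / lpnorm2 p m n F) * F i j))
    by (intros; field; lra).
  rewrite lpnorm2_scal; [field; lra|assumption|].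
  left. now apply Rdiv_lt_0_compat.
Qed.

Lemma lpnorm2_entry_le p m n F a b : 0 < p -> (a < m)%nat -> (b < n)%nat ->
  Rabs (F a b) <= lpnorm2 p m n F.
Proof.
  intros Hp Ha Hb. unfold lpnorm2.
  rewrite <- (rpow_cancel (Rabs (F a b)) p (1 / p)); [|apply Rabs_pos|field; lra].
  apply rpow_le; [split; [apply rpow_nonneg|]|left; apply Rdiv_lt_0_compat; lra].
  apply (fsum2_term_le m n (fun i j => rpow (Rabs (F i j)) p)); auto. intros; apply rpow_nonneg.
Qed.

(** * Two-sided comparison up to a factor [exp s] *)

(** Multiplicative form of ln a - ln b <= s. It still makes sense at zero entries and passes through
    sums, which the logarithm does not; it is one-sided and also records a >= 0. *)
Definition ratio_le (s a b : R) : Prop := 0 <= a /\ a <= exp s * b.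

Lemma ratio_le_nonneg_r s a b : ratio_le s a b -> 0 <= b.
Proof. intros [H1 H2]. pose proof (exp_pos s). nra. Qed.

Lemma ratio_le_weaken s s' a b : ratio_le s a b -> s <= s' -> ratio_le s' a b.
Proof.
  intros H Hs. pose proof (ratio_le_nonneg_r _ _ _ H). destruct H as [H1 H2]. split; [lra|].
  pose proof (exp_le _ _ Hs). nra.
Qed.

Lemma ratio_le_refl s a : 0 <= s -> 0 <= a -> ratio_le s a a.
Proof.
  intros Hs Ha. split; [lra|]. pose proof (exp_le _ _ Hs). rewrite exp_0 in H. nra.
Qed.

Lemma ratio_le_mult s t a b a' b' :
  ratio_le s a a' -> ratio_le t b b' -> ratio_le (s + t) (a * b) (a' * b').
Proof.
  intros [H1 H2] [H3 H4]. split; [now apply Rmult_le_pos|].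
  rewrite exp_plus. replace (exp s * exp t * (a' * b')) with ((exp s * a') * (exp t * b')) by ring.
  now apply Rmult_le_compat.
Qed.

Lemma ratio_le_scal s c a b : 0 <= c -> ratio_le s a b -> ratio_le s (c * a) (c * b).
Proof.
  intros Hc H. replace s with (0 + s) by ring.
  apply ratio_le_mult; [apply ratio_le_refl; lra|exact H].
Qed.

Lemma ratio_le_plus s a b a' b' :
  ratio_le s a a' -> ratio_le s b b' -> ratio_le s (a + b) (a' + b').
Proof. intros [H1 H2] [H3 H4]. split; lra. Qed.

Lemma ratio_le_fsum s n f g :
  (forall i, (i < n)%nat -> ratio_le s (f i) (g i)) -> ratio_le s (fsum n f) (fsum n g).
Proof.
  intros H. split; [apply fsum_nonneg; intros; now apply H|].
  rewrite <- fsum_scal. apply fsum_le. intros; now apply H.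
Qed.

Lemma ratio_le_rpow s e a b : 0 <= e -> ratio_le s a b -> ratio_le (s * e) (rpow a e) (rpow b e).
Proof.
  intros He H. pose proof (ratio_le_nonneg_r _ _ _ H). destruct H as [H1 H2].
  split; [apply rpow_nonneg|]. rewrite <- rpow_exp, <- rpow_mul; [|left; apply exp_pos|lra].
  now apply rpow_le.
Qed.

(** Denominators are compared in the opposite direction, which is why closeness is later required
    both ways. *)
Lemma ratio_le_div s t a b a' b' : 0 < b -> 0 < b' ->
  ratio_le s a a' -> ratio_le t b' b -> ratio_le (s + t) (a / b) (a' / b').
Proof.
  intros Hb Hb' Ha [_ H]. apply ratio_le_mult; [exact Ha|].
  split; [left; now apply Rinv_0_lt_compat|].
  apply Rmult_le_reg_r with (b * b'); [nra|]. field_simplify; lra.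
Qed.

(** * The bound encoded by [Psi] *)

Lemma fmin_on_None P g n : fmin_on P g n = None -> forall l, (l < n)%nat -> P l = false.
Proof.
  induction n as [|n IH]; simpl; intros H l Hl; [lia|].
  destruct (P n) eqn:E.
  - destruct (fmin_on P g n); discriminate.
  - destruct (Nat.eq_dec l n) as [->|]; [exact E|apply IH; [exact H|lia]].
Qed.

Lemma fmin_on_Some P g n c : fmin_on P g n = Some c ->
  (exists l, (l < n)%nat /\ P l = true /\ g l = c) /\
  (forall l, (l < n)%nat -> P l = true -> c <= g l).
Proof.
  revert c. induction n as [|n IH]; simpl; intros c H; [discriminate|].
  destruct (P n) eqn:E.
  - destruct (fmin_on P g n) as [a|] eqn:F; injection H as <-.
    + destruct (IH a eq_refl) as [[l [Hl [HP Hg]]] Hmin]. split.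
      * unfold Rmin. destruct (Rle_dec a (g n)); [exists l|exists n]; repeat split; auto; lia.
      * intros k Hk HPk. destruct (Nat.eq_dec k n) as [->|]; [apply Rmin_r|].
        eapply Rle_trans; [apply Rmin_l|]. apply Hmin; [lia|exact HPk].
    + split; [exists n; auto|]. intros k Hk HPk.
      destruct (Nat.eq_dec k n) as [->|]; [lra|].
      rewrite (fmin_on_None _ _ _ F k) in HPk by lia. discriminate.
  - destruct (IH c H) as [[l [Hl [HP Hg]]] Hmin]. split.
    + exists l; repeat split; auto; lia.
    + intros k Hk HPk. destruct (Nat.eq_dec k n) as [->|]; [congruence|]. apply Hmin; [lia|exact HPk].
Qed.

Lemma Psi_nonneg p q r gam del t : 0 <= Psi p q r gam del t.
Proof. apply rpow_nonneg. Qed.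

Lemma le1_of_rpow_le1 s q : 0 < q -> 0 <= s -> rpow s q <= 1 -> s <= 1.
Proof.
  intros Hq Hs H. rewrite <- (rpow_cancel s q (1 / q)) by (lra || (field; lra)).
  apply Rle_trans with (rpow 1 (1 / q)); [|rewrite rpow_one; lra].
  apply rpow_le; [split; [apply rpow_nonneg|exact H]|].
  left; apply Rdiv_lt_0_compat; lra.
Qed.

(** [Psi] bounds a maximum over the unit ball of l_q. There s l <= 1, so outside J the power s^(gam
    p) is at most s^q and the largest coefficient suffices. Inside J all exponents are lowered to
    their minimum, and Hoelder against s^q yields the first term. *)
Lemma Psi_bound p q r gam del t s : 0 < p -> 0 < q -> 0 <= t ->
  (forall l, (l < r)%nat -> 0 < gam l) -> (forall l, (l < r)%nat -> 0 <= del l) ->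
  (forall l, (l < r)%nat -> 0 <= s l) -> fsum r (fun l => rpow (s l) q) <= 1 ->
  fsum r (fun l => rpow (del l * rpow (t * s l) (gam l)) p) <= rpow (Psi p q r gam del t) p.
Proof.
  intros Hp Hq Ht Hgam Hdel Hs Hsum.
  assert (Hs1 : forall l, (l < r)%nat -> s l <= 1).
  { intros l Hl. apply (le1_of_rpow_le1 _ q); auto.
    eapply Rle_trans; [|exact Hsum].
    apply (fsum_term_le r (fun l => rpow (s l) q)); auto. intros; apply rpow_nonneg. }
  set (J := inJ gam p q). set (a := fun l => del l * rpow t (gam l)).
  assert (Ha : forall l, (l < r)%nat -> 0 <= a l).
  { intros l Hl. apply Rmult_le_pos; [auto|apply rpow_nonneg]. }
  assert (HX : forall l, (l < r)%nat ->
    rpow (del l * rpow (t * s l) (gam l)) p = rpow (a l) p * rpow (s l) (gam l * p)).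
  { intros l Hl. rewrite (rpow_mul t (s l)) by auto. rewrite <- Rmult_assoc.
    fold (a l). rewrite rpow_mul, rpow_rpow; auto. apply rpow_nonneg. }
  unfold Psi. fold J.
  set (T1 := match fmin_on J gam r with Some _ => _ | None => _ end).
  set (T2 := fmax r _).
  assert (B1 : fsum r (fun l => if J l then rpow (a l) p * rpow (s l) (gam l * p) else 0) <= T1 /\ 0 <= T1).
  { unfold T1. destruct (fmin_on J gam r) as [g|] eqn:E.
    - destruct (fmin_on_Some _ _ _ _ E) as [[l0 [Hl0 [HJ0 Hg0]]] Hmin].
      split; [|apply rpow_nonneg].
      assert (Hgp : 0 < g * p < q).
      { unfold J, inJ in HJ0. rewrite <- Hg0. destruct (Rlt_dec (gam l0 * p) q); [|discriminate].
        split; [apply Rmult_lt_0_compat; auto|assumption]. }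
      (* This th makes (s^q)^(1 - th) equal to s^(g p), while the exponent p q / (q - g p) of [Psi]
         becomes p when multiplied by th. *)
      set (th := 1 - g * p / q).
      assert (Eq : g * p / q * q = g * p) by (field; lra).
      assert (Hth : 0 < th < 1) by (unfold th; nra).
      match goal with |- _ <= rpow (fsum r ?F) _ => set (X := F) end.
      apply Rle_trans with (rpow (fsum r X) th * rpow (fsum r (fun l => rpow (s l) q)) (1 - th)).
      + eapply Rle_trans; [|apply fsum_holder; [exact Hth| |intros; apply rpow_nonneg]].
        * apply fsum_le. intros l Hl. unfold X. fold (a l).
          destruct (J l) eqn:EJ; [|rewrite rpow_0, Rmult_0_l; lra].
          rewrite !rpow_rpow. replace (p * q / (q - g * p) * th) with p by (unfold th; field; lra).
          replace (q * (1 - th)) with (g * p) by (unfold th; field; lra).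
          apply Rmult_le_compat_l; [apply rpow_nonneg|].
          apply rpow_le_exponent; [auto|]. apply Rmult_le_compat_r; [lra|auto].
        * intros l Hl. unfold X. destruct (J l); [apply rpow_nonneg|lra].
      + apply Rle_trans with (rpow (fsum r X) th * 1); [|lra].
        apply Rmult_le_compat_l; [apply rpow_nonneg|].
        apply Rle_trans with (rpow 1 (1 - th)); [|rewrite rpow_one; lra]. apply rpow_le; [|lra].
        split; [apply fsum_nonneg; intros; apply rpow_nonneg|exact Hsum].
    - split; [|lra]. rewrite (fsum_ext r _ (fun _ => 0)); [rewrite fsum_0; lra|].
      intros l Hl. now rewrite (fmin_on_None _ _ _ E l Hl). }
  assert (B2 : fsum r (fun l => if J l then 0 else rpow (a l) p * rpow (s l) (gam l * p)) <= T2).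
  { assert (HT2 : 0 <= T2) by apply fmax_nonneg.
    apply Rle_trans with (T2 * fsum r (fun l => rpow (s l) q)); [|nra].
    rewrite <- fsum_scal. apply fsum_le. intros l Hl.
    destruct (J l) eqn:EJ; [apply Rmult_le_pos; [exact HT2|apply rpow_nonneg]|].
    apply Rmult_le_compat; try apply rpow_nonneg.
    - unfold T2. match goal with |- _ <= fmax r ?F => pose proof (fmax_ge r F l Hl) as M end.
      cbv beta in M. rewrite EJ in M. exact M.
    - apply rpow_le_exponent; [auto|]. unfold J, inJ in EJ.
      destruct (Rlt_dec (gam l * p) q); [discriminate|lra]. }
  rewrite rpow_cancel; [|pose proof (fmax_nonneg r); unfold T2; destruct B1; apply Rplus_le_le_0_compat; auto|field; lra].
  destruct B1 as [B1 _]. eapply Rle_trans; [|exact (Rplus_le_compat _ _ _ _ B1 B2)].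
  rewrite <- fsum_plus. right. apply fsum_ext. intros l Hl. rewrite HX by exact Hl.
  destruct (J l); lra.
Qed.

(* Through the row norms of F, a layer sees only the norm of its input. *)
Lemma layer_bound m n F p rho b B p2 gam del :
  1 < p -> 0 < rho -> 0 < p2 ->
  (forall i j, (i < m)%nat -> (j < n)%nat -> 0 <= F i j) ->
  fsum m (fun i => fsum n (fun j => rpow (F i j) p)) <= rpow rho p ->
  (forall j, (j < n)%nat -> 0 <= b j) ->
  rpow (fsum n (fun j => rpow (b j) (conj p))) (1 / conj p) <= B ->
  (forall i, (i < m)%nat -> 0 < gam i) -> (forall i, (i < m)%nat -> 0 <= del i) ->
  fsum m (fun i => rpow (del i * rpow (fsum n (fun j => F i j * b j)) (gam i)) p2)
  <= rpow (Psi p2 p m gam del (rho * B)) p2.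
Proof.
  intros Hp Hrho Hp2 HF Hball Hb HB Hgam Hdel.
  (* T i is the l_p norm of row i. Hoelder bounds the i-th linear form by T i * B, and the row norms
     divided by rho form a vector in the unit ball of l_p, the setting of [Psi_bound]. *)
  set (T := fun i => rpow (fsum n (fun j => rpow (F i j) p)) (1 / p)).
  assert (HB0 : 0 <= B) by (eapply Rle_trans; [apply rpow_nonneg|exact HB]).
  assert (HT : forall i, 0 <= T i) by (intros; apply rpow_nonneg).
  eapply Rle_trans; [|apply (Psi_bound p2 p m gam del (rho * B) (fun i => / rho * T i)); auto; try lra].
  - apply fsum_le. intros i Hi.
    assert (S0 : 0 <= fsum n (fun j => F i j * b j)).
    { apply fsum_nonneg. intros; apply Rmult_le_pos; auto. }
    apply rpow_le; [|lra]. split; [apply Rmult_le_pos; [auto|apply rpow_nonneg]|].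
    apply Rmult_le_compat_l; [auto|]. apply rpow_le; [|left; auto]. split; [exact S0|].
    eapply Rle_trans; [apply (holder_conj n (F i) b p Hp); auto|].
    fold (T i). replace (rho * B * (/ rho * T i)) with (T i * B) by (field; lra).
    apply Rmult_le_compat_l; auto.
  - apply Rmult_le_pos; lra.
  - intros i Hi. apply Rmult_le_pos; [left; now apply Rinv_0_lt_compat|auto].
  - rewrite (fsum_ext m _ (fun i => / rpow rho p * fsum n (fun j => rpow (F i j) p))).
    + rewrite fsum_scal. pose proof (rpow_gt0 rho p Hrho) as P.
      apply Rmult_le_reg_l with (rpow rho p); [exact P|]. rewrite <- Rmult_assoc, Rinv_r; lra.
    + intros i Hi. rewrite rpow_mul, rpow_inv; auto; [|left; now apply Rinv_0_lt_compat].
      f_equal. apply rpow_cancel; [|field; lra]. apply fsum_nonneg; intros; apply rpow_nonneg.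
Qed.

(** * Bounds on the outputs over the parameter balls *)

Section Network.

Variables (n d K n1 n2 : nat) (x : nat -> nat -> R) (y : nat -> nat)
  (pw pv pu rw rv ru eps : R) (alpha beta : nat -> R).
Hypotheses (Hn : (1 <= n)%nat) (Hd : (1 <= d)%nat) (Hn1 : (1 <= n1)%nat) (Hn2 : (1 <= n2)%nat)
  (Hx : forall i s, (i < n)%nat -> (s < d)%nat -> 0 <= x i s)
  (Hy : forall i, (i < n)%nat -> (y i < K)%nat)
  (Hpw : 1 < pw) (Hpv : 1 < pv) (Hpu : 1 < pu)
  (Hrw : 0 < rw) (Hrv : 0 < rv) (Hru : 0 < ru) (Heps : 0 < eps)
  (Halpha : forall m, (m < n1)%nat -> 1 <= alpha m)
  (Hbeta : forall l, (l < n2)%nat -> 1 <= beta l).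

Local Notation rx := (fmax n (fun i => lpnorm (conj pu) d (x i))).
Local Notation theta := (rv * Psi (conj pv) pu n1 alpha (fun _ => 1) (ru * rx)).
Local Notation Cw := (rw * Psi (conj pw) pv n2 beta (fun _ => 1) theta).
Local Notation Cv := (rw * Psi (conj pw) pv n2 beta beta theta).
Local Notation ainf := (linf n1 alpha).
Local Notation binf := (linf n2 beta).
Local Notation Splus := (InSplus K n1 n2 d pw pv pu rw rv ru).
Local Notation Spp := (InSpp K n1 n2 d pw pv pu rw rv ru).
Local Notation Ph := (Phi K n n1 n2 d alpha beta eps x y).
Local Notation G := (Gstep K n1 n2 d pw pv pu rw rv ru Ph).

Definition hidden (z : Par) (xi : nat -> R) (m : nat) : R := fsum d (fun s => PU z m s * xi s).
Definition inner (z : Par) (xi : nat -> R) (l : nat) : R :=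
  fsum n1 (fun m => PV z l m * rpow (hidden z xi m) (alpha m)).
Local Notation f z i r := (fnet n1 n2 d alpha beta z (x i) r).

Definition entries (P : R -> Prop) (z : Par) : Prop :=
  (forall r l, (r < K)%nat -> (l < n2)%nat -> P (PW z r l)) /\
  (forall l m, (l < n2)%nat -> (m < n1)%nat -> P (PV z l m)) /\
  (forall m s, (m < n1)%nat -> (s < d)%nat -> P (PU z m s)).

(** Inequalities instead of norm equalities, because geodesics between points of the spheres run
    through the balls. Absolute values are omitted since the predicate accompanies nonnegative
    entries. *)
Definition ball (z : Par) : Prop :=
  (forall r, (r < K)%nat -> fsum n2 (fun l => rpow (PW z r l) pw) <= rpow rw pw) /\
  fsum n2 (fun l => fsum n1 (fun m => rpow (PV z l m) pv)) <= rpow rv pv /\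
  fsum n1 (fun m => fsum d (fun s => rpow (PU z m s) pu)) <= rpow ru pu.

Lemma hidden_nonneg z i m : entries (Rle 0) z -> (i < n)%nat -> (m < n1)%nat -> 0 <= hidden z (x i) m.
Proof.
  intros [_ [_ HU]] Hi Hm. apply fsum_nonneg. intros s Hs. apply Rmult_le_pos; auto.
Qed.

Lemma inner_nonneg z i l : entries (Rle 0) z -> (l < n2)%nat -> 0 <= inner z (x i) l.
Proof.
  intros [_ [HV _]] Hl. apply fsum_nonneg. intros m Hm.
  apply Rmult_le_pos; [auto|apply rpow_nonneg].
Qed.

(** Hoelder is applied layer by layer, each layer being measured in the norm dual to that of the
    next weights. The weight del = 1 gives Cw, and del = beta gives Cv, which absorbs the factors
    beta produced by differentiating the outer powers. *)
Lemma output_bound z i r del : entries (Rle 0) z -> ball z -> (i < n)%nat -> (r < K)%nat ->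
  (forall l, (l < n2)%nat -> 0 <= del l) ->
  fsum n2 (fun l => PW z r l * (del l * rpow (inner z (x i) l) (beta l)))
  <= rw * Psi (conj pw) pv n2 beta del theta.
Proof.
  intros Hz [BW [BV BU]] Hi Hr Hdel. pose proof Hz as [HW [HV HU]].
  pose proof (conj_gt1 pw Hpw). pose proof (conj_gt1 pv Hpv). pose proof (conj_gt1 pu Hpu).
  assert (L1 : fsum n1 (fun m => rpow (rpow (hidden z (x i) m) (alpha m)) (conj pv))
     <= rpow (Psi (conj pv) pu n1 alpha (fun _ => 1) (ru * rx)) (conj pv)).
  { eapply Rle_trans; [|apply (layer_bound n1 d (PU z) pu ru (x i) rx (conj pv) alpha (fun _ => 1))]; auto; try lra.
    - right. apply fsum_ext. intros m Hm. now rewrite Rmult_1_l.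
    - eapply Rle_trans; [|apply (fmax_ge n (fun i => lpnorm (conj pu) d (x i)) i Hi)].
      right. unfold lpnorm. f_equal. apply fsum_ext. intros s Hs. rewrite Rabs_pos_eq; auto.
    - intros m Hm. specialize (Halpha m Hm). lra.
    - intros; lra. }
  assert (L2 : fsum n2 (fun l => rpow (del l * rpow (inner z (x i) l) (beta l)) (conj pw))
     <= rpow (Psi (conj pw) pv n2 beta del theta) (conj pw)).
  { eapply Rle_trans; [|apply (layer_bound n2 n1 (PV z) pv rv (fun m => rpow (hidden z (x i) m) (alpha m))
       (Psi (conj pv) pu n1 alpha (fun _ => 1) (ru * rx)) (conj pw) beta del)]; auto; try lra.
    - right; reflexivity.
    - intros; apply rpow_nonneg.
    - rewrite <- (rpow_cancel (Psi _ _ _ _ _ _) (conj pv) (1 / conj pv)); [|apply Psi_nonneg|field; lra].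
      apply rpow_le; [|left; apply Rdiv_lt_0_compat; lra].
      split; [apply fsum_nonneg; intros; apply rpow_nonneg|exact L1].
    - intros l Hl. specialize (Hbeta l Hl). lra. }
  eapply Rle_trans; [apply (holder_conj n2 (PW z r) (fun l => del l * rpow (inner z (x i) l) (beta l)) pw Hpw)|].
  - auto.
  - intros l Hl. apply Rmult_le_pos; [auto|apply rpow_nonneg].
  - apply Rmult_le_compat; try apply rpow_nonneg.
    + rewrite <- (rpow_cancel rw pw (1 / pw)); [|lra|field; lra].
      apply rpow_le; [|left; apply Rdiv_lt_0_compat; lra].
      split; [apply fsum_nonneg; intros; apply rpow_nonneg|auto].
    + rewrite <- (rpow_cancel (Psi _ _ _ _ _ _) (conj pw) (1 / conj pw)); [|apply Psi_nonneg|field; lra].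
      apply rpow_le; [|left; apply Rdiv_lt_0_compat; lra].
      split; [apply fsum_nonneg; intros; apply rpow_nonneg|exact L2].
Qed.

(** * Derivative of the objective along a path *)

(** [dz] is a tangent vector, in which this formula and the next are linear. At a zero
    pre-activation with exponent 1 the value [rpow 0 0 = 0] need not be the true derivative, so they
    serve as derivatives only for positive pre-activations or for a zero input. *)
Definition dinner (z dz : Par) (xi : nat -> R) (l : nat) : R :=
  fsum n1 (fun m => PV dz l m * rpow (hidden z xi m) (alpha m)
    + PV z l m * (alpha m * rpow (hidden z xi m) (alpha m - 1) * hidden dz xi m)).

Definition dfnet (z dz : Par) (xi : nat -> R) (r : nat) : R :=
  fsum n2 (fun l => PW dz r l * rpow (inner z xi l) (beta l)
    + PW z r l * (beta l * rpow (inner z xi l) (beta l - 1) * dinner z dz xi l)).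

Definition path_deriv (z : R -> Par) (t : R) (dz : Par) : Prop :=
  (forall r l, (r < K)%nat -> (l < n2)%nat -> derivable_pt_lim (fun s => PW (z s) r l) t (PW dz r l)) /\
  (forall l m, (l < n2)%nat -> (m < n1)%nat -> derivable_pt_lim (fun s => PV (z s) l m) t (PV dz l m)) /\
  (forall m k, (m < n1)%nat -> (k < d)%nat -> derivable_pt_lim (fun s => PU (z s) m k) t (PU dz m k)).

Lemma entries_pos_nonneg z : entries (Rlt 0) z -> entries (Rle 0) z.
Proof. intros [H1 [H2 H3]]; repeat split; intros; left; auto. Qed.

(** A zero input makes every output identically 0, while for a nonzero input positive parameters
    make every pre-activation positive, where the powers are differentiable. *)
Lemma input_dec i : (forall s, (s < d)%nat -> x i s = 0) \/ (exists s, (s < d)%nat /\ x i s <> 0).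
Proof.
  clear - d. induction d as [|k [IH|[s [Hs H]]]].
  - left; intros; lia.
  - destruct (Req_dec (x i k) 0) as [E|E].
    + left. intros s Hs. destruct (Nat.eq_dec s k) as [->|]; [exact E|apply IH; lia].
    + right; exists k; split; [lia|exact E].
  - right; exists s; split; [lia|exact H].
Qed.

Lemma hidden_null z i m : (forall s, (s < d)%nat -> x i s = 0) -> hidden z (x i) m = 0.
Proof.
  intros H. unfold hidden. rewrite (fsum_ext d _ (fun _ => 0)); [apply fsum_0|].
  intros s Hs. rewrite H by exact Hs. ring.
Qed.

Lemma inner_null z i l : (forall s, (s < d)%nat -> x i s = 0) -> inner z (x i) l = 0.
Proof.
  intros H. unfold inner. rewrite (fsum_ext n1 _ (fun _ => 0)); [apply fsum_0|].
  intros m Hm. rewrite hidden_null by exact H. rewrite rpow_0. ring.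
Qed.

Lemma hidden_pos z i m : entries (Rlt 0) z -> (i < n)%nat -> (m < n1)%nat ->
  (exists s, (s < d)%nat /\ x i s <> 0) -> 0 < hidden z (x i) m.
Proof.
  intros [_ [_ HU]] Hi Hm [s [Hs Hxs]]. apply fsum_pos with s; auto.
  - intros k Hk. apply Rmult_le_pos; [left|]; auto.
  - apply Rmult_lt_0_compat; [auto|]. specialize (Hx i s Hi Hs). lra.
Qed.

Lemma inner_pos z i l : entries (Rlt 0) z -> (i < n)%nat -> (l < n2)%nat ->
  (exists s, (s < d)%nat /\ x i s <> 0) -> 0 < inner z (x i) l.
Proof.
  intros Hz Hi Hl Hex. pose proof Hz as [_ [HV _]]. apply fsum_pos with 0%nat; [| lia |].
  - intros m Hm. apply Rmult_le_pos; [left; auto|apply rpow_nonneg].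
  - apply Rmult_lt_0_compat; [apply HV; auto; lia|]. apply rpow_gt0, hidden_pos; auto; lia.
Qed.

Lemma hidden_derivable z t dz i m : path_deriv z t dz -> (m < n1)%nat ->
  derivable_pt_lim (fun s => hidden (z s) (x i) m) t (hidden dz (x i) m).
Proof.
  intros [_ [_ HU]] Hm. apply (fsum_derivable d (fun k s => PU (z s) m k * x i k)).
  intros k Hk. apply derivable_pt_lim_ext with (f := fun s => x i k * PU (z s) m k);
    [intros; ring|]. rewrite Rmult_comm. apply derivable_pt_lim_scal. auto.
Qed.

Lemma inner_derivable z t dz i l : path_deriv z t dz -> entries (Rlt 0) (z t) ->
  (exists s, (s < d)%nat /\ x i s <> 0) -> (i < n)%nat -> (l < n2)%nat ->
  derivable_pt_lim (fun s => inner (z s) (x i) l) t (dinner (z t) dz (x i) l).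
Proof.
  intros Hpath Hz Hex Hi Hl.
  apply (fsum_derivable n1 (fun m s => PV (z s) l m * rpow (hidden (z s) (x i) m) (alpha m))).
  intros m Hm. pose proof Hpath as [_ [HV _]].
  apply (derivable_pt_lim_mult (fun s => PV (z s) l m) (fun s => rpow (hidden (z s) (x i) m) (alpha m))).
  - auto.
  - apply (rpow_derivable (fun s => hidden (z s) (x i) m)).
    + now apply hidden_pos.
    + now apply hidden_derivable.
Qed.

Lemma fnet_derivable z t dz i r : path_deriv z t dz -> entries (Rlt 0) (z t) ->
  (i < n)%nat -> (r < K)%nat ->
  derivable_pt_lim (fun s => f (z s) i r) t (dfnet (z t) dz (x i) r).
Proof.
  intros Hpath Hz Hi Hr. destruct (input_dec i) as [Hnull|Hex].
  - apply derivable_pt_lim_ext with (f := fct_cte 0).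
    + intros s. symmetry. change (fsum n2 (fun l => PW (z s) r l * rpow (inner (z s) (x i) l) (beta l)) = 0).
      rewrite (fsum_ext n2 _ (fun _ => 0)); [apply fsum_0|].
      intros l Hl. rewrite inner_null by exact Hnull. rewrite rpow_0. ring.
    + replace (dfnet (z t) dz (x i) r) with 0; [apply derivable_pt_lim_const|].
      unfold dfnet. rewrite (fsum_ext n2 _ (fun _ => 0)); [now rewrite fsum_0|].
      intros l Hl. rewrite inner_null by exact Hnull. rewrite !rpow_0. ring.
  - apply (fsum_derivable n2 (fun l s => PW (z s) r l * rpow (inner (z s) (x i) l) (beta l))).
    intros l Hl. pose proof Hpath as [HW _].
    apply (derivable_pt_lim_mult (fun s => PW (z s) r l) (fun s => rpow (inner (z s) (x i) l) (beta l))).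
    + auto.
    + apply (rpow_derivable (fun s => inner (z s) (x i) l)).
      * now apply inner_pos.
      * now apply inner_derivable.
Qed.

Lemma fsum_except N (g : nat -> R) k : (k < N)%nat ->
  fsum N (fun j => if Nat.eqb j k then 0 else g j) = fsum N g - g k.
Proof.
  induction N as [|N IH]; simpl; intros Hk; [lia|].
  destruct (Nat.eqb_spec N k) as [->|Hne].
  - rewrite (fsum_ext k _ g); [lra|]. intros i Hi. destruct (Nat.eqb_spec i k); [lia|reflexivity].
  - rewrite IH by lia. lra.
Qed.

Lemma fsum_single N (g : nat -> R) k : (k < N)%nat ->
  fsum N (fun j => (if Nat.eqb k j then 1 else 0) * g j) = g k.
Proof.
  intros Hk. rewrite (fsum_ext N _ (fun j => g j + (-1) * (if Nat.eqb j k then 0 else g j))).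
  - rewrite fsum_plus, fsum_scal, fsum_except by exact Hk. lra.
  - intros j Hj. rewrite Nat.eqb_sym. destruct (Nat.eqb j k); lra.
Qed.

(* [coef i z r] is the derivative of the i-th summand of the objective with respect to the r-th
   output, that is 1 + [r = y_i] minus the r-th softmax component. *)
Definition coef (i : nat) (z : Par) (r : nat) : R :=
  (if Nat.eqb (y i) r then 1 else 0)
  + fsum K (fun j => if Nat.eqb j r then 0 else exp (f z i j)) / fsum K (fun j => exp (f z i j)).

Definition total (z : Par) : R :=
  fsum K (fun r => fsum n2 (PW z r)) + fsum n2 (fun l => fsum n1 (PV z l))
  + fsum n1 (fun m => fsum d (PU z m)).

Definition dPhi (z dz : Par) : R :=
  (1 / INR n) * fsum n (fun i => fsum K (fun r => coef i z r * dfnet z dz (x i) r)) + eps * total dz.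

Lemma K_pos : (0 < K)%nat.
Proof. specialize (Hy 0%nat Hn). lia. Qed.

Lemma sum_exp_pos i z : 0 < fsum K (fun j => exp (f z i j)).
Proof. apply fsum_pos with 0%nat; [intros; left; apply exp_pos|apply K_pos|apply exp_pos]. Qed.

Lemma total_derivable z t dz : path_deriv z t dz ->
  derivable_pt_lim (fun s => total (z s)) t (total dz).
Proof.
  intros [HW [HV HU]]. unfold total.
  apply (derivable_pt_lim_plus (fun s => _ + _) (fun s => fsum n1 (fun m => fsum d (PU (z s) m)))).
  - apply (derivable_pt_lim_plus (fun s => fsum K (fun r => fsum n2 (PW (z s) r)))
      (fun s => fsum n2 (fun l => fsum n1 (PV (z s) l)))).
    + apply (fsum_derivable K (fun r s => fsum n2 (PW (z s) r))). intros r Hr.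
      apply (fsum_derivable n2 (fun l s => PW (z s) r l)). auto.
    + apply (fsum_derivable n2 (fun r s => fsum n1 (PV (z s) r))). intros r Hr.
      apply (fsum_derivable n1 (fun l s => PV (z s) r l)). auto.
  - apply (fsum_derivable n1 (fun r s => fsum d (PU (z s) r))). intros r Hr.
    apply (fsum_derivable d (fun l s => PU (z s) r l)). auto.
Qed.

Lemma gain_derivable z t dz i : path_deriv z t dz -> entries (Rlt 0) (z t) -> (i < n)%nat ->
  derivable_pt_lim (fun s => - loss K (y i) (fnet n1 n2 d alpha beta (z s) (x i))
     + fsum K (fnet n1 n2 d alpha beta (z s) (x i))) t
   (fsum K (fun r => coef i (z t) r * dfnet (z t) dz (x i) r)).
Proof.
  intros Hpath Hz Hi. unfold loss.
  assert (Hf : forall r, (r < K)%nat -> derivable_pt_lim (fun s => f (z s) i r) t (dfnet (z t) dz (x i) r)).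
  { intros; now apply fnet_derivable. }
  set (S := fun s => fsum K (fun j => exp (f (z s) i j))).
  set (df := dfnet (z t) dz (x i)) in *.
  assert (HS : derivable_pt_lim S t (fsum K (fun j => exp (f (z t) i j) * df j))).
  { apply (fsum_derivable K (fun j s => exp (f (z s) i j))). intros j Hj.
    apply (derivable_pt_lim_comp (fun s => f (z s) i j) exp); [auto|apply derivable_pt_lim_exp]. }
  assert (HL : derivable_pt_lim (fun s => ln (S s)) t (/ S t * fsum K (fun j => exp (f (z t) i j) * df j))).
  { apply (derivable_pt_lim_comp S ln); [exact HS|]. apply derivable_pt_lim_ln, sum_exp_pos. }
  assert (HF : derivable_pt_lim (fun s => fsum K (fnet n1 n2 d alpha beta (z s) (x i))) t (fsum K df)).
  { apply (fsum_derivable K (fun r s => f (z s) i r)). auto. }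
  (* The contributions of the true label, of log-sum-exp and of the added sum are regrouped by
     output index, which exposes [coef]. *)
  replace (fsum K (fun r => coef i (z t) r * df r))
    with ((df (y i) - / S t * fsum K (fun j => exp (f (z t) i j) * df j)) + fsum K df).
  - apply (derivable_pt_lim_ext (fun s => (f (z s) i (y i) - ln (S s)) + fsum K (fnet n1 n2 d alpha beta (z s) (x i)))).
    + intros s. unfold S. ring.
    + apply (derivable_pt_lim_plus (fun s => f (z s) i (y i) - ln (S s))); [|exact HF].
      apply (derivable_pt_lim_minus (fun s => f (z s) i (y i))); auto.
  - pose proof (sum_exp_pos i (z t)) as HS0. fold (S t) in HS0.
    rewrite (fsum_ext K (fun r => coef i (z t) r * df r)
      (fun r => (if Nat.eqb (y i) r then 1 else 0) * df r
        + (df r + - / S t * (exp (f (z t) i r) * df r)))).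
    + rewrite !fsum_plus, fsum_scal, fsum_single by auto. ring.
    + intros r Hr. unfold coef. fold (S t). rewrite (fsum_except K (fun j => exp (f (z t) i j))) by exact Hr.
      fold (S t). field. lra.
Qed.

Lemma Phi_derivable z t dz : path_deriv z t dz -> entries (Rlt 0) (z t) ->
  derivable_pt_lim (fun s => Ph (z s)) t (dPhi (z t) dz).
Proof.
  intros Hpath Hz. unfold Phi, dPhi. cbv zeta.
  apply (derivable_pt_lim_plus (fun s => 1 / INR n * _) (fun s => eps * total (z s))).
  - apply (derivable_pt_lim_scal (fun s => fsum n (fun i =>
       - loss K (y i) (fnet n1 n2 d alpha beta (z s) (x i)) + fsum K (fnet n1 n2 d alpha beta (z s) (x i))))).
    apply (fsum_derivable n (fun i s => - loss K (y i) (fnet n1 n2 d alpha beta (z s) (x i))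
      + fsum K (fnet n1 n2 d alpha beta (z s) (x i)))).
    intros i Hi. now apply gain_derivable.
  - apply (derivable_pt_lim_scal (fun s => total (z s))). now apply total_derivable.
Qed.

(** * The gradient through coordinate directions *)

Definition zero : nat -> nat -> R := fun _ _ => 0.
Definition unitW r l := mkPar (upd2 zero r l 1) zero zero.
Definition unitV l m := mkPar zero (upd2 zero l m 1) zero.
Definition unitU m s := mkPar zero zero (upd2 zero m s 1).

Lemma upd2_derivable F a b i j t : derivable_pt_lim (fun s => upd2 F a b s i j) t (upd2 zero a b 1 i j).
Proof.
  unfold upd2. destruct (Nat.eqb i a && Nat.eqb j b)%bool.
  - apply derivable_pt_lim_id.
  - apply derivable_pt_lim_const.
Qed.

Lemma upd2_same F a b i j : upd2 F a b (F a b) i j = F i j.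
Proof.
  unfold upd2. destruct (Nat.eqb_spec i a), (Nat.eqb_spec j b); simpl; subst; reflexivity.
Qed.

(** Parameters are functions on all of nat, of which only the entries within the bounds matter; this
    relation replaces equality. *)
Definition same (z z' : Par) : Prop :=
  (forall r l, (r < K)%nat -> (l < n2)%nat -> PW z r l = PW z' r l) /\
  (forall l m, (l < n2)%nat -> (m < n1)%nat -> PV z l m = PV z' l m) /\
  (forall m s, (m < n1)%nat -> (s < d)%nat -> PU z m s = PU z' m s).

Lemma hidden_ext z z' xi m : same z z' -> (m < n1)%nat -> hidden z xi m = hidden z' xi m.
Proof. intros [_ [_ HU]] Hm. apply fsum_ext. intros s Hs. now rewrite HU. Qed.

Lemma inner_ext z z' xi l : same z z' -> (l < n2)%nat -> inner z xi l = inner z' xi l.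
Proof.
  intros H Hl. apply fsum_ext. intros m Hm. rewrite (hidden_ext z z') by assumption.
  destruct H as [_ [HV _]]. now rewrite HV.
Qed.

Lemma fnet_ext z z' i r : same z z' -> (r < K)%nat -> f z i r = f z' i r.
Proof.
  intros H Hr. apply fsum_ext. intros l Hl.
  change (PW z r l * rpow (inner z (x i) l) (beta l) = PW z' r l * rpow (inner z' (x i) l) (beta l)).
  rewrite (inner_ext z z') by assumption. destruct H as [HW _]. now rewrite HW.
Qed.

Lemma dfnet_ext z z' dz dz' i r : same z z' -> same dz dz' -> (r < K)%nat ->
  dfnet z dz (x i) r = dfnet z' dz' (x i) r.
Proof.
  intros H Hd' Hr. apply fsum_ext. intros l Hl. rewrite (inner_ext z z') by assumption.
  replace (dinner z dz (x i) l) with (dinner z' dz' (x i) l).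
  - destruct H as [HW _], Hd' as [HdW _]. now rewrite HW, HdW.
  - apply fsum_ext. intros m Hm. rewrite (hidden_ext z z'), (hidden_ext dz dz') by assumption.
    destruct H as [_ [HV _]], Hd' as [_ [HdV _]]. now rewrite HV, HdV.
Qed.

Lemma coef_ext z z' i r : same z z' -> coef i z r = coef i z' r.
Proof.
  intros H. unfold coef.
  rewrite (fsum_ext K (fun j => exp (f z i j)) (fun j => exp (f z' i j)))
    by (intros j Hj; now rewrite (fnet_ext z z')).
  rewrite (fsum_ext K (fun j => if Nat.eqb j r then 0 else exp (f z i j))
      (fun j => if Nat.eqb j r then 0 else exp (f z' i j)))
    by (intros j Hj; now rewrite (fnet_ext z z')).
  reflexivity.
Qed.

Lemma total_ext z z' : same z z' -> total z = total z'.
Proof.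
  intros [HW [HV HU]]. unfold total. f_equal; [f_equal|];
    apply fsum_ext; intros i Hi; apply fsum_ext; auto.
Qed.

Lemma dPhi_ext z z' dz dz' : same z z' -> same dz dz' -> dPhi z dz = dPhi z' dz'.
Proof.
  intros H Hd'. unfold dPhi. rewrite (total_ext dz dz' Hd'). do 2 f_equal.
  apply fsum_ext. intros i Hi. apply fsum_ext. intros r Hr.
  now rewrite (coef_ext z z'), (dfnet_ext z z' dz dz').
Qed.

Lemma same_refl z : same z z.
Proof. repeat split. Qed.

Lemma entries_ext P z z' : same z z' -> entries P z -> entries P z'.
Proof.
  intros [E1 [E2 E3]] [H1 [H2 H3]]; split; [|split]; intros;
    [rewrite <- E1|rewrite <- E2|rewrite <- E3]; auto.
Qed.

(** A coordinate line is a differentiable path with unit velocity; it passes through a parameter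
    that agrees with z up to [same]. *)
Lemma dPhi_is_grad z : entries (Rlt 0) z ->
  is_grad K n1 n2 d Ph z (fun r l => dPhi z (unitW r l)) (fun l m => dPhi z (unitV l m))
    (fun m s => dPhi z (unitU m s)).
Proof.
  intros Hz. repeat split; intros a b Ha Hb.
  - set (p := fun t => mkPar (upd2 (PW z) a b t) (PV z) (PU z)).
    assert (E : same z (p (PW z a b))) by (repeat split; intros; simpl; now rewrite ?upd2_same).
    rewrite (dPhi_ext _ _ _ _ E (same_refl _)). apply (Phi_derivable p).
    + repeat split; simpl; intros; (apply upd2_derivable || apply derivable_pt_lim_const).
    + now apply (entries_ext _ z).
  - set (p := fun t => mkPar (PW z) (upd2 (PV z) a b t) (PU z)).
    assert (E : same z (p (PV z a b))) by (repeat split; intros; simpl; now rewrite ?upd2_same).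
    rewrite (dPhi_ext _ _ _ _ E (same_refl _)). apply (Phi_derivable p).
    + repeat split; simpl; intros; (apply upd2_derivable || apply derivable_pt_lim_const).
    + now apply (entries_ext _ z).
  - set (p := fun t => mkPar (PW z) (PV z) (upd2 (PU z) a b t)).
    assert (E : same z (p (PU z a b))) by (repeat split; intros; simpl; now rewrite ?upd2_same).
    rewrite (dPhi_ext _ _ _ _ E (same_refl _)). apply (Phi_derivable p).
    + repeat split; simpl; intros; (apply upd2_derivable || apply derivable_pt_lim_const).
    + now apply (entries_ext _ z).
Qed.

(** * Logarithmic derivative bounds *)

Lemma alpha_le m : (m < n1)%nat -> 1 <= alpha m <= ainf.
Proof. intros Hm. split; [auto|now apply linf_ge]. Qed.

Lemma beta_le l : (l < n2)%nat -> 1 <= beta l <= binf.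
Proof. intros Hl. split; [auto|now apply linf_ge]. Qed.

Lemma ainf_ge1 : 1 <= ainf.
Proof. pose proof (alpha_le 0 Hn1). lra. Qed.

Lemma binf_ge1 : 1 <= binf.
Proof. pose proof (beta_le 0 Hn2). lra. Qed.

Lemma Cw_nonneg : 0 <= Cw.
Proof. apply Rmult_le_pos; [lra|apply Psi_nonneg]. Qed.

Lemma Cv_nonneg : 0 <= Cv.
Proof. apply Rmult_le_pos; [lra|apply Psi_nonneg]. Qed.

Definition close (a b c : R) (z z' : Par) : Prop :=
  (forall r l, (r < K)%nat -> (l < n2)%nat -> ratio_le a (PW z r l) (PW z' r l)) /\
  (forall l m, (l < n2)%nat -> (m < n1)%nat -> ratio_le b (PV z l m) (PV z' l m)) /\
  (forall m s, (m < n1)%nat -> (s < d)%nat -> ratio_le c (PU z m s) (PU z' m s)).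

Lemma ratio_le_00 s : ratio_le s 0 0.
Proof. split; lra. Qed.

Lemma hidden_ratio a b c z z' i m : close a b c z z' -> (i < n)%nat -> (m < n1)%nat ->
  ratio_le c (hidden z (x i) m) (hidden z' (x i) m).
Proof.
  intros [_ [_ HU]] Hi Hm. apply ratio_le_fsum. intros s Hs.
  rewrite (Rmult_comm (PU z m s)), (Rmult_comm (PU z' m s)). apply ratio_le_scal; auto.
Qed.

Lemma inner_ratio a b c z z' i l : 0 <= c -> close a b c z z' -> (i < n)%nat -> (l < n2)%nat ->
  ratio_le (b + ainf * c) (inner z (x i) l) (inner z' (x i) l).
Proof.
  intros Hc H Hi Hl. apply ratio_le_fsum. intros m Hm.
  pose proof (alpha_le m Hm). apply ratio_le_mult.
  - destruct H as [_ [HV _]]; auto.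
  - apply ratio_le_weaken with (c * alpha m); [|nra]. apply ratio_le_rpow; [lra|].
    now apply (hidden_ratio a b).
Qed.

Lemma inner_rpow_ratio a b c z z' i l e e' : 0 <= b -> 0 <= c -> 0 <= e <= e' ->
  close a b c z z' -> (i < n)%nat -> (l < n2)%nat ->
  ratio_le ((b + ainf * c) * e') (rpow (inner z (x i) l) e) (rpow (inner z' (x i) l) e).
Proof.
  intros Hb Hc He H Hi Hl. pose proof ainf_ge1.
  apply ratio_le_weaken with ((b + ainf * c) * e).
  - apply ratio_le_rpow; [lra|]. now apply (inner_ratio a).
  - apply Rmult_le_compat_l; [|lra]. apply Rplus_le_le_0_compat; [lra|]. apply Rmult_le_pos; lra.
Qed.

Lemma fnet_ratio a b c z z' i r : 0 <= b -> 0 <= c -> close a b c z z' ->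
  (i < n)%nat -> (r < K)%nat -> ratio_le (a + (b + ainf * c) * binf) (f z i r) (f z' i r).
Proof.
  intros Hb Hc H Hi Hr. apply ratio_le_fsum. intros l Hl. pose proof (beta_le l Hl).
  apply ratio_le_mult; [destruct H as [HW _]; auto|].
  apply (inner_rpow_ratio a b c z z'); auto; lra.
Qed.

Lemma hidden_zero dz xi m : PU dz = zero -> hidden dz xi m = 0.
Proof.
  intros H. unfold hidden. rewrite H. rewrite (fsum_ext d _ (fun _ => 0)); [apply fsum_0|].
  intros; unfold zero; ring.
Qed.

Lemma dinner_zero z dz xi l : PV dz = zero -> PU dz = zero -> dinner z dz xi l = 0.
Proof.
  intros HV HU. unfold dinner. rewrite (fsum_ext n1 _ (fun _ => 0)); [apply fsum_0|].
  intros m Hm. rewrite (hidden_zero dz) by exact HU. rewrite HV. unfold zero. ring.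
Qed.

(** The output is linear in w, so its derivative in a w-direction does not depend on w and the
    constant a is absent. *)
Lemma dfnet_ratio_W a b c z z' dz i r : 0 <= b -> 0 <= c -> close a b c z z' ->
  entries (Rle 0) dz -> PV dz = zero -> PU dz = zero -> (i < n)%nat -> (r < K)%nat ->
  ratio_le ((b + ainf * c) * binf) (dfnet z dz (x i) r) (dfnet z' dz (x i) r).
Proof.
  intros Hb Hc H [HdW _] HV HU Hi Hr. apply ratio_le_fsum. intros l Hl. pose proof (beta_le l Hl).
  rewrite !dinner_zero, !Rmult_0_r, !Rplus_0_r by assumption.
  apply ratio_le_scal; [auto|]. apply (inner_rpow_ratio a); auto; lra.
Qed.

(** Differentiating in v lowers the outer exponent to beta - 1 and leaves one hidden power. The
    total a + (binf - 1) b + ainf binf c carries the -1 of the diagonal entry for v. *)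
Lemma dfnet_ratio_V a b c z z' dz i r : 0 <= b -> 0 <= c -> close a b c z z' ->
  entries (Rle 0) dz -> PW dz = zero -> PU dz = zero -> (i < n)%nat -> (r < K)%nat ->
  ratio_le (a + ((b + ainf * c) * (binf - 1) + ainf * c)) (dfnet z dz (x i) r) (dfnet z' dz (x i) r).
Proof.
  intros Hb Hc H [_ [HdV _]] HW HU Hi Hr. apply ratio_le_fsum. intros l Hl. pose proof (beta_le l Hl).
  rewrite HW. unfold zero. rewrite !Rmult_0_l, !Rplus_0_l.
  apply ratio_le_mult; [destruct H as [HcW _]; auto|].
  apply ratio_le_mult; [apply ratio_le_scal; [lra|apply (inner_rpow_ratio a); auto; lra]|].
  apply ratio_le_fsum. intros m Hm. pose proof (alpha_le m Hm).
  rewrite !(hidden_zero dz), !Rmult_0_r, !Rplus_0_r by assumption.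
  apply ratio_le_scal; [auto|]. apply ratio_le_weaken with (c * alpha m); [|nra].
  apply ratio_le_rpow; [lra|]. now apply (hidden_ratio a b).
Qed.

(** Here both powers are differentiated, and the total simplifies to a + binf b + (ainf binf - 1)
    c. *)
Lemma dfnet_ratio_U a b c z z' dz i r : 0 <= b -> 0 <= c -> close a b c z z' ->
  entries (Rle 0) dz -> PW dz = zero -> PV dz = zero -> (i < n)%nat -> (r < K)%nat ->
  ratio_le (a + ((b + ainf * c) * (binf - 1) + (b + c * (ainf - 1))))
    (dfnet z dz (x i) r) (dfnet z' dz (x i) r).
Proof.
  intros Hb Hc H Hdz HW HV Hi Hr. apply ratio_le_fsum. intros l Hl. pose proof (beta_le l Hl).
  rewrite HW. unfold zero. rewrite !Rmult_0_l, !Rplus_0_l.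
  apply ratio_le_mult; [destruct H as [HcW _]; auto|].
  apply ratio_le_mult; [apply ratio_le_scal; [lra|apply (inner_rpow_ratio a); auto; lra]|].
  apply ratio_le_fsum. intros m Hm. pose proof (alpha_le m Hm).
  rewrite HV. unfold zero. rewrite !Rmult_0_l, !Rplus_0_l.
  apply ratio_le_mult; [destruct H as [_ [HcV _]]; auto|].
  rewrite !(Rmult_comm _ (hidden dz (x i) m)). apply ratio_le_scal; [now apply hidden_nonneg|].
  apply ratio_le_scal; [lra|]. apply ratio_le_weaken with (c * (alpha m - 1)); [|nra].
  apply ratio_le_rpow; [lra|]. now apply (hidden_ratio a b).
Qed.

Lemma coef_nonneg i z r : 0 <= coef i z r.
Proof.
  unfold coef. apply Rplus_le_le_0_compat.
  - destruct (Nat.eqb (y i) r); lra.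
  - apply Rmult_le_pos; [|left; apply Rinv_0_lt_compat, sum_exp_pos].
    apply fsum_nonneg. intros j Hj. destruct (Nat.eqb j r); [lra|left; apply exp_pos].
Qed.

Lemma exp_ratio E u v : Rabs (u - v) <= E -> ratio_le E (exp u) (exp v).
Proof.
  intros H. split; [left; apply exp_pos|]. rewrite <- exp_plus. apply exp_le.
  pose proof (Rle_abs (u - v)). lra.
Qed.

(** Numerator and denominator of the softmax part each change by a factor of at most exp E, hence 2
    E. The numerator is a sum over j <> r, so no subtraction spoils the comparison. *)
Lemma coef_ratio E i z z' r : 0 <= E ->
  (forall j, (j < K)%nat -> Rabs (f z i j - f z' i j) <= E) ->
  ratio_le (2 * E) (coef i z r) (coef i z' r).
Proof.
  intros HE H. unfold coef. apply ratio_le_plus.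
  - destruct (Nat.eqb (y i) r); apply ratio_le_refl; lra.
  - replace (2 * E) with (E + E) by ring. apply ratio_le_div; try apply sum_exp_pos.
    + apply ratio_le_fsum. intros j Hj. destruct (Nat.eqb j r); [apply ratio_le_00|].
      apply exp_ratio; auto.
    + apply ratio_le_fsum. intros j Hj. apply exp_ratio. rewrite Rabs_minus_sym. auto.
Qed.

Lemma inv_n_pos : 0 < 1 / INR n.
Proof. apply Rdiv_lt_0_compat; [lra|]. apply lt_0_INR. lia. Qed.

Lemma total_nonneg dz : entries (Rle 0) dz -> 0 <= total dz.
Proof.
  intros [HW [HV HU]]. unfold total.
  repeat apply Rplus_le_le_0_compat; apply fsum2_nonneg; auto.
Qed.

(** The [eps] term depends on the direction only, not on the point, so it is compared with factor 1
    and does not worsen the estimate. *)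
Lemma dPhi_ratio E t z z' dz : 0 <= E -> 0 <= t -> entries (Rle 0) dz ->
  (forall i r, (i < n)%nat -> (r < K)%nat -> Rabs (f z i r - f z' i r) <= E) ->
  (forall i r, (i < n)%nat -> (r < K)%nat -> ratio_le t (dfnet z dz (x i) r) (dfnet z' dz (x i) r)) ->
  ratio_le (2 * E + t) (dPhi z dz) (dPhi z' dz).
Proof.
  intros HE Ht Hdz Hf Hdf. apply ratio_le_plus.
  - apply ratio_le_scal; [left; apply inv_n_pos|]. apply ratio_le_fsum. intros i Hi.
    apply ratio_le_fsum. intros r Hr. apply ratio_le_mult; [|auto]. apply coef_ratio; auto.
  - apply ratio_le_refl; [lra|]. apply Rmult_le_pos; [lra|now apply total_nonneg].
Qed.

Lemma close_refl z : entries (Rle 0) z -> close 0 0 0 z z.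
Proof. intros [H1 [H2 H3]]; repeat split; rewrite ?exp_0; auto; lra. Qed.

Lemma unitW_nonneg r l : entries (Rle 0) (unitW r l).
Proof.
  repeat split; simpl; unfold zero, upd2; intros; try lra.
  destruct (Nat.eqb _ _ && Nat.eqb _ _)%bool; lra.
Qed.

Lemma unitV_nonneg r l : entries (Rle 0) (unitV r l).
Proof.
  repeat split; simpl; unfold zero, upd2; intros; try lra.
  destruct (Nat.eqb _ _ && Nat.eqb _ _)%bool; lra.
Qed.

Lemma unitU_nonneg r l : entries (Rle 0) (unitU r l).
Proof.
  repeat split; simpl; unfold zero, upd2; intros; try lra.
  destruct (Nat.eqb _ _ && Nat.eqb _ _)%bool; lra.
Qed.

Lemma upd2_eq F a b t : upd2 F a b t a b = t.
Proof. unfold upd2. now rewrite !Nat.eqb_refl. Qed.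

Lemma entry_le_total_W z r l : entries (Rle 0) z -> (r < K)%nat -> (l < n2)%nat -> PW z r l <= total z.
Proof.
  intros [HW [HV HU]] Hr Hl. unfold total.
  pose proof (fsum2_term_le K n2 (PW z) r l HW Hr Hl).
  pose proof (fsum2_nonneg n2 n1 (PV z) HV). pose proof (fsum2_nonneg n1 d (PU z) HU). lra.
Qed.

Lemma entry_le_total_V z r l : entries (Rle 0) z -> (r < n2)%nat -> (l < n1)%nat -> PV z r l <= total z.
Proof.
  intros [HW [HV HU]] Hr Hl. unfold total.
  pose proof (fsum2_term_le n2 n1 (PV z) r l HV Hr Hl).
  pose proof (fsum2_nonneg K n2 (PW z) HW). pose proof (fsum2_nonneg n1 d (PU z) HU). lra.
Qed.

Lemma entry_le_total_U z r l : entries (Rle 0) z -> (r < n1)%nat -> (l < d)%nat -> PU z r l <= total z.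
Proof.
  intros [HW [HV HU]] Hr Hl. unfold total.
  pose proof (fsum2_term_le n1 d (PU z) r l HU Hr Hl).
  pose proof (fsum2_nonneg K n2 (PW z) HW). pose proof (fsum2_nonneg n2 n1 (PV z) HV). lra.
Qed.

Lemma dPhi_pos z dz : (forall i r, (i < n)%nat -> (r < K)%nat -> 0 <= dfnet z dz (x i) r) ->
  1 <= total dz -> 0 < dPhi z dz.
Proof.
  intros Hdf Ht. unfold dPhi. apply Rplus_le_lt_0_compat; [|apply Rmult_lt_0_compat; lra].
  apply Rmult_le_pos; [left; apply inv_n_pos|]. apply fsum2_nonneg. intros i r Hi Hr.
  apply Rmult_le_pos; [apply coef_nonneg|auto].
Qed.

(** The ratio bounds at z = z' with constants 0 contain the nonnegativity of the network part;
    strictness comes from the [eps] term, as a unit direction has [total] at least 1. *)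
Lemma grad_pos z : entries (Rle 0) z ->
  (forall r l, (r < K)%nat -> (l < n2)%nat -> 0 < dPhi z (unitW r l)) /\
  (forall l m, (l < n2)%nat -> (m < n1)%nat -> 0 < dPhi z (unitV l m)) /\
  (forall m s, (m < n1)%nat -> (s < d)%nat -> 0 < dPhi z (unitU m s)).
Proof.
  intros Hz. pose proof (close_refl z Hz) as Hc.
  split; [|split]; intros a b Ha Hb; apply dPhi_pos.
  - intros i r Hi Hr.
    apply (dfnet_ratio_W 0 0 0 z z (unitW a b)); auto; (apply unitW_nonneg || lra).
  - eapply Rle_trans; [|apply (entry_le_total_W (unitW a b) a b); auto; apply unitW_nonneg].
    simpl. rewrite upd2_eq. lra.
  - intros i r Hi Hr.
    apply (dfnet_ratio_V 0 0 0 z z (unitV a b)); auto; (apply unitV_nonneg || lra).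
  - eapply Rle_trans; [|apply (entry_le_total_V (unitV a b) a b); auto; apply unitV_nonneg].
    simpl. rewrite upd2_eq. lra.
  - intros i r Hi Hr.
    apply (dfnet_ratio_U 0 0 0 z z (unitU a b)); auto; (apply unitU_nonneg || lra).
  - eapply Rle_trans; [|apply (entry_le_total_U (unitU a b) a b); auto; apply unitU_nonneg].
    simpl. rewrite upd2_eq. lra.
Qed.

(** * Lipschitz bound for the outputs in the log-metric *)

Lemma dinner_bound b c z dz i l : entries (Rlt 0) z -> 0 <= b -> 0 <= c ->
  (forall l m, (l < n2)%nat -> (m < n1)%nat -> Rabs (PV dz l m) <= b * PV z l m) ->
  (forall m s, (m < n1)%nat -> (s < d)%nat -> Rabs (PU dz m s) <= c * PU z m s) ->
  (i < n)%nat -> (l < n2)%nat ->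
  Rabs (dinner z dz (x i) l) <= (b + ainf * c) * inner z (x i) l.
Proof.
  intros Hz Hb Hc HV HU Hi Hl. pose proof Hz as [_ [PVz _]].
  eapply Rle_trans; [apply fsum_abs|]. unfold inner. rewrite <- fsum_scal. apply fsum_le.
  intros m Hm. pose proof (alpha_le m Hm).
  assert (Hh : Rabs (hidden dz (x i) m) <= c * hidden z (x i) m).
  { eapply Rle_trans; [apply fsum_abs|]. unfold hidden. rewrite <- fsum_scal. apply fsum_le.
    intros s Hs. rewrite Rabs_mult, (Rabs_pos_eq (x i s)) by auto. rewrite <- Rmult_assoc.
    apply Rmult_le_compat_r; auto. }
  assert (Hpow : rpow (hidden z (x i) m) (alpha m - 1) * hidden z (x i) m = rpow (hidden z (x i) m) (alpha m)).
  { rewrite <- (rpow_1 (hidden z (x i) m)) at 2 by (apply hidden_nonneg; auto using entries_pos_nonneg).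
    rewrite <- rpow_add. f_equal. ring. }
  pose proof (rpow_nonneg (hidden z (x i) m) (alpha m - 1)) as P1.
  pose proof (rpow_nonneg (hidden z (x i) m) (alpha m)) as P2.
  pose proof (PVz l m Hl Hm) as P3. specialize (HV l m Hl Hm).
  eapply Rle_trans; [apply Rabs_triang|].
  rewrite !Rabs_mult, (Rabs_pos_eq (PV z l m)), (Rabs_pos_eq (alpha m)),
    (Rabs_pos_eq (rpow _ (alpha m - 1))), (Rabs_pos_eq (rpow _ (alpha m))) by lra.
  apply Rle_trans with (b * PV z l m * rpow (hidden z (x i) m) (alpha m)
    + PV z l m * (ainf * rpow (hidden z (x i) m) (alpha m - 1) * (c * hidden z (x i) m))).
  - apply Rplus_le_compat; [apply Rmult_le_compat_r; lra|].
    apply Rmult_le_compat_l; [lra|]. apply Rmult_le_compat; [|apply Rabs_pos| |exact Hh].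
    + apply Rmult_le_pos; lra.
    + apply Rmult_le_compat_r; lra.
  - right. rewrite <- Hpow. ring.
Qed.

(** The velocities are relative: a, b, c bound the logarithmic derivatives of the entries.
    Multiplying t^(beta - 1) by t restores t^beta, which leaves the outputs weighted by 1 and by
    beta that Cw and Cv control. *)
Lemma dfnet_bound a b c z dz i r : entries (Rlt 0) z -> ball z -> 0 <= a -> 0 <= b -> 0 <= c ->
  (forall r l, (r < K)%nat -> (l < n2)%nat -> Rabs (PW dz r l) <= a * PW z r l) ->
  (forall l m, (l < n2)%nat -> (m < n1)%nat -> Rabs (PV dz l m) <= b * PV z l m) ->
  (forall m s, (m < n1)%nat -> (s < d)%nat -> Rabs (PU dz m s) <= c * PU z m s) ->
  (i < n)%nat -> (r < K)%nat ->
  Rabs (dfnet z dz (x i) r) <= Cw * a + Cv * (b + ainf * c).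
Proof.
  intros Hz Hball Ha Hb Hc HW HV HU Hi Hr. pose proof Hz as [PWz _].
  pose proof (entries_pos_nonneg z Hz) as Hz0. pose proof ainf_ge1 as Hainf.
  assert (Hbc : 0 <= b + ainf * c) by (apply Rplus_le_le_0_compat; [lra|apply Rmult_le_pos; lra]).
  eapply Rle_trans; [apply fsum_abs|].
  apply Rle_trans with (a * fsum n2 (fun l => PW z r l * (1 * rpow (inner z (x i) l) (beta l)))
    + (b + ainf * c) * fsum n2 (fun l => PW z r l * (beta l * rpow (inner z (x i) l) (beta l)))).
  - rewrite <- !fsum_scal, <- fsum_plus. apply fsum_le. intros l Hl. pose proof (beta_le l Hl).
    pose proof (dinner_bound b c z dz i l Hz Hb Hc HV HU Hi Hl) as Hin.
    assert (Hpow : rpow (inner z (x i) l) (beta l - 1) * inner z (x i) l = rpow (inner z (x i) l) (beta l)).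
    { rewrite <- (rpow_1 (inner z (x i) l)) at 2 by (apply inner_nonneg; auto).
      rewrite <- rpow_add. f_equal. ring. }
    pose proof (rpow_nonneg (inner z (x i) l) (beta l - 1)) as P1.
    pose proof (rpow_nonneg (inner z (x i) l) (beta l)) as P2.
    pose proof (PWz r l Hr Hl) as P3. specialize (HW r l Hr Hl).
    eapply Rle_trans; [apply Rabs_triang|].
    rewrite !Rabs_mult, (Rabs_pos_eq (PW z r l)), (Rabs_pos_eq (beta l)),
      (Rabs_pos_eq (rpow _ (beta l - 1))), (Rabs_pos_eq (rpow _ (beta l))) by lra.
    apply Rle_trans with (a * PW z r l * rpow (inner z (x i) l) (beta l)
      + PW z r l * (beta l * rpow (inner z (x i) l) (beta l - 1) * ((b + ainf * c) * inner z (x i) l))).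
    + apply Rplus_le_compat; [apply Rmult_le_compat_r; lra|].
      apply Rmult_le_compat_l; [lra|]. apply Rmult_le_compat_l; [|exact Hin].
      apply Rmult_le_pos; lra.
    + right. rewrite <- Hpow. ring.
  - rewrite (Rmult_comm a), (Rmult_comm (b + ainf * c)). apply Rplus_le_compat.
    + apply Rmult_le_compat_r; [lra|]. apply output_bound; auto. intros; lra.
    + apply Rmult_le_compat_r; [lra|]. apply output_bound; auto.
      intros l Hl. pose proof (beta_le l Hl). lra.
Qed.

(* The geodesic from u to v for the metric |ln u - ln v|. *)
Definition geodesic (u v t : R) : R := exp ((1 - t) * ln u + t * ln v).

Lemma geodesic_derivable u v t :
  derivable_pt_lim (geodesic u v) t (geodesic u v t * (ln v - ln u)).
Proof.
  apply (derivable_pt_lim_comp (fun s => (1 - s) * ln u + s * ln v) exp); [|apply derivable_pt_lim_exp].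
  apply derivable_pt_lim_ext with (f := fun s => ln u + (ln v - ln u) * s); [intros; ring|].
  pose proof (derivable_pt_lim_plus _ _ _ _ _ (derivable_pt_lim_const (ln u) t)
    (derivable_pt_lim_scal _ (ln v - ln u) t 1 (derivable_pt_lim_id t))) as D.
  rewrite Rplus_0_l, Rmult_1_r in D. exact D.
Qed.

Lemma geodesic_0 u v : 0 < u -> geodesic u v 0 = u.
Proof. intros H. unfold geodesic. rewrite Rminus_0_r, Rmult_1_l, Rmult_0_l, Rplus_0_r. now apply exp_ln. Qed.

Lemma geodesic_1 u v : 0 < v -> geodesic u v 1 = v.
Proof. intros H. unfold geodesic. rewrite Rminus_diag, Rmult_1_l, Rmult_0_l, Rplus_0_l. now apply exp_ln. Qed.

(** By the weighted arithmetic-geometric mean, power sums are convex along geodesics; this makes the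
    balls geodesically convex. *)
Lemma geodesic_rpow_le u v t p : 0 < t < 1 -> 0 < u -> 0 < v ->
  rpow (geodesic u v t) p <= (1 - t) * rpow u p + t * rpow v p.
Proof.
  intros Ht Hu Hv.
  replace (rpow (geodesic u v t) p) with (rpow (rpow v p) t * rpow (rpow u p) (1 - t)).
  - rewrite (Rplus_comm ((1 - t) * _)). apply weighted_amgm; [exact Ht| |]; apply rpow_nonneg.
  - unfold geodesic. rewrite rpow_exp, !rpow_rpow, !rpow_pos_eq by assumption. unfold Rpower.
    rewrite <- exp_plus. f_equal. ring.
Qed.

Lemma ln_ratio a u v : 0 < u -> 0 < v -> ratio_le a u v -> ratio_le a v u -> Rabs (ln u - ln v) <= a.
Proof.
  intros Hu Hv [_ H1] [_ H2].
  assert (L : forall s w, 0 < s -> 0 < w -> s <= exp a * w -> ln s <= a + ln w).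
  { intros s w Hs Hw H. rewrite <- (ln_exp a), <- ln_mult by (assumption || apply exp_pos).
    destruct H as [H| ->]; [left; now apply ln_increasing|lra]. }
  pose proof (L u v Hu Hv H1). pose proof (L v u Hv Hu H2). apply Rabs_le. lra.
Qed.

(** Mean value theorem along the entrywise geodesic from z' to z. Each entry has constant
    logarithmic velocity ln z - ln z', at most a, b or c in absolute value. *)
Lemma fnet_lipschitz a b c z z' i r : 0 <= a -> 0 <= b -> 0 <= c ->
  entries (Rlt 0) z -> entries (Rlt 0) z' -> ball z -> ball z' ->
  close a b c z z' -> close a b c z' z -> (i < n)%nat -> (r < K)%nat ->
  Rabs (f z i r - f z' i r) <= Cw * a + Cv * (b + ainf * c).
Proof.
  intros Ha Hb Hc Hz Hz' Bz Bz' C1 C2 Hi Hr.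
  set (p := fun t => mkPar (fun i j => geodesic (PW z' i j) (PW z i j) t)
     (fun i j => geodesic (PV z' i j) (PV z i j) t) (fun i j => geodesic (PU z' i j) (PU z i j) t)).
  set (dp := fun t => mkPar
     (fun i j => geodesic (PW z' i j) (PW z i j) t * (ln (PW z i j) - ln (PW z' i j)))
     (fun i j => geodesic (PV z' i j) (PV z i j) t * (ln (PV z i j) - ln (PV z' i j)))
     (fun i j => geodesic (PU z' i j) (PU z i j) t * (ln (PU z i j) - ln (PU z' i j)))).
  assert (Hp : forall t, entries (Rlt 0) (p t)) by (intros; repeat split; intros; apply exp_pos).
  pose proof Hz as [ZW [ZV ZU]]. pose proof Hz' as [ZW' [ZV' ZU']].
  assert (E1 : f z i r = f (p 1) i r).
  { apply fnet_ext; [|exact Hr]. repeat split; intros; simpl; rewrite geodesic_1; auto. }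
  assert (E0 : f z' i r = f (p 0) i r).
  { apply fnet_ext; [|exact Hr]. repeat split; intros; simpl; rewrite geodesic_0; auto. }
  destruct (MVT_cor2 (fun t => f (p t) i r) (fun t => dfnet (p t) (dp t) (x i) r) 0 1) as [t [Ht Ht01]].
  - lra.
  - intros t _. apply (fnet_derivable p); auto. repeat split; intros; apply geodesic_derivable.
  - rewrite E1, E0, Ht, Rminus_0_r, Rmult_1_r.
    destruct C1 as [C1W [C1V C1U]], C2 as [C2W [C2V C2U]].
    apply dfnet_bound; auto.
    + destruct Bz as [BW [BV BU]], Bz' as [BW' [BV' BU']].
      (* The intermediate point stays in the balls; the matrix form covers all three layers. *)
      assert (Hsum : forall m k F F' q B, (forall i j, (i < m)%nat -> (j < k)%nat -> 0 < F i j) ->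
        (forall i j, (i < m)%nat -> (j < k)%nat -> 0 < F' i j) ->
        fsum m (fun i => fsum k (fun j => rpow (F i j) q)) <= B ->
        fsum m (fun i => fsum k (fun j => rpow (F' i j) q)) <= B ->
        fsum m (fun i => fsum k (fun j => rpow (geodesic (F' i j) (F i j) t) q)) <= B).
      { intros m k F F' q B HF HF' B1 B2.
        apply Rle_trans with ((1 - t) * fsum m (fun i => fsum k (fun j => rpow (F' i j) q))
          + t * fsum m (fun i => fsum k (fun j => rpow (F i j) q))); [|nra].
        rewrite <- !fsum_scal, <- fsum_plus. apply fsum_le. intros i0 Hi0.
        rewrite <- !fsum_scal, <- fsum_plus. apply fsum_le. intros j0 Hj0.
        apply geodesic_rpow_le; auto. }
      repeat split; simpl.
      * intros k Hk. specialize (Hsum 1%nat n2 (fun _ => PW z k) (fun _ => PW z' k) pw (rpow rw pw)).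
        simpl in Hsum. rewrite !Rplus_0_l in Hsum. apply Hsum; auto.
      * apply Hsum; auto.
      * apply Hsum; auto.
    + intros k l Hk Hl. simpl. unfold geodesic at 1 2. rewrite Rabs_mult, Rabs_pos_eq, Rmult_comm by (left; apply exp_pos).
      apply Rmult_le_compat_r; [left; apply exp_pos|]. apply ln_ratio; auto.
    + intros k l Hk Hl. simpl. unfold geodesic at 1 2. rewrite Rabs_mult, Rabs_pos_eq, Rmult_comm by (left; apply exp_pos).
      apply Rmult_le_compat_r; [left; apply exp_pos|]. apply ln_ratio; auto.
    + intros k l Hk Hl. simpl. unfold geodesic at 1 2. rewrite Rabs_mult, Rabs_pos_eq, Rmult_comm by (left; apply exp_pos).
      apply Rmult_le_compat_r; [left; apply exp_pos|]. apply ln_ratio; auto.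
Qed.

(** * The iteration map and its contraction rate *)

(** One block of the iteration map as a function of its gradient block g; a row of w is the case m =
    1. *)
Definition normal (m k : nat) (p rho : R) (g : nat -> nat -> R) (i j : nat) : R :=
  rho * psi (conj p) (g i j) / lpnorm2 p m k (fun i' j' => psi (conj p) (g i' j')).

Definition positive (m k : nat) (g : nat -> nat -> R) : Prop :=
  forall i j, (i < m)%nat -> (j < k)%nat -> 0 < g i j.

Lemma psi_pos_eq p g : 0 < g -> psi p g = rpow g (p - 1).
Proof. intros H. unfold psi. destruct (Rlt_dec 0 g); [reflexivity|lra]. Qed.

Lemma psi_norm_pos m k p g : (0 < m)%nat -> (0 < k)%nat -> positive m k g ->
  0 < lpnorm2 p m k (fun i j => psi (conj p) (g i j)).
Proof.
  intros Hm Hk Hg. apply lpnorm2_gt0 with 0%nat 0%nat; auto.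
  rewrite psi_pos_eq by auto. apply Rgt_not_eq, rpow_gt0; auto.
Qed.

Lemma normal_pos m k p rho g : (0 < m)%nat -> (0 < k)%nat -> 0 < rho -> positive m k g ->
  positive m k (normal m k p rho g).
Proof.
  intros Hm Hk Hrho Hg i j Hi Hj. unfold normal.
  apply Rdiv_lt_0_compat; [|now apply psi_norm_pos].
  apply Rmult_lt_0_compat; [exact Hrho|]. rewrite psi_pos_eq by auto. apply rpow_gt0; auto.
Qed.

Lemma normal_norm m k p rho g : (0 < m)%nat -> (0 < k)%nat -> 1 < p -> 0 < rho -> positive m k g ->
  lpnorm2 p m k (normal m k p rho g) = rho.
Proof.
  intros Hm Hk Hp Hrho Hg.
  apply (lpnorm2_normalize p m k rho (fun i j => psi (conj p) (g i j))); [lra|exact Hrho|].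
  now apply psi_norm_pos.
Qed.

(** The numerator varies with the power conj p - 1 of g. The norm is homogeneous of degree one and
    thus varies by at most the same factor; standing in the denominator, it doubles the exponent. *)
Lemma normal_ratio m k p rho g g' s : (0 < m)%nat -> (0 < k)%nat -> 1 < p -> 0 < rho ->
  positive m k g -> positive m k g' ->
  (forall i j, (i < m)%nat -> (j < k)%nat -> ratio_le s (g i j) (g' i j)) ->
  (forall i j, (i < m)%nat -> (j < k)%nat -> ratio_le s (g' i j) (g i j)) ->
  forall i j, (i < m)%nat -> (j < k)%nat ->
  ratio_le (2 * (conj p - 1) * s) (normal m k p rho g i j) (normal m k p rho g' i j).
Proof.
  intros Hm Hk Hp Hrho Hg Hg' H1 H2 i j Hi Hj. pose proof (conj_gt1 p Hp) as Hc.
  assert (Hpsi : forall h h' : nat -> nat -> R, positive m k h -> positive m k h' ->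
    (forall i j, (i < m)%nat -> (j < k)%nat -> ratio_le s (h i j) (h' i j)) ->
    forall i j, (i < m)%nat -> (j < k)%nat ->
    ratio_le (s * (conj p - 1)) (psi (conj p) (h i j)) (psi (conj p) (h' i j))).
  { intros h h' Hh Hh' H a b Ha Hb. rewrite !psi_pos_eq by auto. apply ratio_le_rpow; [lra|auto]. }
  replace (2 * (conj p - 1) * s) with (s * (conj p - 1) + s * (conj p - 1)) by ring.
  unfold normal. apply ratio_le_div; try now apply psi_norm_pos.
  - apply ratio_le_scal; [lra|]. now apply Hpsi.
  - unfold lpnorm2.
    replace (s * (conj p - 1)) with (s * (conj p - 1) * p * (1 / p)) by (field; lra).
    apply ratio_le_rpow; [left; apply Rdiv_lt_0_compat; lra|].
    apply ratio_le_fsum. intros a Ha. apply ratio_le_fsum. intros b Hb.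
    apply ratio_le_rpow; [lra|]. specialize (Hpsi g' g Hg' Hg H2 a b Ha Hb).
    pose proof (ratio_le_nonneg_r _ _ _ Hpsi). pose proof (proj1 Hpsi).
    rewrite !Rabs_pos_eq by assumption. exact Hpsi.
Qed.

(** A function realizing the relation [Gstep] at positive points; since partial derivatives are
    unique, every step agrees with it up to [same]. *)
Definition Gmap (z : Par) : Par := mkPar
  (fun r => normal 1 n2 pw rw (fun _ l => dPhi z (unitW r l)) 0%nat)
  (normal n2 n1 pv rv (fun l m => dPhi z (unitV l m)))
  (normal n1 d pu ru (fun m s => dPhi z (unitU m s))).

Lemma Spp_entries z : Spp z -> entries (Rlt 0) z.
Proof. intros [_ H]. exact H. Qed.

Lemma Splus_entries z : Splus z -> entries (Rle 0) z.
Proof. intros [H1 [H2 [H3 _]]]. repeat split; auto. Qed.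

Lemma Splus_ball z : Splus z -> ball z.
Proof.
  intros Hz. pose proof Hz as [H1 [H2 [H3 [NW [NV NU]]]]].
  assert (Hsum : forall m k F p rho, 1 < p -> 0 < rho ->
    (forall i j, (i < m)%nat -> (j < k)%nat -> 0 <= F i j) -> lpnorm2 p m k F = rho ->
    fsum m (fun i => fsum k (fun j => rpow (F i j) p)) <= rpow rho p).
  { intros m k F p rho Hp Hrho HF HN. apply lpnorm2_sum in HN; [|lra|exact Hrho].
    rewrite <- HN. right. apply fsum_ext. intros i Hi. apply fsum_ext. intros j Hj.
    rewrite Rabs_pos_eq; auto. }
  repeat split.
  - intros r Hr. specialize (Hsum 1%nat n2 (fun _ => PW z r) pw rw). simpl in Hsum.
    rewrite Rplus_0_l in Hsum. apply Hsum; auto. rewrite <- lpnorm_row. auto.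
  - apply Hsum; auto.
  - apply Hsum; auto.
Qed.

Lemma Splus_ext z z' : same z z' -> Splus z -> Splus z'.
Proof.
  intros H Hz. pose proof (entries_ext (Rle 0) z z' H (Splus_entries z Hz)) as [P1 [P2 P3]].
  destruct Hz as [_ [_ [_ [NW [NV NU]]]]]. destruct H as [E1 [E2 E3]].
  repeat split; auto.
  - intros r Hr. rewrite <- (NW r Hr), !lpnorm_row. apply lpnorm2_ext. intros; symmetry; auto.
  - rewrite <- NV. apply lpnorm2_ext. intros; symmetry; auto.
  - rewrite <- NU. apply lpnorm2_ext. intros; symmetry; auto.
Qed.

Lemma Spp_ext z z' : same z z' -> Spp z -> Spp z'.
Proof.
  intros H Hz. split; [now apply (Splus_ext z); [|apply Hz]|].
  apply (entries_ext (Rlt 0) z z' H), Spp_entries, Hz.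
Qed.

Lemma grad_positive z : entries (Rle 0) z ->
  (forall r, (r < K)%nat -> positive 1 n2 (fun _ l => dPhi z (unitW r l))) /\
  positive n2 n1 (fun l m => dPhi z (unitV l m)) /\
  positive n1 d (fun m s => dPhi z (unitU m s)).
Proof.
  intros Hz. destruct (grad_pos z Hz) as [G1 [G2 G3]].
  split; [|split]; [intros r Hr i j Hi Hj|..]; auto.
Qed.

Lemma Gmap_Spp z : entries (Rle 0) z -> Spp (Gmap z).
Proof.
  intros Hz. destruct (grad_positive z Hz) as [G1 [G2 G3]].
  assert (HP : entries (Rlt 0) (Gmap z)).
  { split; [|split]; simpl; intros a b Ha Hb;
      (apply (normal_pos 1 n2) || apply normal_pos); auto; lia. }
  split; [|exact HP]. apply entries_pos_nonneg in HP. destruct HP as [P1 [P2 P3]].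
  split; [|split; [|split; [|split; [|split]]]]; auto; simpl.
  - intros r Hr. rewrite lpnorm_row.
    rewrite (lpnorm2_ext pw 1 n2 _ (normal 1 n2 pw rw (fun _ l => dPhi z (unitW r l)))).
    + apply normal_norm; auto.
    + intros i j Hi Hj. replace i with 0%nat by lia. reflexivity.
  - apply normal_norm; auto; lia.
  - apply normal_norm; auto; lia.
Qed.

Lemma Gmap_step z : entries (Rlt 0) z -> G z (Gmap z).
Proof.
  intros Hz. exists (fun r l => dPhi z (unitW r l)), (fun l m => dPhi z (unitV l m)), (fun m s => dPhi z (unitU m s)).
  split; [now apply dPhi_is_grad|]. split; [|split]; intros a b Ha Hb; simpl; unfold normal; auto.
  now rewrite lpnorm_row.
Qed.

Lemma Gstep_same z z' : entries (Rlt 0) z -> G z z' -> same (Gmap z) z'.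
Proof.
  intros Hz [gW [gV [gU [[D1 [D2 D3]] [E1 [E2 E3]]]]]].
  destruct (dPhi_is_grad z Hz) as [F1 [F2 F3]].
  assert (U1 : forall r l, (r < K)%nat -> (l < n2)%nat -> gW r l = dPhi z (unitW r l)).
  { intros r l Hr Hl. eapply uniqueness_limite; [now apply D1|now apply F1]. }
  assert (U2 : forall r l, (r < n2)%nat -> (l < n1)%nat -> gV r l = dPhi z (unitV r l)).
  { intros r l Hr Hl. eapply uniqueness_limite; [now apply D2|now apply F2]. }
  assert (U3 : forall r l, (r < n1)%nat -> (l < d)%nat -> gU r l = dPhi z (unitU r l)).
  { intros r l Hr Hl. eapply uniqueness_limite; [now apply D3|now apply F3]. }
  split; [|split]; intros a b Ha Hb; simpl; unfold normal.
  - rewrite E1, U1, lpnorm_row by assumption. f_equal.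
    apply lpnorm2_ext. intros; now rewrite U1.
  - rewrite E2, U2 by assumption. f_equal. apply lpnorm2_ext. intros; now rewrite U2.
  - rewrite E3, U3 by assumption. f_equal. apply lpnorm2_ext. intros; now rewrite U3.
Qed.

Definition near (a b c : R) (z z' : Par) : Prop := close a b c z z' /\ close a b c z' z.

Local Notation Cu := (ainf * Cv).

(** The three constants are the rows of A applied to (a, b, c), with the K equal w-columns counted
    once. The part 2 E comes from the softmax weights, the rest from the degrees of the derivative
    in the respective layer. *)
Lemma Gmap_close a b c z z' : 0 <= a -> 0 <= b -> 0 <= c -> Spp z -> Spp z' -> near a b c z z' ->
  close (2 * (conj pw - 1) * (2 * Cw * a + (2 * Cv + binf) * b + (2 * Cu + ainf * binf) * c))
        (2 * (conj pv - 1) * ((2 * Cw + 1) * a + (2 * Cv + binf - 1) * b + (2 * Cu + ainf * binf) * c))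
        (2 * (conj pu - 1) * ((2 * Cw + 1) * a + (2 * Cv + binf) * b + (2 * Cu + ainf * binf - 1) * c))
    (Gmap z) (Gmap z').
Proof.
  intros Ha Hb Hc Hz Hz' [C1 C2].
  pose proof (Spp_entries z Hz) as Pz. pose proof (Spp_entries z' Hz') as Pz'.
  pose proof (entries_pos_nonneg z Pz) as Nz. pose proof (entries_pos_nonneg z' Pz') as Nz'.
  pose proof (Splus_ball z (proj1 Hz)) as Bz. pose proof (Splus_ball z' (proj1 Hz')) as Bz'.
  pose proof ainf_ge1 as A1. pose proof binf_ge1 as B1.
  pose proof Cw_nonneg as C0. pose proof Cv_nonneg as D0.
  destruct (grad_positive z Nz) as [G1 [G2 G3]]. destruct (grad_positive z' Nz') as [G1' [G2' G3']].
  set (E := Cw * a + Cv * (b + ainf * c)).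
  assert (Hbc : 0 <= b + ainf * c) by nra.
  assert (HE : 0 <= E).
  { unfold E. apply Rplus_le_le_0_compat; apply Rmult_le_pos; assumption. }
  assert (Hf : forall i r, (i < n)%nat -> (r < K)%nat -> Rabs (f z i r - f z' i r) <= E).
  { intros; now apply fnet_lipschitz. }
  assert (Hf' : forall i r, (i < n)%nat -> (r < K)%nat -> Rabs (f z' i r - f z i r) <= E).
  { intros; rewrite Rabs_minus_sym; auto. }
  split; [|split]; intros k l Hk Hl; simpl.
  - replace (2 * Cw * a + (2 * Cv + binf) * b + (2 * Cu + ainf * binf) * c)
      with (2 * E + (b + ainf * c) * binf) by (unfold E; ring).
    assert (0 <= (b + ainf * c) * binf) by (apply Rmult_le_pos; lra).
    apply (normal_ratio 1 n2); auto; intros; apply dPhi_ratio; auto using unitW_nonneg;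
      intros; apply (dfnet_ratio_W a); auto using unitW_nonneg.
  - replace ((2 * Cw + 1) * a + (2 * Cv + binf - 1) * b + (2 * Cu + ainf * binf) * c)
      with (2 * E + (a + ((b + ainf * c) * (binf - 1) + ainf * c))) by (unfold E; ring).
    assert (0 <= a + ((b + ainf * c) * (binf - 1) + ainf * c)).
    { repeat apply Rplus_le_le_0_compat; auto; apply Rmult_le_pos; lra. }
    apply (normal_ratio n2 n1); auto; intros; apply dPhi_ratio; auto using unitV_nonneg;
      intros; apply dfnet_ratio_V; auto using unitV_nonneg.
  - replace ((2 * Cw + 1) * a + (2 * Cv + binf) * b + (2 * Cu + ainf * binf - 1) * c)
      with (2 * E + (a + ((b + ainf * c) * (binf - 1) + (b + c * (ainf - 1))))) by (unfold E; ring).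
    assert (0 <= a + ((b + ainf * c) * (binf - 1) + (b + c * (ainf - 1)))).
    { repeat apply Rplus_le_le_0_compat; auto; apply Rmult_le_pos; lra. }
    apply (normal_ratio n1 d); auto; intros; apply dPhi_ratio; auto using unitU_nonneg;
      intros; apply dfnet_ratio_U; auto using unitU_nonneg.
Qed.

(** * Contraction in Perron weights and conversion to the maximum norm *)

Lemma close_weaken a b c a' b' c' z z' : a <= a' -> b <= b' -> c <= c' ->
  close a b c z z' -> close a' b' c' z z'.
Proof.
  intros Ha Hb Hc [H1 [H2 H3]].
  split; [|split]; intros; (eapply ratio_le_weaken; [eauto|assumption]).
Qed.

Lemma close_ext a b c z z' t t' : same z t -> same z' t' -> close a b c z z' -> close a b c t t'.
Proof.
  intros [E1 [E2 E3]] [F1 [F2 F3]] [H1 [H2 H3]].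
  split; [|split]; intros; [rewrite <- E1, <- F1|rewrite <- E2, <- F2|rewrite <- E3, <- F3]; auto.
Qed.

(* A x <= lam x for a vector x equal to xw on all rows of w.  The w-columns are counted once instead
   of K times, because [near] uses a single constant for all rows of w. *)
Definition perron_vector (lam xw xv xu : R) : Prop :=
  0 < lam /\ 0 < xw /\ 0 < xv /\ 0 < xu /\
  2 * (conj pw - 1) * (2 * Cw * xw + (2 * Cv + binf) * xv + (2 * Cu + ainf * binf) * xu) <= lam * xw /\
  2 * (conj pv - 1) * ((2 * Cw + 1) * xw + (2 * Cv + binf - 1) * xv + (2 * Cu + ainf * binf) * xu) <= lam * xv /\
  2 * (conj pu - 1) * ((2 * Cw + 1) * xw + (2 * Cv + binf) * xv + (2 * Cu + ainf * binf - 1) * xu) <= lam * xu.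

Lemma Gmap_contraction lam xw xv xu M z z' : perron_vector lam xw xv xu -> 0 <= M ->
  Spp z -> Spp z' -> near (M * xw) (M * xv) (M * xu) z z' ->
  near (lam * M * xw) (lam * M * xv) (lam * M * xu) (Gmap z) (Gmap z').
Proof.
  intros [Hl [Hw [Hv [Hu [Q1 [Q2 Q3]]]]]] HM Hz Hz' [N1 N2].
  apply Rmult_le_compat_l with (r := M) in Q1; [|exact HM].
  apply Rmult_le_compat_l with (r := M) in Q2; [|exact HM].
  apply Rmult_le_compat_l with (r := M) in Q3; [|exact HM].
  assert (P1 : 0 <= M * xw) by (apply Rmult_le_pos; lra).
  assert (P2 : 0 <= M * xv) by (apply Rmult_le_pos; lra).
  assert (P3 : 0 <= M * xu) by (apply Rmult_le_pos; lra).
  pose proof (Gmap_close _ _ _ z z' P1 P2 P3 Hz Hz' (Logic.conj N1 N2)) as C1.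
  pose proof (Gmap_close _ _ _ z' z P1 P2 P3 Hz' Hz (Logic.conj N2 N1)) as C2.
  split; (eapply close_weaken; [| | |eassumption]); lra.
Qed.

Lemma distinf_le z z' c : 0 <= c ->
  (forall r l, (r < K)%nat -> (l < n2)%nat -> Rabs (PW z r l - PW z' r l) <= c) ->
  (forall l m, (l < n2)%nat -> (m < n1)%nat -> Rabs (PV z l m - PV z' l m) <= c) ->
  (forall m s, (m < n1)%nat -> (s < d)%nat -> Rabs (PU z m s - PU z' m s) <= c) ->
  distinf K n1 n2 d z z' <= c.
Proof.
  intros Hc H1 H2 H3. unfold distinf.
  repeat apply Rmax_lub; apply fmax_le; auto; intros; apply fmax_le; auto.
Qed.

Lemma distinf_nonneg z z' : 0 <= distinf K n1 n2 d z z'.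
Proof. unfold distinf. eapply Rle_trans; [apply fmax_nonneg|apply Rmax_r]. Qed.

Lemma exp_m1_le s : exp s - 1 <= s * exp s.
Proof.
  pose proof (exp_ineq1_le (- s)) as H. pose proof (exp_pos s) as P.
  apply Rmult_le_compat_l with (r := exp s) in H; [|lra].
  rewrite <- exp_plus, Rplus_opp_r, exp_0 in H. lra.
Qed.

(** Since exp s - 1 <= s exp s, the distance is linear in s up to a factor that stays bounded along
    the iteration. *)
Lemma ratio_le_dist s u v rho : 0 <= s -> u <= rho -> v <= rho ->
  ratio_le s u v -> ratio_le s v u -> Rabs (u - v) <= s * exp s * rho.
Proof.
  intros Hs Hu Hv [U0 H1] [V0 H2]. pose proof (exp_m1_le s) as H.
  pose proof (exp_le _ _ Hs) as H0. rewrite exp_0 in H0.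
  assert ((exp s - 1) * u <= s * exp s * rho) by (apply Rmult_le_compat; lra).
  assert ((exp s - 1) * v <= s * exp s * rho) by (apply Rmult_le_compat; lra).
  apply Rabs_le. lra.
Qed.

Lemma Splus_entries_le z : Splus z -> entries (fun v => v <= rw + rv + ru) z.
Proof.
  intros [_ [_ [_ [NW [NV NU]]]]].
  assert (H : forall m k p F rho, 1 < p -> lpnorm2 p m k F = rho ->
     forall i j, (i < m)%nat -> (j < k)%nat -> F i j <= rho).
  { intros m k p F rho Hp HN i j Hi Hj. rewrite <- HN.
    eapply Rle_trans; [apply Rle_abs|]. apply lpnorm2_entry_le; auto; lra. }
  split; [|split]; intros a b Ha Hb.
  - specialize (NW a Ha). rewrite lpnorm_row in NW.
    pose proof (H 1%nat n2 pw _ _ Hpw NW 0%nat b Nat.lt_0_1 Hb) as E. simpl in E. lra.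
  - pose proof (H _ _ _ _ _ Hpv NV a b Ha Hb). lra.
  - pose proof (H _ _ _ _ _ Hpu NU a b Ha Hb). lra.
Qed.

Lemma near_dist s z z' : 0 <= s -> Splus z -> Splus z' -> near s s s z z' ->
  distinf K n1 n2 d z z' <= s * exp s * (rw + rv + ru).
Proof.
  intros Hs Hz Hz' [[A1 [A2 A3]] [B1 [B2 B3]]].
  destruct (Splus_entries_le z Hz) as [L1 [L2 L3]].
  destruct (Splus_entries_le z' Hz') as [L1' [L2' L3']].
  apply distinf_le; [apply Rmult_le_pos; [apply Rmult_le_pos; [lra|left; apply exp_pos]|lra]|..];
    intros; apply ratio_le_dist; auto.
Qed.

(** As t <= exp t, the largest quotient of entries can itself serve as the exponent. *)
Lemma close_exists z z' : entries (Rlt 0) z -> entries (Rlt 0) z' ->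
  exists a, 0 <= a /\ close a a a z z'.
Proof.
  intros [H1 [H2 H3]] [H1' [H2' H3']].
  assert (H : forall m k F F', positive m k F -> positive m k F' ->
    exists a, 0 <= a /\ forall i j, (i < m)%nat -> (j < k)%nat -> ratio_le a (F i j) (F' i j)).
  { intros m k F F' HF HF'. exists (fmax m (fun i => fmax k (fun j => F i j / F' i j))).
    split; [apply fmax_nonneg|]. intros i j Hi Hj. specialize (HF i j Hi Hj). specialize (HF' i j Hi Hj).
    split; [lra|]. apply Rmult_le_reg_r with (/ F' i j); [now apply Rinv_0_lt_compat|].
    rewrite Rmult_assoc, Rinv_r, Rmult_1_r by lra.
    eapply Rle_trans; [|apply Rle_trans with (2 := exp_ineq1_le _)].
    - apply (fmax_ge k (fun j => F i j / F' i j)), Hj.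
    - pose proof (fmax_ge m (fun i => fmax k (fun j => F i j / F' i j)) i Hi) as Q. cbv beta in Q. lra. }
  destruct (H K n2 _ _ H1 H1') as [a [Ha Ra]].
  destruct (H n2 n1 _ _ H2 H2') as [b [Hb Rb]].
  destruct (H n1 d _ _ H3 H3') as [c [Hc Rc]].
  exists (a + b + c). split; [lra|].
  apply close_weaken with a b c; try lra. repeat split; auto; intros; (apply Ra || apply Rb || apply Rc); auto.
Qed.

Lemma near_exists xw xv xu z z' : 0 < xw -> 0 < xv -> 0 < xu ->
  entries (Rlt 0) z -> entries (Rlt 0) z' ->
  exists M, 0 <= M /\ near (M * xw) (M * xv) (M * xu) z z'.
Proof.
  intros Hw Hv Hu Hz Hz'.
  destruct (close_exists z z' Hz Hz') as [a [Ha Ca]]. destruct (close_exists z' z Hz' Hz) as [b [Hb Cb]].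
  assert (I : forall t, 0 < t -> 0 <= (a + b) / t).
  { intros t Ht. apply Rmult_le_pos; [lra|left; now apply Rinv_0_lt_compat]. }
  set (M := (a + b) / xw + (a + b) / xv + (a + b) / xu).
  pose proof (I _ Hw) as Iw. pose proof (I _ Hv) as Iv. pose proof (I _ Hu) as Iu.
  assert (J : forall t, 0 < t -> (a + b) / t <= M -> a + b <= M * t).
  { intros t Ht H. apply Rmult_le_compat_r with (r := t) in H; [|lra].
    unfold Rdiv in H. rewrite Rmult_assoc, Rinv_l in H; lra. }
  assert (Jw : a + b <= M * xw) by (apply J; [exact Hw|unfold M; lra]).
  assert (Jv : a + b <= M * xv) by (apply J; [exact Hv|unfold M; lra]).
  assert (Ju : a + b <= M * xu) by (apply J; [exact Hu|unfold M; lra]).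
  exists M. split; [unfold M; lra|].
  split; [apply close_weaken with a a a|apply close_weaken with b b b]; auto; lra.
Qed.

Lemma iterates_rate lam xw xv xu zs z0 : perron_vector lam xw xv xu -> lam <= 1 ->
  Spp zs -> same (Gmap zs) zs -> Spp z0 ->
  exists C, 0 < C /\ forall s : nat -> Par, s O = z0 -> (forall k, G (s k) (s (S k))) ->
    forall k, distinf K n1 n2 d (s k) zs <= C * lam ^ k.
Proof.
  intros HP Hlam1 Hzs Hfix Hz0. pose proof HP as [Hl [Hw [Hv [Hu _]]]].
  destruct (near_exists xw xv xu z0 zs Hw Hv Hu (Spp_entries _ Hz0) (Spp_entries _ Hzs)) as [M [HM HN]].
  set (X := M * (xw + xv + xu)).
  assert (HX : 0 <= X) by (apply Rmult_le_pos; lra).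
  (* The conversion to distances yields lam^k X exp(lam^k X), and lam <= 1 bounds the exponential by
     exp X. The summand 1 only makes the constant positive. *)
  exists (X * exp X * (rw + rv + ru) + 1). split.
  { apply Rplus_le_lt_0_compat; [|lra].
    apply Rmult_le_pos; [apply Rmult_le_pos; [exact HX|left; apply exp_pos]|lra]. }
  intros s Hs0 HG k.
  assert (Hk : Spp (s k) /\ near (lam ^ k * M * xw) (lam ^ k * M * xv) (lam ^ k * M * xu) (s k) zs).
  { induction k as [|k [IH1 IH2]].
    - rewrite Hs0. split; [exact Hz0|]. simpl. rewrite !Rmult_1_l. exact HN.
    - pose proof (Gstep_same _ _ (Spp_entries _ IH1) (HG k)) as E. split.
      + apply (Spp_ext _ _ E), Gmap_Spp, entries_pos_nonneg, Spp_entries, IH1.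
      + assert (HMk : 0 <= lam ^ k * M) by (apply Rmult_le_pos; [apply pow_le; lra|exact HM]).
        destruct (Gmap_contraction lam xw xv xu _ _ _ HP HMk IH1 Hzs IH2) as [N1 N2].
        simpl. rewrite !(Rmult_assoc lam (lam ^ k) M).
        split; [apply (close_ext _ _ _ _ _ _ _ E Hfix N1)|apply (close_ext _ _ _ _ _ _ _ Hfix E N2)]. }
  destruct Hk as [Hk1 [N1 N2]].
  assert (L0 : 0 <= lam ^ k) by (apply pow_le; lra).
  assert (L1 : lam ^ k <= 1) by (rewrite <- (pow1 k); apply pow_incr; lra).
  assert (HsX : 0 <= lam ^ k * X) by (apply Rmult_le_pos; assumption).
  assert (Q : forall t, 0 <= t -> t <= xw + xv + xu -> lam ^ k * M * t <= lam ^ k * X).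
  { intros t Ht H. unfold X. rewrite Rmult_assoc. apply Rmult_le_compat_l; [exact L0|].
    apply Rmult_le_compat_l; assumption. }
  apply Rle_trans with (lam ^ k * X * exp (lam ^ k * X) * (rw + rv + ru)).
  - apply near_dist; [exact HsX|apply Hk1|apply Hzs|].
    split; (eapply close_weaken; [| | |eassumption]); apply Q; lra.
  - assert (E1 : exp (lam ^ k * X) <= exp X) by (apply exp_le; nra).
    pose proof (exp_pos (lam ^ k * X)).
    apply Rle_trans with (lam ^ k * X * exp X * (rw + rv + ru)).
    + apply Rmult_le_compat_r; [lra|]. apply Rmult_le_compat_l; assumption.
    + rewrite (Rmult_plus_distr_r _ 1). lra.
Qed.

(* With q_i = 2(p_i' - 1) and c = (2 Cw + 1, 2 Cv + |beta|, 2 Cu + |alpha||beta|) the matrix is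
   diag(q) (1 c^T - E), E block diagonal with all-one blocks; hence its Perron eigenvalue solves
   this secular equation. *)
Lemma secular_root k qw qv qu cw cv cu : 1 <= k -> 0 < qw -> 0 < qv -> 0 < qu ->
  1 <= cw -> 1 <= cv -> 1 <= cu ->
  exists lam, 0 < lam /\ k * qw * cw / (lam + k * qw) + qv * cv / (lam + qv) + qu * cu / (lam + qu) = 1.
Proof.
  intros Hk Hw Hv Hu Cw' Cv' Cu'.
  set (B := k * qw * cw + qv * cv + qu * cu).
  assert (Kq : 0 < k * qw) by nra.
  assert (B1 : 0 < k * qw * cw) by nra. assert (B2 : 0 < qv * cv) by nra. assert (B3 : 0 < qu * cu) by nra.
  set (h := fun lam => 1 - (k * qw * cw * / (lam + k * qw) + qv * cv * / (lam + qv) + qu * cu * / (lam + qu))).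
  assert (T : forall a q, 0 < a -> 0 < q -> a * / (B + q) < a * / B).
  { intros a q Ha Hq. apply Rmult_lt_compat_l; [exact Ha|]. apply Rinv_lt_contravar; [|lra].
    apply Rmult_lt_0_compat; unfold B; lra. }
  (* At 0 the sum equals cw + cv + cu >= 3, and at B it lies below the sum of the numerators divided
     by B, which is 1; hence h changes sign. *)
  destruct (IVT_interv h 0 B) as [lam [Hlam Hh]].
  - intros a Ha. unfold h. reg; lra.
  - unfold B; lra.
  - unfold h. rewrite !Rplus_0_l. replace (k * qw * cw * / (k * qw)) with cw by (field; lra).
    replace (qv * cv * / qv) with cv by (field; lra). replace (qu * cu * / qu) with cu by (field; lra). lra.
  - unfold h. pose proof (T _ _ B1 Kq). pose proof (T _ _ B2 Hv). pose proof (T _ _ B3 Hu).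
    assert (k * qw * cw * / B + qv * cv * / B + qu * cu * / B = 1) by (unfold B; field; fold B; unfold B; lra).
    lra.
  - assert (lam <> 0).
    { intros ->. unfold h in Hh. rewrite !Rplus_0_l in Hh.
      replace (k * qw * cw * / (k * qw)) with cw in Hh by (field; lra).
      replace (qv * cv * / qv) with cv in Hh by (field; lra).
      replace (qu * cu * / qu) with cu in Hh by (field; lra). lra. }
    exists lam. split; [lra|]. unfold h in Hh. unfold Rdiv. lra.
Qed.

Lemma perron_exists rhoA :
  is_spectral_radius (K + 2) (Amat K pw pv pu Cw Cv Cu ainf binf) rhoA ->
  exists lam xw xv xu, perron_vector lam xw xv xu /\ lam <= rhoA.
Proof.
  intros [_ Hrad].
  pose proof (conj_gt1 pw Hpw) as Q1. pose proof (conj_gt1 pv Hpv) as Q2. pose proof (conj_gt1 pu Hpu) as Q3.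
  pose proof Cw_nonneg as P1. pose proof Cv_nonneg as P2. pose proof ainf_ge1 as P3. pose proof binf_ge1 as P4.
  assert (P5 : 0 <= Cu) by (apply Rmult_le_pos; lra).
  assert (P6 : 1 <= ainf * binf) by nra.
  assert (HK : 1 <= INR K) by (apply (le_INR 1), K_pos).
  set (qw := 2 * (conj pw - 1)). set (qv := 2 * (conj pv - 1)). set (qu := 2 * (conj pu - 1)).
  set (cw := 2 * Cw + 1). set (cv := 2 * Cv + binf). set (cu := 2 * Cu + ainf * binf).
  assert (W : 0 < qw /\ 0 < qv /\ 0 < qu /\ 1 <= cw /\ 1 <= cv /\ 1 <= cu).
  { unfold qw, qv, qu, cw, cv, cu. repeat split; lra. }
  destruct W as [W1 [W2 [W3 [W4 [W5 W6]]]]].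
  destruct (secular_root (INR K) qw qv qu cw cv cu) as [lam [Hl Hsec]]; auto.
  assert (Kq : 0 < INR K * qw) by nra.
  (* Row i of the eigenvalue equation reads lam x_i = q_i (c . x - sum of x over the block of i).
     Normalizing c . x = 1 gives these weights, and the secular equation is exactly that
     normalization. *)
  set (xw := qw / (lam + INR K * qw)). set (xv := qv / (lam + qv)). set (xu := qu / (lam + qu)).
  assert (Xw : 0 < xw) by (apply Rdiv_lt_0_compat; lra).
  assert (Xv : 0 < xv) by (apply Rdiv_lt_0_compat; lra).
  assert (Xu : 0 < xu) by (apply Rdiv_lt_0_compat; lra).
  assert (T : INR K * cw * xw + cv * xv + cu * xu = 1).
  { rewrite <- Hsec. unfold xw, xv, xu. field. lra. }
  assert (Ew : lam * xw = qw * (1 - INR K * xw)) by (unfold xw; field; lra).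
  assert (Ev : lam * xv = qv * (1 - xv)) by (unfold xv; field; lra).
  assert (Eu : lam * xu = qu * (1 - xu)) by (unfold xu; field; lra).
  exists lam, xw, xv, xu. split.
  - unfold perron_vector. fold qw qv qu. fold cv cu. fold cw.
    (* The remaining K - 1 copies of the w-column contribute nonnegative amounts; dropping them
       turns the eigenvalue equations into inequalities. *)
    assert (S1 : 0 <= (INR K - 1) * xw) by (apply Rmult_le_pos; lra).
    assert (S2 : 0 <= cw * ((INR K - 1) * xw)) by (apply Rmult_le_pos; lra).
    assert (S3 : 0 <= (cw - 1) * ((INR K - 1) * xw)) by (apply Rmult_le_pos; lra).
    repeat split; auto.
    + rewrite Ew. apply Rmult_le_compat_l; [lra|]. unfold cw in *. lra.
    + rewrite Ev. apply Rmult_le_compat_l; [lra|]. lra.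
    + rewrite Eu. apply Rmult_le_compat_l; [lra|]. lra.
  (* lam is an eigenvalue with imaginary part 0, so the definition of the spectral radius bounds
     it. *)
  - replace lam with (sqrt (lam ^ 2 + 0 ^ 2)) by (rewrite pow_i, Rplus_0_r by lia; apply sqrt_pow2; lra).
    apply Hrad.
    exists (fun j => if Nat.ltb j K then xw else if Nat.eqb j K then xv else xu), (fun _ => 0). split.
    + exists 0%nat. split; [lia|]. left. pose proof K_pos.
      destruct (Nat.ltb_spec 0 K); [lra|lia].
    + intros i Hi. split; cycle 1.
      { rewrite (fsum_ext _ _ (fun _ => 0)) by (intros; ring). rewrite fsum_0. ring. }
      rewrite fsum_split. simpl fsum at 2. rewrite Nat.add_0_r, Nat.add_1_r.
      assert (N1 : Nat.ltb K K = false) by (apply Nat.ltb_ge; lia).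
      assert (N2 : Nat.ltb (S K) K = false) by (apply Nat.ltb_ge; lia).
      assert (N3 : Nat.eqb (S K) K = false) by (apply Nat.eqb_neq; lia).
      unfold Amat. rewrite N1, N2, N3, Nat.eqb_refl.
      rewrite Rmult_0_l, Rminus_0_r, Rplus_0_l.
      destruct (Nat.ltb_spec i K) as [Li|Li]; [|destruct (Nat.eqb_spec i K) as [Ei|Ei]].
      * rewrite (fsum_ext K _ (fun _ => qw * (cw - 1) * xw)).
        2:{ intros j Hj. destruct (Nat.ltb_spec j K); [unfold qw, cw; ring|lia]. }
        rewrite fsum_const. transitivity (qw * ((INR K * cw * xw + cv * xv + cu * xu) - INR K * xw));
          [unfold qw, cv, cu; ring|rewrite T; lra].
      * rewrite (fsum_ext K _ (fun _ => qv * cw * xw)).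
        2:{ intros j Hj. destruct (Nat.ltb_spec j K); [unfold qv, cw; ring|lia]. }
        rewrite fsum_const. transitivity (qv * ((INR K * cw * xw + cv * xv + cu * xu) - xv));
          [unfold qv, cv, cu; ring|rewrite T; lra].
      * rewrite (fsum_ext K _ (fun _ => qu * cw * xw)).
        2:{ intros j Hj. destruct (Nat.ltb_spec j K); [unfold qu, cw; ring|lia]. }
        rewrite fsum_const. transitivity (qu * ((INR K * cw * xw + cv * xv + cu * xu) - xu));
          [unfold qu, cv, cu; ring|rewrite T; lra].
Qed.

(** * Existence of a maximizer *)

Definition par_cv (z : nat -> Par) (zs : Par) : Prop :=
  (forall r l, (r < K)%nat -> (l < n2)%nat -> Un_cv (fun k => PW (z k) r l) (PW zs r l)) /\
  (forall l m, (l < n2)%nat -> (m < n1)%nat -> Un_cv (fun k => PV (z k) l m) (PV zs l m)) /\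
  (forall m s, (m < n1)%nat -> (s < d)%nat -> Un_cv (fun k => PU (z k) m s) (PU zs m s)).

Lemma hidden_Un_cv z zs xi m : par_cv z zs -> (m < n1)%nat ->
  Un_cv (fun k => hidden (z k) xi m) (hidden zs xi m).
Proof.
  intros [_ [_ HU]] Hm. apply (fsum_Un_cv d (fun k s => PU (z k) m s * xi s)). intros s Hs.
  apply (CV_mult (fun k => PU (z k) m s) (fun _ => xi s)); [auto|apply Un_cv_const].
Qed.

Lemma inner_Un_cv z zs xi l : par_cv z zs -> (l < n2)%nat ->
  Un_cv (fun k => inner (z k) xi l) (inner zs xi l).
Proof.
  intros H Hl. pose proof H as [_ [HV _]].
  apply (fsum_Un_cv n1 (fun k m => PV (z k) l m * rpow (hidden (z k) xi m) (alpha m))). intros m Hm.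
  apply (CV_mult (fun k => PV (z k) l m) (fun k => rpow (hidden (z k) xi m) (alpha m))); [auto|].
  apply rpow_Un_cv; [pose proof (alpha_le m Hm); lra|now apply hidden_Un_cv].
Qed.

Lemma fnet_Un_cv z zs i r : par_cv z zs -> (r < K)%nat -> Un_cv (fun k => f (z k) i r) (f zs i r).
Proof.
  intros H Hr. pose proof H as [HW _].
  apply (fsum_Un_cv n2 (fun k l => PW (z k) r l * rpow (inner (z k) (x i) l) (beta l))). intros l Hl.
  apply (CV_mult (fun k => PW (z k) r l) (fun k => rpow (inner (z k) (x i) l) (beta l))); [auto|].
  apply rpow_Un_cv; [pose proof (beta_le l Hl); lra|now apply inner_Un_cv].
Qed.

Definition gain (i : nat) (F : nat -> R) : R := - loss K (y i) F + fsum K F.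

Lemma gain_Un_cv z zs i : par_cv z zs -> (i < n)%nat ->
  Un_cv (fun k => gain i (fnet n1 n2 d alpha beta (z k) (x i))) (gain i (fnet n1 n2 d alpha beta zs (x i))).
Proof.
  intros H Hi. assert (Hf := fun r => fnet_Un_cv z zs i r H). unfold gain, loss.
  apply (CV_plus (fun k => _) (fun k => fsum K (fnet n1 n2 d alpha beta (z k) (x i)))).
  - apply (CV_opp (fun k => - f (z k) i (y i) + ln (fsum K (fun j => exp (f (z k) i j))))).
    apply (CV_plus (fun k => - f (z k) i (y i)) (fun k => ln (fsum K (fun j => exp (f (z k) i j))))).
    + apply (CV_opp (fun k => f (z k) i (y i))). auto.
    + apply (continuity_seq ln).
      * apply derivable_continuous_pt. eexists. apply derivable_pt_lim_ln, sum_exp_pos.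
      * apply (fsum_Un_cv K (fun k j => exp (f (z k) i j))). intros j Hj.
        apply (continuity_seq exp); [apply derivable_continuous, derivable_exp|auto].
  - apply (fsum_Un_cv K (fun k => fnet n1 n2 d alpha beta (z k) (x i))). auto.
Qed.

Lemma total_Un_cv z zs : par_cv z zs -> Un_cv (fun k => total (z k)) (total zs).
Proof.
  intros [HW [HV HU]]. unfold total.
  apply (CV_plus (fun k => _ + _) (fun k => fsum n1 (fun m => fsum d (PU (z k) m)))).
  - apply (CV_plus (fun k => fsum K (fun r => fsum n2 (PW (z k) r))) (fun k => fsum n2 (fun l => fsum n1 (PV (z k) l)))).
    + apply (fsum_Un_cv K (fun k r => fsum n2 (PW (z k) r))). intros r Hr.
      apply (fsum_Un_cv n2 (fun k l => PW (z k) r l)). auto.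
    + apply (fsum_Un_cv n2 (fun k r => fsum n1 (PV (z k) r))). intros r Hr.
      apply (fsum_Un_cv n1 (fun k l => PV (z k) r l)). auto.
  - apply (fsum_Un_cv n1 (fun k r => fsum d (PU (z k) r))). intros r Hr.
    apply (fsum_Un_cv d (fun k l => PU (z k) r l)). auto.
Qed.

Lemma Phi_split z : Ph z = 1 / INR n * fsum n (fun i => gain i (fnet n1 n2 d alpha beta z (x i))) + eps * total z.
Proof. reflexivity. Qed.

Lemma Phi_Un_cv z zs : par_cv z zs -> Un_cv (fun k => Ph (z k)) (Ph zs).
Proof.
  intros H.
  apply (CV_plus (fun k => 1 / INR n * fsum n (fun i => gain i (fnet n1 n2 d alpha beta (z k) (x i))))
    (fun k => eps * total (z k))).
  - apply (CV_mult (fun _ => 1 / INR n)); [apply Un_cv_const|].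
    apply (fsum_Un_cv n (fun k i => gain i (fnet n1 n2 d alpha beta (z k) (x i)))).
    intros i Hi. now apply gain_Un_cv.
  - apply (CV_mult (fun _ => eps)); [apply Un_cv_const|now apply total_Un_cv].
Qed.

Lemma lpnorm2_Un_cv p m k (F : nat -> nat -> nat -> R) Fs : 1 < p ->
  (forall i j, (i < m)%nat -> (j < k)%nat -> Un_cv (fun q => F q i j) (Fs i j)) ->
  Un_cv (fun q => lpnorm2 p m k (F q)) (lpnorm2 p m k Fs).
Proof.
  intros Hp H. apply rpow_Un_cv; [apply Rdiv_lt_0_compat; lra|].
  apply (fsum_Un_cv m (fun q i => fsum k (fun j => rpow (Rabs (F q i j)) p))). intros i Hi.
  apply (fsum_Un_cv k (fun q j => rpow (Rabs (F q i j)) p)). intros j Hj.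
  apply (rpow_Un_cv p (fun q => Rabs (F q i j))); [lra|]. apply cv_cvabs. auto.
Qed.

Lemma Un_cv_eq_const u c l : Un_cv u l -> (forall k, u k = c) -> l = c.
Proof.
  intros H Hc. apply (UL_sequence u); [exact H|].
  intros e He. exists 0%nat. intros k _. rewrite Hc. unfold Rdist. now rewrite Rminus_diag, Rabs_R0.
Qed.

Lemma Splus_closed z zs : par_cv z zs -> (forall k, Splus (z k)) -> Splus zs.
Proof.
  intros [HW [HV HU]] Hz.
  assert (N : forall u l, Un_cv u l -> (forall k, 0 <= u k) -> 0 <= l).
  { intros u l Hu H. apply (@Rle_cv_lim (fun _ => 0) u 0 l); auto. apply Un_cv_const. }
  repeat split.
  - intros r l Hr Hl. apply (N _ _ (HW r l Hr Hl)). intros k. apply (Hz k); auto.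
  - intros r l Hr Hl. apply (N _ _ (HV r l Hr Hl)). intros k. apply (Hz k); auto.
  - intros r l Hr Hl. apply (N _ _ (HU r l Hr Hl)). intros k. apply (Hz k); auto.
  - intros r Hr. rewrite lpnorm_row.
    apply (Un_cv_eq_const (fun k => lpnorm2 pw 1 n2 (fun _ => PW (z k) r))).
    + apply (lpnorm2_Un_cv pw 1 n2 (fun k _ => PW (z k) r)); auto.
    + intros k. rewrite <- lpnorm_row. apply (Hz k); auto.
  - apply (Un_cv_eq_const (fun k => lpnorm2 pv n2 n1 (PV (z k)))).
    + apply (lpnorm2_Un_cv pv n2 n1 (fun k => PV (z k))); auto.
    + intros k. apply (Hz k).
  - apply (Un_cv_eq_const (fun k => lpnorm2 pu n1 d (PU (z k)))).
    + apply (lpnorm2_Un_cv pu n1 d (fun k => PU (z k))); auto.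
    + intros k. apply (Hz k).
Qed.

Lemma Un_cv_subseq u l (phi : nat -> nat) : (forall k, (k <= phi k)%nat) -> Un_cv u l ->
  Un_cv (fun k => u (phi k)) l.
Proof.
  intros Hphi Hu e He. destruct (Hu e He) as [N HN]. exists N. intros k Hk.
  apply HN. specialize (Hphi k). lia.
Qed.

Lemma inv_INR_cv e : 0 < e -> exists N, forall k, (N <= k)%nat -> / INR (S k) < e.
Proof.
  intros He. destruct (archimed_cor1 e He) as [N [HN HN0]]. exists N. intros k Hk.
  eapply Rle_lt_trans; [|exact HN]. apply Rinv_le_contravar; [now apply lt_0_INR|].
  apply le_INR. lia.
Qed.

(** Subsequences are encoded by k <= phi k, which preserves limits and is stable under composition.
    Bolzano-Weierstrass gives an accumulation point, and choice picks the indices. *)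
Lemma bounded_subseq u B : (forall k, - B <= u k <= B) ->
  exists phi l, (forall k : nat, (k <= phi k)%nat) /\ Un_cv (fun k => u (phi k)) l.
Proof.
  intros HB. destruct (Bolzano_Weierstrass u _ (compact_P3 (- B) B) HB) as [l Hl].
  assert (H : forall k : nat, exists q, (k <= q)%nat /\ Rabs (u q - l) < / INR (S k)).
  { intros k. assert (P : 0 < / INR (S k)) by (apply Rinv_0_lt_compat, lt_0_INR; lia).
    apply (Hl (disc l (mkposreal _ P)) k). exists (mkposreal _ P). now intros v Hv. }
  destruct (functional_choice _ H) as [phi Hphi]. exists phi, l. split; [apply Hphi|].
  intros e He. destruct (inv_INR_cv e He) as [N HN]. exists N. intros k Hk.
  unfold Rdist. eapply Rlt_trans; [apply Hphi|]. now apply HN.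
Qed.

Lemma bounded_list_subseq B (L : list (nat -> R)) : (forall u, In u L -> forall k, - B <= u k <= B) ->
  exists phi, (forall k : nat, (k <= phi k)%nat) /\
    forall u, In u L -> exists l, Un_cv (fun k => u (phi k)) l.
Proof.
  induction L as [|u L IH]; intros HB.
  - exists (fun k => k). split; [auto|]. intros u [].
  - destruct IH as [phi [Hphi HL]]; [intros; apply HB; now right|].
    destruct (bounded_subseq (fun k => u (phi k)) B) as [psi [l [Hpsi Hl]]].
    { intros k. apply HB. now left. }
    exists (fun k => phi (psi k)). split.
    + intros k. specialize (Hpsi k). specialize (Hphi (psi k)). lia.
    + intros v [<-|Hv]; [now exists l|]. destruct (HL v Hv) as [lv Hlv]. exists lv.
      apply (Un_cv_subseq (fun k => v (phi k))); assumption.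
Qed.

(** The finitely many entries are listed as bounded real sequences, and a common subsequence is
    extracted one entry at a time. *)
Lemma Splus_subseq z : (forall k, Splus (z k)) ->
  exists phi zs, (forall k : nat, (k <= phi k)%nat) /\ par_cv (fun k => z (phi k)) zs.
Proof.
  intros Hz.
  set (grid := fun m k (F : nat -> nat -> nat -> R) =>
    flat_map (fun i => map (fun j q => F q i j) (seq 0 k)) (seq 0 m)).
  assert (Hin : forall m k F i j, (i < m)%nat -> (j < k)%nat -> In (fun q => F q i j) (grid m k F)).
  { intros m k F i j Hi Hj. apply in_flat_map. exists i. split; [apply in_seq; lia|].
    apply in_map_iff. exists j. split; [reflexivity|apply in_seq; lia]. }
  assert (Hout : forall m k F u, In u (grid m k F) ->
    exists i j, (i < m)%nat /\ (j < k)%nat /\ u = fun q => F q i j).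
  { intros m k F u H. apply in_flat_map in H as [i [Hi H]]. apply in_map_iff in H as [j [<- Hj]].
    apply in_seq in Hi, Hj. exists i, j. repeat split; lia. }
  destruct (bounded_list_subseq (rw + rv + ru)
    (grid K n2 (fun q => PW (z q)) ++ grid n2 n1 (fun q => PV (z q)) ++ grid n1 d (fun q => PU (z q)))) as [phi [Hphi H]].
  { intros u Hu k. destruct (Splus_entries _ (Hz k)) as [N1 [N2 N3]].
    destruct (Splus_entries_le _ (Hz k)) as [L1 [L2 L3]].
    assert (B : forall v, 0 <= v -> v <= rw + rv + ru -> - (rw + rv + ru) <= v <= rw + rv + ru) by (intros; lra).
    apply in_app_or in Hu as [Hu|Hu]; [|apply in_app_or in Hu as [Hu|Hu]];
      apply Hout in Hu as [i [j [Hi [Hj ->]]]]; apply B; auto. }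
  assert (HC : forall m k F, incl (grid m k F) (grid K n2 (fun q => PW (z q)) ++ grid n2 n1 (fun q => PV (z q)) ++ grid n1 d (fun q => PU (z q))) ->
    exists Fs : nat -> nat -> R, forall i j, (i < m)%nat -> (j < k)%nat -> Un_cv (fun q => F (phi q) i j) (Fs i j)).
  { intros m k F HF.
    assert (E : forall ij : nat * nat, exists l, (fst ij < m)%nat -> (snd ij < k)%nat ->
       Un_cv (fun q => F (phi q) (fst ij) (snd ij)) l).
    { intros [i j]. simpl. destruct (lt_dec i m) as [Hi|Hi]; [|exists 0; intros; lia].
      destruct (lt_dec j k) as [Hj|Hj]; [|exists 0; intros; lia].
      destruct (H _ (HF _ (Hin m k F i j Hi Hj))) as [l Hl]. now exists l. }
    destruct (functional_choice _ E) as [Fs HFs]. exists (fun i j => Fs (i, j)).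
    intros i j. apply (HFs (i, j)). }
  destruct (HC K n2 (fun q => PW (z q))) as [W HW]; [intros u Hu; apply in_or_app; now left|].
  destruct (HC n2 n1 (fun q => PV (z q))) as [V HV];
    [intros u Hu; apply in_or_app; right; apply in_or_app; now left|].
  destruct (HC n1 d (fun q => PU (z q))) as [U HU];
    [intros u Hu; apply in_or_app; right; apply in_or_app; now right|].
  exists phi, (mkPar W V U). split; [exact Hphi|]. repeat split; auto.
Qed.

(** The loss is nonnegative because log-sum-exp dominates every output. *)
Lemma gain_le_sum i F : (i < n)%nat -> gain i F <= fsum K F.
Proof.
  intros Hi. unfold gain, loss.
  assert (S0 : exp (F (y i)) <= fsum K (fun j => exp (F j))).
  { apply (fsum_term_le K (fun j => exp (F j))); [intros; left; apply exp_pos|auto]. }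
  assert (F (y i) <= ln (fsum K (fun j => exp (F j)))); [|lra].
  rewrite <- (ln_exp (F (y i))).
  destruct S0 as [S0| ->]; [left; apply ln_increasing; [apply exp_pos|exact S0]|lra].
Qed.

Lemma Phi_bounded : exists B, forall z, Splus z -> Ph z <= B.
Proof.
  exists (1 / INR n * (INR n * (INR K * Cw))
    + eps * (INR K * (INR n2 * (rw + rv + ru)) + INR n2 * (INR n1 * (rw + rv + ru)) + INR n1 * (INR d * (rw + rv + ru)))).
  intros z Hz. pose proof (Splus_entries z Hz) as Nz. rewrite Phi_split. apply Rplus_le_compat.
  - apply Rmult_le_compat_l; [left; apply inv_n_pos|]. rewrite <- !fsum_const.
    apply fsum_le. intros i Hi. eapply Rle_trans; [now apply gain_le_sum|].
    apply fsum_le. intros r Hr.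
    eapply Rle_trans; [|apply (output_bound z i r (fun _ => 1)); auto using Splus_ball; intros; lra].
    right. apply fsum_ext. intros l Hl. now rewrite Rmult_1_l.
  - apply Rmult_le_compat_l; [lra|]. destruct (Splus_entries_le z Hz) as [L1 [L2 L3]].
    unfold total. rewrite <- !(fsum_const _ (rw + rv + ru)), <- !fsum_const.
    repeat apply Rplus_le_compat; apply fsum_le; intros; apply fsum_le; auto.
Qed.

(** The image of [Gmap] is normalized, so any nonnegative parameter produces a witness. *)
Lemma Splus_nonempty : exists z, Splus z.
Proof.
  set (one := fun _ _ : nat => 1). exists (Gmap (mkPar one one one)).
  apply Gmap_Spp. repeat split; unfold one; simpl; intros; lra.
Qed.

Lemma maximizer_exists : exists zs, Splus zs /\ forall z, Splus z -> Ph z <= Ph zs.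
Proof.
  destruct Phi_bounded as [B HB]. destruct Splus_nonempty as [z0 Hz0].
  destruct (completeness (fun v => exists z, Splus z /\ v = Ph z)) as [M [HM1 HM2]].
  - exists B. intros v [z [Hz ->]]. auto.
  - exists (Ph z0), z0. auto.
  - assert (E : forall k : nat, exists z, Splus z /\ M - / INR (S k) < Ph z).
    { intros k. apply NNPP. intros Hno.
      assert (P : 0 < / INR (S k)) by (apply Rinv_0_lt_compat, lt_0_INR; lia).
      assert (M <= M - / INR (S k)); [|lra]. apply HM2. intros v [z [Hz ->]].
      apply Rnot_lt_le. intros Hlt. apply Hno. exists z. auto. }
    destruct (functional_choice _ E) as [z Hz].
    destruct (Splus_subseq z (fun k => proj1 (Hz k))) as [phi [zs [Hphi Hcv]]].
    assert (Hzs : Splus zs) by (apply (Splus_closed _ _ Hcv); intros; apply Hz).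
    exists zs. split; [exact Hzs|].
    assert (HMs : Ph zs = M).
    { apply (UL_sequence (fun k => Ph (z (phi k)))); [now apply Phi_Un_cv|].
      intros e He. destruct (inv_INR_cv e He) as [N HN]. exists N. intros k Hk.
      unfold Rdist. apply Rabs_def1.
      - assert (Ph (z (phi k)) <= M) by (apply HM1; exists (z (phi k)); split; [apply Hz|reflexivity]). lra.
      - pose proof (proj2 (Hz (phi k))) as Q. specialize (Hphi k).
        specialize (HN (phi k) ltac:(lia)). lra. }
    intros w Hw. rewrite HMs. apply HM1. exists w. auto.
Qed.

(** * Maximizers are positive fixed points *)

(** Log-sum-exp grows by at most the largest increment of an output, hence by at most the sum D of
    the increments, which the added sum of outputs supplies. Being free of derivatives, the argument
    covers parameters with zero entries. *)
Lemma gain_mono i F F' : (i < n)%nat -> (forall j, (j < K)%nat -> F j <= F' j) -> gain i F <= gain i F'.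
Proof.
  intros Hi H. unfold gain, loss.
  set (D := fsum K (fun j => F' j + (-1) * F j)).
  assert (HD : D = fsum K F' - fsum K F) by (unfold D; rewrite fsum_plus, fsum_scal; lra).
  assert (S : forall G0 : nat -> R, 0 < fsum K (fun j => exp (G0 j))).
  { intros G0. apply fsum_pos with 0%nat; [intros; left; apply exp_pos|apply K_pos|apply exp_pos]. }
  assert (L : ln (fsum K (fun j => exp (F' j))) <= D + ln (fsum K (fun j => exp (F j)))).
  { rewrite <- (ln_exp D), <- ln_mult by (apply exp_pos || apply S).
    assert (Q : fsum K (fun j => exp (F' j)) <= exp D * fsum K (fun j => exp (F j))).
    { rewrite <- fsum_scal. apply fsum_le. intros j Hj. rewrite <- exp_plus. apply exp_le.
      assert (F' j + (-1) * F j <= D); [|lra].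
      apply (fsum_term_le K (fun j => F' j + (-1) * F j)); [|exact Hj].
      intros k Hk. specialize (H k Hk). lra. }
    destruct Q as [Q| ->]; [left; apply ln_increasing; [apply S|exact Q]|lra]. }
  specialize (H (y i) (Hy i Hi)). lra.
Qed.

(** The output of the true label and the sum of K outputs lose at most (K + 1) D together, while the
    log-sum-exp term moves in the favourable direction. *)
Lemma gain_shrink i F F' D : (i < n)%nat -> (forall j, (j < K)%nat -> F' j <= F j <= F' j + D) ->
  gain i F <= gain i F' + (INR K + 1) * D.
Proof.
  intros Hi H. unfold gain, loss.
  assert (S : 0 < fsum K (fun j => exp (F' j))).
  { apply fsum_pos with 0%nat; [intros; left; apply exp_pos|apply K_pos|apply exp_pos]. }
  assert (L : ln (fsum K (fun j => exp (F' j))) <= ln (fsum K (fun j => exp (F j)))).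
  { assert (Q : fsum K (fun j => exp (F' j)) <= fsum K (fun j => exp (F j))).
    { apply fsum_le. intros j Hj. apply exp_le. now apply H. }
    destruct Q as [Q| ->]; [left; now apply ln_increasing|lra]. }
  assert (Q : fsum K F <= fsum K F' + INR K * D).
  { rewrite <- fsum_const, <- fsum_plus. apply fsum_le. intros j Hj. now apply H. }
  specialize (H (y i) (Hy i Hi)). lra.
Qed.

(** With all constants 0, [close] is the entrywise order between nonnegative parameters. *)
Lemma close0_fnet_le z z' i r : close 0 0 0 z z' -> (i < n)%nat -> (r < K)%nat -> f z i r <= f z' i r.
Proof.
  intros H Hi Hr. destruct (fnet_ratio 0 0 0 z z' i r) as [_ Q]; auto; try lra.
  rewrite Rmult_0_r, Rplus_0_r, Rmult_0_l, Rplus_0_r, exp_0 in Q. lra.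
Qed.

Lemma Phi_mono z z' : close 0 0 0 z z' -> Ph z + eps * (total z' - total z) <= Ph z'.
Proof.
  intros H. rewrite !Phi_split.
  assert (1 / INR n * fsum n (fun i => gain i (fnet n1 n2 d alpha beta z (x i)))
    <= 1 / INR n * fsum n (fun i => gain i (fnet n1 n2 d alpha beta z' (x i)))); [|lra].
  apply Rmult_le_compat_l; [left; apply inv_n_pos|]. apply fsum_le. intros i Hi.
  apply gain_mono; [exact Hi|]. intros j Hj. now apply close0_fnet_le.
Qed.

Lemma close_total a z z' : close a a a z z' -> total z <= exp a * total z'.
Proof.
  intros [H1 [H2 H3]]. unfold total. apply ratio_le_plus.
  - apply ratio_le_plus; apply ratio_le_fsum; intros; apply ratio_le_fsum; auto.
  - apply ratio_le_fsum; intros; apply ratio_le_fsum; auto.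
Qed.

Lemma sub_exp_le s u v : 0 <= u -> u <= exp s * v -> u <= v + s * u.
Proof.
  intros Hu H. pose proof (exp_ineq1_le (- s)) as E. pose proof (exp_pos (- s)) as P.
  apply Rmult_le_compat_l with (r := exp (- s)) in H; [|lra].
  rewrite <- Rmult_assoc, <- exp_plus, Rplus_opp_l, exp_0 in H.
  assert ((1 - s) * u <= exp (- s) * u) by (apply Rmult_le_compat_r; lra). lra.
Qed.

(** Scaling entries down by factors no smaller than exp(-s) costs at most a multiple of s. The
    constant depends on z alone, and zero entries are allowed because z will be a maximizer not yet
    known to be positive. *)
Lemma Phi_shrink z : entries (Rle 0) z -> exists C, 0 <= C /\ forall s z', 0 <= s ->
  close 0 0 0 z' z -> close s s s z z' -> Ph z <= Ph z' + C * s.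
Proof.
  intros Hz. pose proof ainf_ge1 as A1. pose proof binf_ge1 as B1.
  (* M bounds the total degree of an output in the parameters: 1 from w and (1 + ainf) binf from v
     and u. *)
  set (M := 1 + (1 + ainf) * binf).
  assert (HM : 0 <= M) by (unfold M; nra).
  set (B := fsum n (fun i => fsum K (fun r => f z i r))).
  assert (Hf0 : forall i r, (i < n)%nat -> (r < K)%nat -> 0 <= f z i r).
  { intros i r Hi Hr. apply (fnet_ratio 0 0 0 z z); auto using close_refl; lra. }
  assert (HB : forall i r, (i < n)%nat -> (r < K)%nat -> f z i r <= B).
  { intros i r Hi Hr. apply (fsum2_term_le n K (fun i r => f z i r)); auto. }
  assert (HB0 : 0 <= B) by (apply (fsum2_nonneg n K (fun i r => f z i r)); auto).
  assert (HK : 0 <= INR K) by apply pos_INR.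
  pose proof (total_nonneg z Hz) as HT.
  set (C1 := (INR K + 1) * (M * B)).
  assert (HC1 : 0 <= C1) by (apply Rmult_le_pos; [lra|apply Rmult_le_pos; assumption]).
  exists (C1 + eps * total z). split; [apply Rplus_le_le_0_compat; [exact HC1|apply Rmult_le_pos; lra]|].
  intros s z' Hs H0 H1. rewrite !Phi_split.
  assert (Q1 : 1 / INR n * fsum n (fun i => gain i (fnet n1 n2 d alpha beta z (x i)))
    <= 1 / INR n * fsum n (fun i => gain i (fnet n1 n2 d alpha beta z' (x i))) + C1 * s).
  { replace (C1 * s) with (1 / INR n * (INR n * (C1 * s))) by (field; apply not_0_INR; lia).
    rewrite <- Rmult_plus_distr_l. apply Rmult_le_compat_l; [left; apply inv_n_pos|].
    rewrite <- fsum_const, <- fsum_plus. apply fsum_le. intros i Hi.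
    replace (C1 * s) with ((INR K + 1) * (s * M * B)) by (unfold C1; ring).
    apply gain_shrink; [exact Hi|]. intros j Hj. split; [now apply close0_fnet_le|].
    destruct (fnet_ratio s s s z z' i j) as [P0 P1]; auto.
    replace (s + (s + ainf * s) * binf) with (s * M) in P1 by (unfold M; ring).
    apply sub_exp_le in P1; [|exact P0].
    assert (s * M * f z i j <= s * M * B) by (apply Rmult_le_compat_l; [apply Rmult_le_pos|]; auto).
    lra. }
  pose proof (sub_exp_le s (total z) (total z') HT (close_total s z z' H1)) as Q2.
  assert (eps * total z <= eps * (total z' + s * total z)) by (apply Rmult_le_compat_l; lra).
  lra.
Qed.

(** * Single entries of all layers under one index, and exchanges within a block *)

Inductive coord : Set := cW (r l : nat) | cV (l m : nat) | cU (m s : nat).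

Lemma coord_eq_dec (c c' : coord) : {c = c'} + {c <> c'}.
Proof. decide equality; apply Nat.eq_dec. Qed.

Definition valid (c : coord) : Prop :=
  match c with
  | cW r l => (r < K)%nat /\ (l < n2)%nat
  | cV l m => (l < n2)%nat /\ (m < n1)%nat
  | cU m s => (m < n1)%nat /\ (s < d)%nat
  end.

Definition get (z : Par) (c : coord) : R :=
  match c with cW r l => PW z r l | cV l m => PV z l m | cU m s => PU z m s end.

Definition put (z : Par) (c : coord) (t : R) : Par :=
  match c with
  | cW r l => mkPar (upd2 (PW z) r l t) (PV z) (PU z)
  | cV l m => mkPar (PW z) (upd2 (PV z) l m t) (PU z)
  | cU m s => mkPar (PW z) (PV z) (upd2 (PU z) m s t)
  end.

(* Coordinates subject to the same norm constraint. *)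
Definition same_block (c c' : coord) : Prop :=
  match c, c' with
  | cW r _, cW r' _ => r = r' | cV _ _, cV _ _ => True | cU _ _, cU _ _ => True | _, _ => False
  end.

Definition exponent (c : coord) : R := match c with cW _ _ => pw | cV _ _ => pv | cU _ _ => pu end.

Definition unit_par (c : coord) : Par := put (mkPar zero zero zero) c 1.

Lemma exponent_gt1 c : 1 < exponent c.
Proof. destruct c; assumption. Qed.

Lemma get_put_same z c t : get (put z c t) c = t.
Proof. destruct c; simpl; apply upd2_eq. Qed.

Lemma get_put_other z c c' t : c <> c' -> get (put z c t) c' = get z c'.
Proof.
  intros H. destruct c as [a b|a b|a b], c' as [a' b'|a' b'|a' b']; simpl; try reflexivity;
    unfold upd2; destruct (Nat.eqb_spec a' a), (Nat.eqb_spec b' b); simpl; congruence.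
Qed.

Lemma entries_get P z : entries P z <-> forall c, valid c -> P (get z c).
Proof.
  split.
  - intros [H1 [H2 H3]] [a b|a b|a b] [Ha Hb]; simpl; auto.
  - intros H. split; [|split]; intros a b Ha Hb.
    + apply (H (cW a b)); split; assumption.
    + apply (H (cV a b)); split; assumption.
    + apply (H (cU a b)); split; assumption.
Qed.

Lemma same_get z z' : (forall c, valid c -> get z c = get z' c) -> same z z'.
Proof.
  intros H. split; [|split]; intros a b Ha Hb.
  - apply (H (cW a b)); split; assumption.
  - apply (H (cV a b)); split; assumption.
  - apply (H (cU a b)); split; assumption.
Qed.

Lemma close_get s z z' : (forall c, valid c -> ratio_le s (get z c) (get z' c)) -> close s s s z z'.
Proof.
  intros H. split; [|split]; intros a b Ha Hb.
  - apply (H (cW a b)); split; assumption.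
  - apply (H (cV a b)); split; assumption.
  - apply (H (cU a b)); split; assumption.
Qed.

Lemma path_deriv_get p t dz :
  (forall c, valid c -> derivable_pt_lim (fun s => get (p s) c) t (get dz c)) -> path_deriv p t dz.
Proof.
  intros H. split; [|split]; intros a b Ha Hb.
  - apply (H (cW a b)); split; assumption.
  - apply (H (cV a b)); split; assumption.
  - apply (H (cU a b)); split; assumption.
Qed.

Lemma fsum_change N g g' k : (k < N)%nat -> (forall j, (j < N)%nat -> j <> k -> g' j = g j) ->
  fsum N g' = fsum N g - g k + g' k.
Proof.
  intros Hk H.
  assert (E : fsum N (fun j => if Nat.eqb j k then 0 else g' j) = fsum N (fun j => if Nat.eqb j k then 0 else g j)).
  { apply fsum_ext. intros j Hj. destruct (Nat.eqb_spec j k); auto. }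
  rewrite !fsum_except in E by exact Hk. lra.
Qed.

Lemma fsum2_upd2 (h : R -> R) m k F a b t : (a < m)%nat -> (b < k)%nat ->
  fsum m (fun i => fsum k (fun j => h (upd2 F a b t i j)))
  = fsum m (fun i => fsum k (fun j => h (F i j))) - h (F a b) + h t.
Proof.
  intros Ha Hb.
  rewrite (fsum_change m (fun i => fsum k (fun j => h (F i j))) (fun i => fsum k (fun j => h (upd2 F a b t i j))) a Ha).
  - rewrite (fsum_change k (fun j => h (F a j)) (fun j => h (upd2 F a b t a j)) b Hb).
    + rewrite upd2_eq. lra.
    + intros j _ Hj. unfold upd2. destruct (Nat.eqb_spec j b); [lia|]. now rewrite Bool.andb_false_r.
  - intros i _ Hi. apply fsum_ext. intros j _. unfold upd2. destruct (Nat.eqb_spec i a); [lia|reflexivity].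
Qed.

Lemma total_put z c t : valid c -> total (put z c t) = total z - get z c + t.
Proof.
  destruct c as [a b|a b|a b]; intros [Ha Hb]; unfold total; simpl;
    [pose proof (fsum2_upd2 id K n2 (PW z) a b t Ha Hb) as E
    |pose proof (fsum2_upd2 id n2 n1 (PV z) a b t Ha Hb) as E
    |pose proof (fsum2_upd2 id n1 d (PU z) a b t Ha Hb) as E];
    unfold id in E;
    match type of E with ?l = ?s - _ + _ => set (L := l) in *; set (S0 := s) in * end.
  - change (L + fsum n2 (fun l => fsum n1 (PV z l)) + fsum n1 (fun m => fsum d (PU z m))
      = S0 + fsum n2 (fun l => fsum n1 (PV z l)) + fsum n1 (fun m => fsum d (PU z m)) - PW z a b + t). lra.
  - change (fsum K (fun r => fsum n2 (PW z r)) + L + fsum n1 (fun m => fsum d (PU z m))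
      = fsum K (fun r => fsum n2 (PW z r)) + S0 + fsum n1 (fun m => fsum d (PU z m)) - PV z a b + t). lra.
  - change (fsum K (fun r => fsum n2 (PW z r)) + fsum n2 (fun l => fsum n1 (PV z l)) + L
      = fsum K (fun r => fsum n2 (PW z r)) + fsum n2 (fun l => fsum n1 (PV z l)) + S0 - PU z a b + t). lra.
Qed.

Definition norms (z : Par) : Prop :=
  (forall r, (r < K)%nat -> fsum 1 (fun _ => fsum n2 (fun l => rpow (Rabs (PW z r l)) pw)) = rpow rw pw) /\
  fsum n2 (fun l => fsum n1 (fun m => rpow (Rabs (PV z l m)) pv)) = rpow rv pv /\
  fsum n1 (fun m => fsum d (fun s => rpow (Rabs (PU z m s)) pu)) = rpow ru pu.

Lemma Splus_norms z : Splus z <-> entries (Rle 0) z /\ norms z.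
Proof.
  assert (PW0 : 0 < pw) by lra. assert (PV0 : 0 < pv) by lra. assert (PU0 : 0 < pu) by lra. split.
  - intros Hz. split; [now apply Splus_entries|]. destruct Hz as [_ [_ [_ [NW [NV NU]]]]].
    split; [|split].
    + intros r Hr. specialize (NW r Hr). rewrite lpnorm_row in NW. now apply lpnorm2_sum in NW.
    + now apply lpnorm2_sum in NV.
    + now apply lpnorm2_sum in NU.
  - intros [[H1 [H2 H3]] [NW [NV NU]]]. repeat split; auto.
    + intros r Hr. rewrite lpnorm_row. apply lpnorm2_sum; auto.
    + apply lpnorm2_sum; auto.
    + apply lpnorm2_sum; auto.
Qed.

Lemma exchange_Splus z c c' t t' : Splus z -> valid c -> valid c' -> same_block c c' -> c <> c' ->
  0 <= t -> 0 <= t' ->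
  rpow t (exponent c) + rpow t' (exponent c) = rpow (get z c) (exponent c) + rpow (get z c') (exponent c) ->
  Splus (put (put z c t) c' t').
Proof.
  intros Hz Hc Hc' Hb Hne Ht Ht' E. apply Splus_norms in Hz as [Hz N]. pose proof Hz as Hz0.
  rewrite entries_get in Hz. apply Splus_norms. split.
  - apply entries_get. intros e He. destruct (coord_eq_dec c' e) as [<-|E1]; [now rewrite get_put_same|].
    rewrite get_put_other by exact E1. destruct (coord_eq_dec c e) as [<-|E2]; [now rewrite get_put_same|].
    rewrite get_put_other by exact E2. auto.
  - pose proof (Hz c Hc) as G1. pose proof (Hz c' Hc') as G2.
    pose proof (get_put_other z c c' t Hne) as G3.
    destruct N as [NW [NV NU]].
    destruct c as [a b|a b|a b], c' as [a' b'|a' b'|a' b']; simpl in Hb; try contradiction;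
      destruct Hc as [Ha Hb1], Hc' as [Ha' Hb1']; simpl in G1, G2, G3, E.
    + subst a'. split; [|split]; auto. intros r Hr. rewrite <- (NW r Hr). simpl. f_equal.
      destruct (Nat.eq_dec r a) as [->|Hr'].
      * assert (b <> b') by congruence.
        rewrite (fsum_change n2 (fun l => rpow (Rabs (upd2 (PW z) a b t a l)) pw) _ b' Hb1').
        -- rewrite (fsum_change n2 (fun l => rpow (Rabs (PW z a l)) pw) _ b Hb1).
           ++ rewrite !upd2_eq, G3, !Rabs_pos_eq by assumption. lra.
           ++ intros j _ Hj. unfold upd2. destruct (Nat.eqb_spec j b); [lia|]. now rewrite Bool.andb_false_r.
        -- intros j _ Hj. unfold upd2 at 1. destruct (Nat.eqb_spec j b'); [lia|]. now rewrite Bool.andb_false_r.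
      * apply fsum_ext. intros j _. unfold upd2. destruct (Nat.eqb_spec r a); [lia|reflexivity].
    + split; [|split]; auto. simpl.
      rewrite !(fsum2_upd2 (fun v => rpow (Rabs v) pv)), G3, NV, !Rabs_pos_eq by assumption. lra.
    + split; [|split]; auto. simpl.
      rewrite !(fsum2_upd2 (fun v => rpow (Rabs v) pu)), G3, NU, !Rabs_pos_eq by assumption. lra.
Qed.

Lemma block_nonzero z c : Splus z -> valid c -> exists c', valid c' /\ same_block c c' /\ get z c' <> 0.
Proof.
  intros Hz Hc. apply Splus_norms in Hz as [_ [NW [NV NU]]].
  assert (H : forall m k F p rho, 0 < rho ->
    fsum m (fun i => fsum k (fun j => rpow (Rabs (F i j)) p)) = rpow rho p ->
    exists i j, (i < m)%nat /\ (j < k)%nat /\ F i j <> 0).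
  { intros m k F p rho Hrho E. pose proof (rpow_gt0 rho p Hrho) as P.
    destruct (fsum_neq0_term m (fun i => fsum k (fun j => rpow (Rabs (F i j)) p))) as [i [Hi E1]]; [lra|].
    destruct (fsum_neq0_term k (fun j => rpow (Rabs (F i j)) p)) as [j [Hj E2]]; [exact E1|].
    exists i, j. repeat split; auto. intros E3. apply E2. now rewrite E3, Rabs_R0, rpow_0. }
  destruct c as [a b|a b|a b]; destruct Hc as [Ha Hb].
  - destruct (H 1%nat n2 (fun _ => PW z a) pw rw Hrw (NW a Ha)) as [i [j [Hi [Hj E]]]].
    exists (cW a j). repeat split; auto.
  - destruct (H n2 n1 (PV z) pv rv Hrv NV) as [i [j [Hi [Hj E]]]]. exists (cV i j). repeat split; auto.
  - destruct (H n1 d (PU z) pu ru Hru NU) as [i [j [Hi [Hj E]]]]. exists (cU i j). repeat split; auto.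
Qed.

(* Taking s in the exponent off a coordinate of value v frees room for a coordinate of order
   s^(1/p), which is much larger than s. *)
Lemma small_transfer p v e C : 1 < p -> 0 < v -> 0 < e -> 0 <= C ->
  exists s t, 0 <= s /\ 0 <= t /\ rpow t p + rpow (exp (- s) * v) p = rpow v p /\ C * s < e * t.
Proof.
  intros Hp Hv He HC.
  assert (Hq : 0 < 1 - 1 / p).
  { assert (1 / p < 1); [|lra]. apply Rmult_lt_reg_r with p; [lra|].
    unfold Rdiv. rewrite Rmult_assoc, Rinv_l; lra. }
  (* With s = 2 g the claim reduces to 2 C g^(1 - 1/p) < e v, which this threshold ensures; 2 C + 1
     also covers C = 0. *)
  assert (Hd' : 0 < e * v / (2 * C + 1)) by (apply Rdiv_lt_0_compat; nra).
  destruct (rpow_small (1 - 1 / p) _ Hq Hd') as [dl [Hdl Hsm]].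
  set (g := Rmin (dl / 2) (1 / 2)).
  assert (Hg : 0 < g) by (unfold g; apply Rmin_glb_lt; lra).
  assert (Hg1 : g <= 1 / 2) by apply Rmin_r.
  assert (Hg2 : g < dl) by (eapply Rle_lt_trans; [apply Rmin_l|lra]).
  specialize (Hsm g Hg2). set (s := 2 * g).
  (* w is the fraction of v^p that is released; it is at least g because exp u >= 1 + u and g <=
     1/2. *)
  set (w := 1 - exp (- (s * p))).
  assert (Hw : g <= w).
  { assert (Hps : 0 < s * p) by (unfold s; nra).
    assert (exp (- (s * p)) <= / (1 + s * p)).
    { rewrite exp_Ropp. apply Rinv_le_contravar; [lra|]. apply exp_ineq1_le. }
    assert (/ (1 + s * p) <= 1 - g); [|unfold w; lra].
    apply Rmult_le_reg_r with (1 + s * p); [lra|]. rewrite Rinv_l by lra. unfold s in *. nra. }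
  exists s, (v * rpow w (1 / p)).
  assert (Hw0 : 0 <= rpow w (1 / p)) by apply rpow_nonneg.
  repeat split.
  - unfold s; lra.
  - apply Rmult_le_pos; lra.
  - rewrite !rpow_mul by (lra || (left; apply exp_pos)). rewrite rpow_exp, (rpow_cancel w) by (lra || (field; lra)).
    unfold w. replace (- s * p) with (- (s * p)) by ring. ring.
  - assert (Hgw : rpow g (1 / p) <= rpow w (1 / p)).
    { apply rpow_le; [lra|]. left; apply Rdiv_lt_0_compat; lra. }
    assert (E : g = rpow g (1 - 1 / p) * rpow g (1 / p)).
    { rewrite <- rpow_add. replace (1 - 1 / p + 1 / p) with 1 by ring. symmetry. apply rpow_1. lra. }
    pose proof (rpow_gt0 g (1 / p) Hg) as P.
    apply Rlt_le_trans with (e * (v * rpow g (1 / p))).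
    + unfold s. rewrite E at 1.
      replace (C * (2 * (rpow g (1 - 1 / p) * rpow g (1 / p)))) with ((2 * C * rpow g (1 - 1 / p)) * rpow g (1 / p)) by ring.
      rewrite <- Rmult_assoc. apply Rmult_lt_compat_r; [exact P|].
      apply Rmult_lt_compat_r with (r := 2 * C + 1) in Hsm; [|lra].
      unfold Rdiv in Hsm. rewrite Rmult_assoc, Rinv_l in Hsm by lra.
      pose proof (rpow_gt0 g (1 - 1 / p) Hg). lra.
    + apply Rmult_le_compat_l; [lra|]. apply Rmult_le_compat_l; lra.
Qed.

Definition maximizer (z : Par) : Prop := Splus z /\ forall z', Splus z' -> Ph z' <= Ph z.

Lemma maximizer_pos z : maximizer z -> Spp z.
Proof.
  intros [Hz Hmax]. pose proof (Splus_entries z Hz) as Nz. split; [exact Hz|].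
  change (entries (Rlt 0) z). apply entries_get. intros c Hc. rewrite entries_get in Nz.
  destruct (Nz c Hc) as [H|H0]; [exact H|exfalso].
  destruct (block_nonzero z c Hz Hc) as [c' [Hc' [Hb Hv]]].
  assert (Hv0 : 0 < get z c') by (destruct (Nz c' Hc'); [assumption|congruence]).
  assert (Hne : c <> c') by congruence.
  destruct (Phi_shrink z (Splus_entries z Hz)) as [C [HC Hshrink]].
  destruct (small_transfer (exponent c) (get z c') eps C (exponent_gt1 c) Hv0 Heps HC)
    as [s [t [Hs [Ht [E Hgain]]]]].
  (* z1 only shrinks the positive entry c'; z2 also raises c from 0 to t, which restores the norm.
     The first move loses at most C s, the second gains at least eps t, which is larger. *)
  set (v := exp (- s) * get z c'). set (z1 := put z c' v). set (z2 := put (put z c t) c' v).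
  assert (Hv1 : 0 <= v) by (apply Rmult_le_pos; [left; apply exp_pos|lra]).
  assert (Hes : exp (- s) <= 1) by (rewrite <- exp_0; apply exp_le; lra).
  assert (Hvz : v <= get z c') by (unfold v; nra).
  assert (M : Ph z2 <= Ph z).
  { apply Hmax, exchange_Splus; auto. fold v in E. rewrite E, <- H0, rpow_0. ring. }
  assert (S1 : Ph z <= Ph z1 + C * s).
  { apply Hshrink; [exact Hs| |]; apply close_get; intros e He; unfold z1;
      (destruct (coord_eq_dec c' e) as [<-|E1]; [rewrite get_put_same|rewrite get_put_other by exact E1]).
    - split; [exact Hv1|rewrite exp_0; lra].
    - apply ratio_le_refl; [lra|auto].
    - split; [lra|]. unfold v. rewrite <- Rmult_assoc, <- exp_plus, Rplus_opp_r, exp_0. lra.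
    - apply ratio_le_refl; auto. }
  assert (S2 : Ph z1 + eps * (total z2 - total z1) <= Ph z2).
  { apply Phi_mono. apply close_get. intros e He. unfold z1, z2.
    destruct (coord_eq_dec c' e) as [<-|E1]; [rewrite !get_put_same; apply ratio_le_refl; lra|].
    rewrite !(get_put_other _ c') by exact E1.
    destruct (coord_eq_dec c e) as [<-|E2]; [rewrite get_put_same, <- H0; split; [lra|rewrite exp_0; lra]|].
    rewrite get_put_other by exact E2. apply ratio_le_refl; [lra|auto]. }
  unfold z1, z2 in S2. rewrite !total_put, get_put_other in S2 by assumption.
  fold z1 z2 in S2. rewrite <- H0 in S2. lra.
Qed.

(** * Lagrange conditions and fixed points *)

Definition lin_comb (a b : R) (z z' : Par) : Par := mkPar
  (fun i j => a * PW z i j + b * PW z' i j) (fun i j => a * PV z i j + b * PV z' i j)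
  (fun i j => a * PU z i j + b * PU z' i j).

Lemma fsum_linear N a b g h : fsum N (fun i => a * g i + b * h i) = a * fsum N g + b * fsum N h.
Proof. now rewrite fsum_plus, !fsum_scal. Qed.

(** Splits the derivative along a path that moves two entries into two partial derivatives. *)
Lemma dPhi_linear z a b u v : dPhi z (lin_comb a b u v) = a * dPhi z u + b * dPhi z v.
Proof.
  assert (HH : forall xi m, hidden (lin_comb a b u v) xi m = a * hidden u xi m + b * hidden v xi m).
  { intros. unfold hidden. rewrite <- fsum_linear. apply fsum_ext. intros; simpl; ring. }
  assert (HI : forall xi l, dinner z (lin_comb a b u v) xi l = a * dinner z u xi l + b * dinner z v xi l).
  { intros. unfold dinner. rewrite <- fsum_linear. apply fsum_ext. intros; rewrite HH; simpl; ring. }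
  assert (HF : forall xi r, dfnet z (lin_comb a b u v) xi r = a * dfnet z u xi r + b * dfnet z v xi r).
  { intros. unfold dfnet. rewrite <- fsum_linear. apply fsum_ext. intros; rewrite HI; simpl; ring. }
  assert (HT : total (lin_comb a b u v) = a * total u + b * total v).
  { unfold total. simpl.
    assert (H2 : forall m k F F', fsum m (fun i => fsum k (fun j => a * F i j + b * F' i j))
      = a * fsum m (fun i => fsum k (F i)) + b * fsum m (fun i => fsum k (F' i))).
    { intros. rewrite <- fsum_linear. apply fsum_ext. intros. apply fsum_linear. }
    rewrite !H2. ring. }
  unfold dPhi. rewrite HT.
  rewrite (fsum_ext n (fun i => fsum K (fun r => coef i z r * dfnet z (lin_comb a b u v) (x i) r))
    (fun i => a * fsum K (fun r => coef i z r * dfnet z u (x i) r) + b * fsum K (fun r => coef i z r * dfnet z v (x i) r))).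
  - rewrite fsum_linear. ring.
  - intros i Hi. rewrite <- fsum_linear. apply fsum_ext. intros r Hr. rewrite HF. ring.
Qed.

Lemma Phi_ext z z' : same z z' -> Ph z = Ph z'.
Proof.
  intros H. rewrite !Phi_split, (total_ext z z' H). do 2 f_equal. apply fsum_ext. intros i Hi.
  unfold gain, loss. rewrite (fsum_ext K _ _ (fun j Hj => fnet_ext z z' i j H Hj)).
  rewrite (fsum_ext K (fun j => exp (f z i j)) (fun j => exp (f z' i j))).
  - now rewrite (fnet_ext z z' i (y i) H (Hy i Hi)).
  - intros j Hj. now rewrite (fnet_ext z z' i j H Hj).
Qed.

(* Moves two coordinates of a block along the sphere of that block. *)
Lemma maximizer_lagrange z c c' : maximizer z -> valid c -> valid c' -> same_block c c' ->
  dPhi z (unit_par c) * rpow (get z c) (1 - exponent c) = dPhi z (unit_par c') * rpow (get z c') (1 - exponent c).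
Proof.
  intros Hmz Hc Hc' Hb. destruct (coord_eq_dec c c') as [<-|Hne]; [reflexivity|].
  pose proof (Spp_entries z (maximizer_pos z Hmz)) as Pz. destruct Hmz as [Hz Hmax].
  pose proof Pz as Gz. rewrite entries_get in Gz.
  pose proof (Gz c Hc) as G1. pose proof (Gz c' Hc') as G2. pose proof (exponent_gt1 c) as Hp.
  set (p := exponent c) in *. set (X := rpow (get z c) p). set (Y := rpow (get z c') p).
  assert (HX : 0 < X) by now apply rpow_gt0. assert (HY : 0 < Y) by now apply rpow_gt0.
  (* The two entries are parametrized by their p-th powers X + t and Y - t, so the norm is constant
     along the path. *)
  set (path := fun t => put (put z c (rpow (X + t) (1 / p))) c' (rpow (Y + - t) (1 / p))).
  set (dX := 1 / p * rpow X (1 / p - 1) * 1). set (dY := 1 / p * rpow Y (1 / p - 1) * (- 1)).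
  set (dz := put (put (mkPar zero zero zero) c dX) c' dY).
  assert (E0 : same z (path 0)).
  { apply same_get. intros e He. unfold path. rewrite Ropp_0, !Rplus_0_r.
    unfold X, Y. rewrite !rpow_cancel by (lra || (field; lra)).
    destruct (coord_eq_dec c' e) as [<-|E1]; [now rewrite get_put_same|].
    rewrite get_put_other by exact E1. destruct (coord_eq_dec c e) as [<-|E2]; [now rewrite get_put_same|].
    now rewrite get_put_other by exact E2. }
  assert (Hpath : path_deriv path 0 dz).
  { apply path_deriv_get. intros e He. unfold path, dz.
    destruct (coord_eq_dec c' e) as [<-|E1].
    - apply (derivable_pt_lim_ext (fun s => rpow (Y + - s) (1 / p))); [intros; now rewrite get_put_same|].
      rewrite get_put_same. unfold dY.
      replace (rpow Y (1 / p - 1)) with (rpow (Y + - 0) (1 / p - 1)) by (f_equal; ring).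
      apply (rpow_derivable (fun s => Y + - s)); [lra|].
      pose proof (derivable_pt_lim_plus _ _ _ _ _ (derivable_pt_lim_const Y 0)
        (derivable_pt_lim_opp _ _ _ (derivable_pt_lim_id 0))) as D. rewrite Rplus_0_l in D. exact D.
    - apply (derivable_pt_lim_ext (fun s => get (put z c (rpow (X + s) (1 / p))) e));
        [intros; now rewrite (get_put_other _ c') by exact E1|].
      rewrite (get_put_other _ c') by exact E1.
      destruct (coord_eq_dec c e) as [<-|E2].
      + apply (derivable_pt_lim_ext (fun s => rpow (X + s) (1 / p))); [intros; now rewrite get_put_same|].
        rewrite get_put_same. unfold dX.
        replace (rpow X (1 / p - 1)) with (rpow (X + 0) (1 / p - 1)) by (f_equal; ring).
        apply (rpow_derivable (fun s => X + s)); [lra|].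
        pose proof (derivable_pt_lim_plus _ _ _ _ _ (derivable_pt_lim_const X 0)
          (derivable_pt_lim_id 0)) as D. rewrite Rplus_0_l in D. exact D.
      + apply (derivable_pt_lim_ext (fct_cte (get z e))); [intros; now rewrite get_put_other by exact E2|].
        rewrite get_put_other by exact E2. replace (get (mkPar zero zero zero) e) with 0 by (destruct e; reflexivity).
        apply derivable_pt_lim_const. }
  pose proof (Phi_derivable path 0 dz Hpath (entries_ext _ _ _ E0 Pz)) as D.
  set (h := Rmin X Y). assert (Hh : 0 < h) by (unfold h; now apply Rmin_glb_lt).
  assert (Hh1 : h <= X) by apply Rmin_l. assert (Hh2 : h <= Y) by apply Rmin_r.
  (* For |t| < h both powers remain positive and the path stays in the constraint set, so t = 0 is
     an interior maximum. *)
  assert (D0 : dPhi (path 0) dz = 0).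
  { apply (deriv_maximum (fun s => Ph (path s)) (- h) h 0 (exist _ _ D)); [lra|lra|].
    intros t Ht1 Ht2. rewrite <- (Phi_ext _ _ E0). apply Hmax. apply exchange_Splus; auto; try apply rpow_nonneg.
    fold p. rewrite !rpow_cancel by (lra || (field; lra)). fold X Y. ring. }
  rewrite <- (dPhi_ext z _ dz dz E0 (same_refl dz)) in D0.
  rewrite (dPhi_ext z z dz (lin_comb dX dY (unit_par c) (unit_par c')) (same_refl z)) in D0.
  - rewrite dPhi_linear in D0. unfold dX, dY, X, Y in D0. rewrite !rpow_rpow in D0.
    replace (p * (1 / p - 1)) with (1 - p) in D0 by (field; lra).
    apply Rmult_eq_reg_l with (1 / p); [lra|].
    apply Rgt_not_eq. apply Rdiv_lt_0_compat; lra.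
  - apply same_get. intros e He.
    replace (get (lin_comb dX dY (unit_par c) (unit_par c')) e) with (dX * get (unit_par c) e + dY * get (unit_par c') e)
      by (destruct e; reflexivity).
    unfold dz, unit_par. destruct (coord_eq_dec c' e) as [<-|E1].
    + rewrite !get_put_same, get_put_other by exact Hne.
      replace (get (mkPar zero zero zero) c') with 0 by (destruct c'; reflexivity). ring.
    + rewrite !(get_put_other _ c') by exact E1.
      replace (get (mkPar zero zero zero) e) with 0 by (destruct e; reflexivity).
      destruct (coord_eq_dec c e) as [<-|E2]; [rewrite !get_put_same; ring|].
      rewrite !get_put_other by exact E2. replace (get (mkPar zero zero zero) e) with 0 by (destruct e; reflexivity).
      ring.
Qed.

(** The Lagrange condition says g = mu F^(p - 1). The map psi with the dual exponent inverts the
    power p - 1, so it sends g to q F with q = mu^(p' - 1), and the normalization removes q. *)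
Lemma normal_of_lagrange m k p rho g F : (0 < m)%nat -> (0 < k)%nat -> 1 < p -> 0 < rho ->
  positive m k g -> positive m k F -> lpnorm2 p m k F = rho ->
  (forall i j, (i < m)%nat -> (j < k)%nat ->
     g i j * rpow (F i j) (1 - p) = g 0%nat 0%nat * rpow (F 0%nat 0%nat) (1 - p)) ->
  forall i j, (i < m)%nat -> (j < k)%nat -> normal m k p rho g i j = F i j.
Proof.
  intros Hm Hk Hp Hrho Hg HF HN HL i j Hi Hj.
  set (mu := g 0%nat 0%nat * rpow (F 0%nat 0%nat) (1 - p)).
  assert (Hmu : 0 < mu) by (apply Rmult_lt_0_compat; [|apply rpow_gt0]; auto).
  set (q := rpow mu (conj p - 1)). assert (Hq : 0 < q) by now apply rpow_gt0.
  assert (Hpsi : forall a b, (a < m)%nat -> (b < k)%nat -> psi (conj p) (g a b) = q * F a b).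
  { intros a b Ha Hb. specialize (HL a b Ha Hb). fold mu in HL.
    specialize (Hg a b Ha Hb). specialize (HF a b Ha Hb). rewrite psi_pos_eq by exact Hg.
    assert (E : g a b = mu * rpow (F a b) (p - 1)).
    { rewrite <- HL, Rmult_assoc, <- rpow_add. replace (1 - p + (p - 1)) with 0 by ring.
      rewrite (rpow_pos_eq _ 0), Rpower_O by assumption. ring. }
    rewrite E, rpow_mul by (lra || apply rpow_nonneg). fold q. f_equal.
    apply rpow_cancel; [lra|now apply conj_m1]. }
  unfold normal. rewrite (lpnorm2_ext p m k _ (fun a b => q * F a b) Hpsi).
  rewrite lpnorm2_scal, HN, Hpsi by (assumption || lra). field. lra.
Qed.

Lemma maximizer_fixed z : maximizer z -> same (Gmap z) z.
Proof.
  intros Hm. pose proof (maximizer_pos z Hm) as Hz.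
  pose proof (Spp_entries z Hz) as Pz. pose proof Pz as [P1 [P2 P3]].
  destruct (grad_positive z (entries_pos_nonneg z Pz)) as [G1 [G2 G3]].
  pose proof (proj1 Hz) as [_ [_ [_ [NW [NV NU]]]]].
  assert (L : forall c c', valid c -> valid c' -> same_block c c' ->
    dPhi z (unit_par c) * rpow (get z c) (1 - exponent c) = dPhi z (unit_par c') * rpow (get z c') (1 - exponent c)).
  { intros; now apply maximizer_lagrange. }
  split; [|split]; intros a b Ha Hb; simpl.
  - apply (normal_of_lagrange 1 n2 pw rw (fun _ l => dPhi z (unitW a l)) (fun _ => PW z a)); auto.
    + intros i j Hi Hj. auto.
    + rewrite <- lpnorm_row. auto.
    + intros i j Hi Hj. apply (L (cW a j) (cW a 0)); repeat split; auto.
  - apply (normal_of_lagrange n2 n1); auto.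
    intros i j Hi Hj. apply (L (cV i j) (cV 0 0)); repeat split; auto.
  - apply (normal_of_lagrange n1 d); auto.
    intros i j Hi Hj. apply (L (cU i j) (cU 0 0)); repeat split; auto.
Qed.

(** * Uniqueness and geometric convergence *)

Lemma geometric_to_0 C q : 0 < C -> 0 <= q < 1 -> Un_cv (fun k => C * q ^ k) 0.
Proof.
  intros HC Hq e He.
  destruct (pow_lt_1_zero q ltac:(rewrite Rabs_pos_eq; lra) (e / C)) as [N HN].
  { now apply Rdiv_lt_0_compat. }
  exists N. intros k Hk. unfold Rdist. rewrite Rminus_0_r, Rabs_mult, (Rabs_pos_eq C) by lra.
  specialize (HN k Hk). apply Rmult_lt_compat_l with (r := C) in HN; [|exact HC].
  replace (C * (e / C)) with e in HN by (field; lra). exact HN.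
Qed.

Lemma geometric_squeeze (u : nat -> R) C q : 0 < C -> 0 <= q < 1 ->
  (forall k, 0 <= u k <= C * q ^ k) -> Un_cv u 0.
Proof.
  intros HC Hq Hu e He. destruct (geometric_to_0 C q HC Hq e He) as [N HN].
  exists N. intros k Hk. specialize (HN k Hk). specialize (Hu k). unfold Rdist in *.
  rewrite Rminus_0_r in *. rewrite Rabs_pos_eq in * by lra. lra.
Qed.

Lemma fixed_step z : Spp z -> same (Gmap z) z -> G z z.
Proof.
  intros Hz [E1 [E2 E3]].
  destruct (Gmap_step z (Spp_entries z Hz)) as [gW [gV [gU [D [F1 [F2 F3]]]]]].
  exists gW, gV, gU. split; [exact D|].
  split; [|split]; intros; [rewrite <- E1, <- F1|rewrite <- E2, <- F2|rewrite <- E3, <- F3]; auto.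
Qed.

Lemma unique_maximizer_and_rate rhoA :
  is_spectral_radius (K + 2) (Amat K pw pv pu Cw Cv Cu ainf binf) rhoA -> rhoA < 1 ->
  exists zs : Par,
    Spp zs /\ (forall z, Splus z -> Ph z <= Ph zs) /\
    (forall z, Splus z -> (forall z', Splus z' -> Ph z' <= Ph z) -> distinf K n1 n2 d z zs = 0) /\
    (forall z0, Spp z0 ->
       (exists s : nat -> Par, s O = z0 /\ forall k, G (s k) (s (S k))) /\
       (forall s : nat -> Par, s O = z0 -> (forall k, G (s k) (s (S k))) ->
          Un_cv (fun k => distinf K n1 n2 d (s k) zs) 0 /\
          exists Rc, 0 < Rc /\ forall k, distinf K n1 n2 d (s k) zs <= Rc * rhoA ^ k)).
Proof.
  intros Hrad Hlt.
  destruct (perron_exists rhoA Hrad) as [lam [xw [xv [xu [HP Hle]]]]].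
  pose proof HP as [Hl _].
  destruct maximizer_exists as [zs Hzs].
  pose proof (maximizer_pos zs Hzs) as Pzs. pose proof (maximizer_fixed zs Hzs) as Fzs.
  (* The contraction gives the rate lam^k, and 0 < lam <= rhoA. *)
  assert (Rate : forall z0, Spp z0 -> exists C, 0 < C /\ forall s : nat -> Par, s O = z0 ->
    (forall k, G (s k) (s (S k))) -> forall k, distinf K n1 n2 d (s k) zs <= C * rhoA ^ k).
  { intros z0 Hz0. destruct (iterates_rate lam xw xv xu zs z0 HP ltac:(lra) Pzs Fzs Hz0) as [C [HC H]].
    exists C. split; [exact HC|]. intros s Hs0 HG k. eapply Rle_trans; [now apply H|].
    apply Rmult_le_compat_l; [lra|]. apply pow_incr. lra. }
  exists zs. split; [exact Pzs|]. split; [apply Hzs|]. split.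
  (* A second maximizer is a fixed point, so the constant sequence is an orbit; its distance to zs
     is at most C rhoA^k for every k, hence 0. *)
  - intros z Hz Hmax. assert (Hm : maximizer z) by now split.
    destruct (Rate z (maximizer_pos z Hm)) as [C [HC H]].
    specialize (H (fun _ => z) eq_refl
      (fun _ => fixed_step z (maximizer_pos z Hm) (maximizer_fixed z Hm))). simpl in H.
    symmetry. apply (Un_cv_eq_const (fun _ => distinf K n1 n2 d z zs)); [|reflexivity].
    apply (geometric_squeeze _ C rhoA HC); [lra|]. intros k. split; [apply distinf_nonneg|apply H].
  - intros z0 Hz0. split.
    + exists (fun k => Nat.iter k Gmap z0). split; [reflexivity|]. intros k.
      assert (Hk : Spp (Nat.iter k Gmap z0)).
      { induction k as [|k IH]; [exact Hz0|].
        apply Gmap_Spp, entries_pos_nonneg, Spp_entries, IH. }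
      apply Gmap_step, Spp_entries, Hk.
    + intros s Hs0 HG. destruct (Rate z0 Hz0) as [C [HC H]]. specialize (H s Hs0 HG). split.
      * apply (geometric_squeeze _ C rhoA HC); [lra|]. intros k. split; [apply distinf_nonneg|apply H].
      * exists C. auto.
Qed.

End Network.

Theorem mainTheorem13 (n d K n1 n2 : nat) (x : nat -> nat -> R) (y : nat -> nat)
  (pw pv pu rw rv ru eps : R) (alpha beta : nat -> R) (rhoA : R)
  (Hn : (1 <= n)%nat) (Hd : (1 <= d)%nat) (Hn1 : (1 <= n1)%nat) (Hn2 : (1 <= n2)%nat)
  (Hx : forall i s, (i < n)%nat -> (s < d)%nat -> 0 <= x i s)
  (Hy : forall i, (i < n)%nat -> (y i < K)%nat)
  (Hpw : 1 < pw) (Hpv : 1 < pv) (Hpu : 1 < pu)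
  (Hrw : 0 < rw) (Hrv : 0 < rv) (Hru : 0 < ru) (Heps : 0 < eps)
  (Halpha : forall m, (m < n1)%nat -> 1 <= alpha m)
  (Hbeta : forall l, (l < n2)%nat -> 1 <= beta l) :
  let rx := fmax n (fun i => lpnorm (conj pu) d (x i)) in
  let theta := rv * Psi (conj pv) pu n1 alpha (fun _ => 1) (ru * rx) in
  let Cw := rw * Psi (conj pw) pv n2 beta (fun _ => 1) theta in
  let Cv := rw * Psi (conj pw) pv n2 beta beta theta in
  let Cu := linf n1 alpha * Cv in
  let A := Amat K pw pv pu Cw Cv Cu (linf n1 alpha) (linf n2 beta) in
  let Ph := Phi K n n1 n2 d alpha beta eps x y in
  is_spectral_radius (K + 2) A rhoA -> rhoA < 1 ->
  exists zs : Par,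
    InSpp K n1 n2 d pw pv pu rw rv ru zs /\
    (forall z, InSplus K n1 n2 d pw pv pu rw rv ru z -> Ph z <= Ph zs) /\
    (forall z, InSplus K n1 n2 d pw pv pu rw rv ru z ->
       (forall z', InSplus K n1 n2 d pw pv pu rw rv ru z' -> Ph z' <= Ph z) ->
       distinf K n1 n2 d z zs = 0) /\
    (forall z0, InSpp K n1 n2 d pw pv pu rw rv ru z0 ->
       (exists s : nat -> Par, s O = z0 /\
          forall k, Gstep K n1 n2 d pw pv pu rw rv ru Ph (s k) (s (S k))) /\
       (forall s : nat -> Par, s O = z0 ->
          (forall k, Gstep K n1 n2 d pw pv pu rw rv ru Ph (s k) (s (S k))) ->
          Un_cv (fun k => distinf K n1 n2 d (s k) zs) 0 /\
          exists Rc, 0 < Rc /\ forall k, distinf K n1 n2 d (s k) zs <= Rc * rhoA ^ k)).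
Proof.
  intros rx theta Cw Cv Cu A Ph. now apply unique_maximizer_and_rate.
Qed.
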